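(* Fix $\alpha > 1$ and let $f:\mathbb{N}\to(0,\infty)$ satisfy $f(n) = \Theta(n^{\alpha})$ as $n\to\infty$. Let $\{T_n^1\}_{n\ge1}$ and $\{T_n^2\}_{n\ge1}$ be two independent sequences of randomly growing trees with attachment function $f$, and let $X_n$ be the number of vertices of the largest common (unlabeled) subtree of $T_n^1$ and $T_n^2$. Then the following hold: (i) If $\alpha > 2$, then the sequence $\{n - X_n\}_{n\geq 1}$ converges almost surely to an almost surely finite limit. (ii) If $\alpha = 2$, then the sequence of random variables $\{(n - X_n)/\log n\}_{n\geq 2}$ is tight. (iii) If $\alpha\in(1,2)$, then the sequence of random variables $\{(n - X_n)\,n^{\alpha-2}\}_{n\geq 1}$ is tight. In particular, in each of the cases $\alpha>2$, $\alpha=2$, and $\alpha\in(1,2)$ (that is, for every $\alpha>1$), $X_n = (1-o(1))n$ with high probability; that is, there is a deterministic sequence $\epsilon_n\to0$ such that $\mathbb{P}(X_n \ge (1-\epsilon_n)n)\to1$ as $n\to\infty$.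
   Context: $\mathbb{N}=\{1,2,3,\ldots\}$. The sequence of randomly growing trees with attachment function $f$: $T_1$ is a single vertex, $T_2$ is the unique tree on two vertices, and for $n\ge 2$, given $T_n$ with vertices $v_1,\ldots,v_n$, the tree $T_{n+1}$ is formed by adding a new vertex $v_{n+1}$ and joining it by an edge to a random existing vertex $u$ with $$\mathbb{P}(u = v_i \mid T_n) = \frac{f(d_{T_n}(v_i))}{\sum_{j=1}^n f(d_{T_n}(v_j))},$$ where $d_{T_n}(v)$ is the degree of $v$ in $T_n$. The size of the largest common subtree of two finite trees $T^1,T^2$ (viewed as unlabeled, unrooted graphs) is the maximum of $|S|$ (number of vertices of $S$) over all trees $S$ isomorphic both to a subtree of $T^1$ and to a subtree of $T^2$. *)

(* Defs.v *)
From HB Require Import structures.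
From mathcomp Require Export all_boot all_order all_algebra.
From mathcomp Require Export all_classical all_reals all_analysis.

Set Implicit Arguments.
Unset Strict Implicit.
Unset Printing Implicit Defensive.

Export Order.TTheory GRing.Theory Num.Theory.
Export numFieldNormedType.Exports.

Open Scope classical_set_scope.
Open Scope ring_scope.

(* A simple graph whose vertices form a subset of the finite type V; an edge
   is a two-element set of vertices. *)
Record sgraph (V : finType) := SGraph {
  verts : {set V};
  edges : {set {set V}};
  edges_verts : [forall e in edges, (#|e| == 2)%N && (e \subset verts)] }.

Section Graphs.
Context {V : finType}.
Implicit Types G H : sgraph V.

Definition adj G : rel V := fun x y => [set x; y]%SET \in edges G.

Definition deg G (x : V) : nat := #|[set e in edges G | x \in e]%SET|.

Definition connected_graph G :=
  forall x y, x \in verts G -> y \in verts G -> connect (adj G) x y.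

(* A cycle has at least three vertices: [:: x; y] is a ucycle of adj G as soon
   as xy is an edge. *)
Definition acyclic_graph G := forall c : seq V, ucycle (adj G) c -> (size c < 3)%N.

Definition is_tree G :=
  [/\ verts G != finset.set0, connected_graph G & acyclic_graph G].

Definition subgraph H G := (verts H \subset verts G) /\ (edges H \subset edges G).

Definition subtree H G := subgraph H G /\ is_tree H.

End Graphs.

Definition graph_iso (V W : finType) (G : sgraph V) (H : sgraph W) :=
  exists phi : V -> W,
    [/\ {in verts G &, injective phi},
        phi @: verts G = verts H &
        {in verts G &, forall x y, adj H (phi x) (phi y) = adj G x y}].

Definition iso_to_subtree (U V : finType) (S : sgraph U) (G : sgraph V) :=
  exists2 H : sgraph V, subtree H G & graph_iso S H.

Definition common_subtree (U V W : finType)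
    (S : sgraph U) (G : sgraph V) (H : sgraph W) :=
  [/\ is_tree S, iso_to_subtree S G & iso_to_subtree S H].

(* The bound on k is harmless: see lcs_size_ub. *)
Definition lcs_size (V W : finType) (G : sgraph V) (H : sgraph W) : nat :=
  \max_(k < #|verts G|.+1 |
        `[< exists (U : finType) (S : sgraph U),
              common_subtree S G H /\ #|verts S| = k >]) k.

Lemma iso_to_subtree_card (U V : finType) (S : sgraph U) (G : sgraph V) :
  iso_to_subtree S G -> (#|verts S| <= #|verts G|)%N.
Proof.
move=> [H [[HG _] _] [phi [phi_inj phiS _]]].
by rewrite -(card_in_imset phi_inj) phiS subset_leq_card.
Qed.

Lemma lcs_size_ub (U V W : finType)
    (S : sgraph U) (G : sgraph V) (H : sgraph W) :
  common_subtree S G H -> (#|verts S| <= lcs_size G H)%N.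
Proof.
move=> SGH; have [_ /iso_to_subtree_card SG _] := SGH.
have lt : (#|verts S| < #|verts G|.+1)%N by [].
apply: (@leq_bigmax_cond _ _ (fun k : 'I__ => val k) (Ordinal lt)).
by apply/asboolP; exists U, S.
Qed.

Lemma lcs_size_attained (U0 V W : finType)
    (S0 : sgraph U0) (G : sgraph V) (H : sgraph W) :
  common_subtree S0 G H ->
  exists (U : finType) (S : sgraph U),
    common_subtree S G H /\ #|verts S| = lcs_size G H.
Proof.
move=> SGH; have [_ /iso_to_subtree_card SG _] := SGH.
have lt : (#|verts S0| < #|verts G|.+1)%N by [].
have P0 : `[< exists (U : finType) (S : sgraph U),
     common_subtree S G H /\ #|verts S| = Ordinal lt >].
  by apply/asboolP; exists U0, S0.
rewrite /lcs_size (bigop.bigmax_eq_arg _ P0).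
by case: arg_maxnP => //= k /asboolP.
Qed.

(* The labelled tree on v_1, ..., v_n is a graph on 'I_n, with v_i represented
   by the ordinal i - 1; widen_ord keeps the labels of old vertices and ord_max
   is the new vertex. *)
Definition old_vertex n : 'I_n -> 'I_n.+1 := widen_ord (leqnSn n).

Lemma attach_proof n (G : sgraph 'I_n) (u : 'I_n) :
  let E := ([set old_vertex u; ord_max] |:
            [set (@old_vertex n @: (e : {set 'I_n}))%SET | e in edges G])%SET in
  [forall e in E,
    (#|e : {set 'I_n.+1}| == 2)%N && (e \subset [set: 'I_n.+1]%SET)].
Proof.
apply/forall_inP => e; rewrite finset.subsetT andbT.
case/setU1P=> [->|/imsetP[e' e'G ->]].
  by rewrite cards2 -val_eqE /= neq_ltn ltn_ord.
rewrite card_imset; last by move=> i j /(congr1 val) /= /val_inj.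
by have /forall_inP/(_ _ e'G)/andP[] := edges_verts G.
Qed.

Definition attach n (G : sgraph 'I_n) (u : 'I_n) : sgraph 'I_n.+1 :=
  SGraph (attach_proof G u).

Section Processes.
Context {d : measure_display} {Omega : measurableType d} {R : realType}.
Implicit Types (P : probability Omega R) (T : forall n, Omega -> sgraph 'I_n).

(* The attachment probabilities given T_n are stated in product form, on each
   atom {T_n = t}; there, as attach t is injective, {T_{n+1} = attach t i} is
   the event that the new vertex is joined to i. The graph T 0 on 'I_0 is the
   empty graph and plays no role, as does the value f 0. *)
Record growing_trees P (f : nat -> R) T : Prop := GrowingTrees {
  growing_measurable : forall n (t : sgraph 'I_n), measurable (T n @^-1` [set t]);
  growing_verts : forall n w, verts (T n w) = [set: 'I_n]%SET;
  growing_one : forall w, edges (T 1%N w) = finset.set0;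
  growing_two : forall w, edges (T 2%N w) = [set [set: 'I_2]]%SET;
  growing_attach : forall n w, (2 <= n)%N ->
    exists u : 'I_n, T n.+1 w = attach (T n w) u;
  growing_law : forall n (t : sgraph 'I_n) (i : 'I_n), (2 <= n)%N ->
    P (T n @^-1` [set t] `&` T n.+1 @^-1` [set attach t i]) =
    (P (T n @^-1` [set t]) *
      (f (deg t i) / \sum_(j < n) f (deg t j))%:E)%E }.

Definition process_events T : set_system Omega :=
  <<s [set A | exists n (t : sgraph 'I_n), (0 < n)%N /\ A = T n @^-1` [set t]] >>.

Definition independent_processes P T T' :=
  forall A B, process_events T A -> process_events T' B ->
    P (A `&` B) = (P A * P B)%E.

Definition tight P (D : set nat) (Y : nat -> Omega -> R) :=
  forall eps : R, 0 < eps ->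
    exists2 K : set R, compact K &
      forall n, D n -> (P (Y n @^-1` ~` K) <= eps%:E)%E.

End Processes.

(* Main.v *)
From HB Require Import structures.
Require Import Defs.
From mathcomp Require Import zify ring lra.

Set Implicit Arguments.
Unset Strict Implicit.
Unset Printing Implicit Defensive.

(** Write alpha = 1 + s. In a superlinear preferential attachment tree one vertex,
the hub, eventually receives almost all new edges. The loss of a tree on n
vertices is n - 1 minus its largest degree. Two trees contain stars around
their vertices of largest degree, so n - X_n is at most the larger of the two
losses ([defect_le]), and everything reduces to one tree at a time: if
growth n = 1 + sum of m^-s over 1 <= m < n, then the loss at time n exceeds
K growth n with a probability that is small, uniformly in n, when K is large
([loss_tail]). This growth is bounded, logarithmic or of order n^(1 - s)
according to whether s > 1, s = 1 or s < 1, which gives both tightness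
statements, and it is o(n) for every s > 0, which gives the last claim.

For s > 1 the loss, which never decreases, is almost surely bounded, hence
eventually constant. From then on every new vertex is a leaf at one fixed hub
([hub_forever]). A largest common subtree misses boundedly many vertices, so
it contains leaves at the hub of the first tree, hence the hub itself, and
must send it to the only vertex of large degree of the second tree; when both
trees grow by one leaf, so does the common subtree ([lcs_size_attach]). Thus
n - X_n is eventually nonincreasing, and it is a natural number.

The degree sequence of the tree is itself a Markov chain, and [loss_tail] is
a statement about it, proved with (super)martingales.

- The largest degree D tends to infinity, and once it is large the mean of
  D^-q at time n is O(n^-2) for a suitable q ([Ex_maxdeg_moment]).

- Fix two vertices, of degrees a and b. A new edge at the second one moves the
  tail sum of 1 / f from b by exactly 1 / f b, so that it decreases at a rate
  which does not depend on b. This makes the product of f a, ..., f (k - 1)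
  with the (k - a)-th power of that tail sum a supermartingale ([mean_reach]),
  which bounds the probability that the first vertex ever reaches degree k.
  Taking for the second vertex the one of largest degree at the birth of the
  first, these probabilities are summable for k large: only finitely many
  vertices ever reach degree k ([late_large_small]).

- Two given vertices cannot both have unbounded degrees. For every real l the
  real part of the product of the 1 + i l / f j for j < a and of the
  1 - i l / f j for j < b is a martingale ([mean_dot]). When a and b both tend
  to infinity it approaches the largest value that it can take, whereas it is
  negligible compared with that value when one of the degrees stays bounded
  and l is large; hence ties have probability zero ([both_large_small]).

- So, up to a small probability, all degrees but one stay below some K
  ([crowded_small]). Under this condition the mean of (n / D)^q stays bounded
  ([Ex_spread]), and the probability that a new vertex misses the hub at time
  n is at most a constant times n / D^(1 + s) = n^-s (n / D)^(1 + s). Summing over n and using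
  the Markov inequality gives [loss_tail]. *)

(** * The Markov chain of degree sequences *)

Notation dg := (nth 0%N).

(** The degree sequence after a new vertex, appended last, has been joined
    to the vertex of index [i]. *)
Definition grow (s : seq nat) (i : nat) : seq nat := rcons (incr_nth s i) 1%N.

(** These arithmetic constraints are all that is used of the fact that the
    entries are the degrees of a tree. *)
Definition treelike (s : seq nat) : bool :=
  [&& (2 <= size s)%N, all (fun d => 0 < d)%N s & sumn s == (size s).-1.*2].

Definition maxdeg (s : seq nat) : nat := \max_(d <- s) d.

Definition loss (s : seq nat) : nat := ((size s).-1 - maxdeg s)%N.

Definition crowded (K : nat) (s : seq nat) : bool :=
  (1 < count (fun d => K <= d)%N s)%N.

Lemma size_grow s i : (i < size s)%N -> size (grow s i) = (size s).+1.
Proof. by move=> si; rewrite size_rcons size_incr_nth si. Qed.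

Lemma nth_grow s i j : (i < size s)%N ->
  dg (grow s i) j = if (j < size s)%N then ((i == j) + dg s j)%N
                         else (j == size s) : nat.
Proof.
move=> si; rewrite nth_rcons size_incr_nth si nth_incr_nth.
by case: ltnP => // _; case: eqP.
Qed.

Lemma sumn_incr_nth s i : sumn (incr_nth s i) = (sumn s).+1.
Proof.
elim: s i => [|x s IH] [|i] //=.
  by rewrite -/(sumn _) sumn_ncons.
by rewrite -/(sumn _) IH addnS.
Qed.

Lemma treelike_grow s i : treelike s -> (i < size s)%N -> treelike (grow s i).
Proof.
case/and3P => s2 /allP spos /eqP ssum si; rewrite /treelike size_grow //.
apply/and3P; split; first by rewrite ltnW.
- apply/(all_nthP 0%N) => j; rewrite size_grow // nth_grow // ltnS leq_eqVlt.
  case: ltnP => [js _|]; last by case: eqP.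
  by rewrite ltn_addl //; apply: spos; rewrite mem_nth.
- by rewrite /grow sumn_rcons sumn_incr_nth ssum; lia.
Qed.

Lemma treelike_nth_gt0 s j : treelike s -> (j < size s)%N -> (0 < dg s j)%N.
Proof. by case/and3P => _ /allP spos _ js; apply: spos; rewrite mem_nth. Qed.

Lemma nth_le_maxdeg s j : (dg s j <= maxdeg s)%N.
Proof.
case: (ltnP j (size s)) => [js|]; last by move=> /(nth_default 0%N) ->.
by rewrite /maxdeg; apply: leq_bigmax_seq => //; rewrite mem_nth.
Qed.

Lemma maxdeg_attained s : (0 < size s)%N ->
  exists2 w, (w < size s)%N & dg s w = maxdeg s.
Proof.
elim: s => // x [|y s] IH _.
  by exists 0%N => //=; rewrite /maxdeg big_seq1.
have [//|w ws wm] := IH; rewrite /maxdeg big_cons.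
case: (leqP (\max_(j <- y :: s) j) x) => h.
  by exists 0%N => //=; apply/esym/maxn_idPl.
by exists w.+1 => //; rewrite /= in wm *; rewrite wm; apply/esym/maxn_idPr/ltnW.
Qed.

Lemma maxdeg_le s m : (forall j, (j < size s)%N -> (dg s j <= m)%N) ->
  (maxdeg s <= m)%N.
Proof.
move=> h; apply/bigmax_leqP_seq => d /(nthP 0%N)[j js <-] _; exact: h.
Qed.

Lemma maxdeg_gt0 s : treelike s -> (0 < maxdeg s)%N.
Proof.
move=> ts; have [s2 _ _] := and3P ts.
by apply: leq_trans (nth_le_maxdeg s 0%N); apply: treelike_nth_gt0 => //; lia.
Qed.

Lemma maxdeg_grow s i : treelike s -> (i < size s)%N ->
  maxdeg (grow s i) = maxn (maxdeg s) (dg s i).+1.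
Proof.
move=> ts si; apply/eqP; rewrite eqn_leq; apply/andP; split.
- apply: maxdeg_le => j; rewrite size_grow // nth_grow // => _.
  have := nth_le_maxdeg s j; have := maxdeg_gt0 ts.
  case: (ltnP j) => [js|_]; last by case: (_ == _) => /=; lia.
  by case: eqP => [->|_] /=; lia.
- have lt0 : (0 < size s)%N by lia.
  have [w ws wm] := maxdeg_attained lt0.
  rewrite geq_max -wm; apply/andP; split.
  + apply: leq_trans (nth_le_maxdeg _ w).
    by rewrite nth_grow // ws; lia.
  + apply: leq_trans (nth_le_maxdeg _ i).
    by rewrite nth_grow // si eqxx.
Qed.

Lemma sumn_ge_size s : all (fun d => 0 < d)%N s -> (size s <= sumn s)%N.
Proof. by elim: s => //= x s IH /andP[x0 /IH]; lia. Qed.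

Lemma sumn_nth_ge s j : all (fun d => 0 < d)%N s -> (j < size s)%N ->
  (dg s j + (size s).-1 <= sumn s)%N.
Proof.
elim: s j => //= x s IH [|j] /andP[x0 h] js /=.
  by rewrite leq_add2l sumn_ge_size.
by have := IH j h js; lia.
Qed.

Lemma maxdeg_lt_size s : treelike s -> (maxdeg s <= (size s).-1)%N.
Proof.
case/and3P => s2 h /eqP hs.
have lt0 : (0 < size s)%N by lia.
by have [w ws <-] := maxdeg_attained lt0; have := sumn_nth_ge h ws; lia.
Qed.

Lemma crowded_grow K s i : crowded K s -> crowded K (grow s i).
Proof.
rewrite /crowded /grow -cats1 count_cat => h; apply: leq_trans h _.
apply: leq_trans (leq_addr _ _).
elim: s i => [|x s IH] [|i] //=; last by rewrite leq_add2l.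
by rewrite leq_add2r; case: (leqP K x) => // h; rewrite (leq_trans h).
Qed.

Lemma crowdedP K s i j : (i < j)%N -> (j < size s)%N ->
  (K <= dg s i)%N -> (K <= dg s j)%N -> crowded K s.
Proof.
rewrite /crowded; elim: s i j => // x s IH [|i] [|j] //= ij js ci cj; last first.
  by apply: leq_trans (IH i j ij js ci cj) _; rewrite leq_addl.
by rewrite ci -[1%N]addn0 ltn_add2l -has_count; apply/(has_nthP 0%N); exists j.
Qed.

Lemma crowded_ex K s : crowded K s ->
  exists i j, [/\ (i < j)%N, (j < size s)%N,
                  (K <= dg s i)%N & (K <= dg s j)%N].
Proof.
rewrite /crowded; elim: s => //= x s IH.
case: (leqP K x) => h /=; last first.
  by rewrite add0n => /IH[i [j [ij js ci cj]]]; exists i.+1, j.+1.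
rewrite -[1%N]addn0 ltn_add2l -has_count => /(has_nthP 0%N)[j js cj].
by exists 0%N, j.+1.
Qed.

(** A second vertex of degree at least [K] would make two of them, because
    the vertex of largest degree is then one as well. *)
Lemma nth_lt_of_uncrowded K s w j : ~~ crowded K s -> dg s w = maxdeg s ->
  (w < size s)%N -> (j < size s)%N -> j != w -> (dg s j < K)%N.
Proof.
move=> nc wm ws js jw; rewrite ltnNge; apply/negP => cj; case/negP: nc.
have cw : (K <= dg s w)%N by rewrite wm (leq_trans cj) // nth_le_maxdeg.
by case: (ltngtP j w) jw => // h _; [exact: (crowdedP h)|exact: (crowdedP h)].
Qed.

(** The loss records exactly the steps at which the new vertex misses the
    largest degree; this is what turns bounds on the probability of a miss into
    bounds on the loss. *)
Lemma loss_grow s i : treelike s -> (i < size s)%N ->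
  loss (grow s i) = (loss s + (dg s i != maxdeg s))%N.
Proof.
move=> ts si; rewrite /loss maxdeg_grow // size_grow //=.
have := maxdeg_lt_size ts; have := nth_le_maxdeg s i.
have [s2 _ _] := and3P ts.
by case: eqP => /= h; lia.
Qed.

Section Chain.
Context {R : realType} (f : nat -> R) (f_gt0 : forall n, (0 < n)%N -> 0 < f n).

Definition weight (s : seq nat) : R := \sum_(i < size s) f (dg s i).

(** One step of the chain, acting on functions of the degree sequence: the
    conditional expectation of [F] after the next attachment. *)
Definition mean (F : seq nat -> R) (s : seq nat) : R :=
  \sum_(i < size s) f (dg s i) / weight s * F (grow s i).

(** The expectation of [F] after [k] attachments, as a function of the starting
    sequence. Composition of these operators is the Markov property, so that no
    path space is needed for the estimates. *)
Definition Ex k (F : seq nat -> R) : seq nat -> R := iter k mean F.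

Lemma weight_ge s i : treelike s -> (i < size s)%N -> f (dg s i) <= weight s.
Proof.
move=> ts si; rewrite /weight (bigD1 (Ordinal si)) //= lerDl sumr_ge0 // => j _.
by apply/ltW/f_gt0/treelike_nth_gt0.
Qed.

Lemma weight_gt0 s : treelike s -> 0 < weight s.
Proof.
move=> ts; have [s2 _ _] := and3P ts.
by apply: lt_le_trans (weight_ge ts (ltnW s2)); apply/f_gt0/treelike_nth_gt0/ltnW.
Qed.

Lemma prob_ge0 s i : treelike s -> (i < size s)%N -> 0 <= f (dg s i) / weight s.
Proof.
move=> ts si; rewrite divr_ge0 ?(ltW (weight_gt0 ts)) //.
by apply/ltW/f_gt0/treelike_nth_gt0.
Qed.

Lemma prob_sum1 s : treelike s -> \sum_(i < size s) f (dg s i) / weight s = 1.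
Proof. by move=> ts; rewrite -mulr_suml divff // gt_eqF // weight_gt0. Qed.

Lemma mean_le F G s : treelike s ->
  (forall i, (i < size s)%N -> F (grow s i) <= G (grow s i)) -> mean F s <= mean G s.
Proof.
move=> ts h; apply: ler_sum => i _; apply: ler_wpM2l; last exact: h.
exact: prob_ge0.
Qed.

Lemma mean_cst c s : treelike s -> mean (fun=> c) s = c.
Proof. by move=> ts; rewrite /mean -mulr_suml prob_sum1 // mul1r. Qed.

Lemma meanD F G s : mean (fun t => F t + G t) s = mean F s + mean G s.
Proof. by rewrite /mean -big_split; apply: eq_bigr => i _; rewrite mulrDr. Qed.

Lemma meanZ c F s : mean (fun t => c * F t) s = c * mean F s.
Proof. by rewrite /mean mulr_sumr; apply: eq_bigr => i _; rewrite mulrCA. Qed.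

Lemma mean_eq F G s : (forall i, (i < size s)%N -> F (grow s i) = G (grow s i)) ->
  mean F s = mean G s.
Proof. by move=> h; apply: eq_bigr => i _; rewrite h. Qed.

(** When few attachments change the value of [F], comparing with that value
    [b] leaves few terms in the sum. *)
Lemma mean_base b F s : treelike s -> mean F s =
  b + \sum_(i < size s) f (dg s i) / weight s * (F (grow s i) - b).
Proof.
move=> ts; rewrite -[X in X + _](mean_cst b ts) /mean -big_split /=.
by apply: eq_bigr => i _; rewrite -mulrDr addrC subrK.
Qed.

Lemma mean_le1 b F s w : treelike s -> (w < size s)%N ->
  (forall i, (i < size s)%N -> i != w -> F (grow s i) <= b) ->
  mean F s <= b + f (dg s w) / weight s * (F (grow s w) - b).
Proof.
move=> ts ws h; rewrite (mean_base b) // lerD2l (bigD1 (Ordinal ws)) //= gerDl.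
apply: sumr_le0 => i iw; apply: mulr_ge0_le0; first exact: prob_ge0.
by rewrite subr_le0 h.
Qed.

Lemma mean_le2 b F s u v : treelike s -> (u < size s)%N -> (v < size s)%N -> u != v ->
  (forall i, (i < size s)%N -> i != u -> i != v -> F (grow s i) <= b) ->
  mean F s <= b + f (dg s u) / weight s * (F (grow s u) - b)
                + f (dg s v) / weight s * (F (grow s v) - b).
Proof.
move=> ts us vs uv h; rewrite (mean_base b) // -addrA lerD2l.
rewrite (bigD1 (Ordinal us)) //= lerD2l (bigD1 (Ordinal vs)) /=; last first.
  by rewrite -val_eqE eq_sym.
rewrite gerDl; apply: sumr_le0 => i /andP[iu iv].
by apply: mulr_ge0_le0; [exact: prob_ge0 | rewrite subr_le0 h].
Qed.

Lemma ExS k F s : Ex k.+1 F s = Ex k (mean F) s.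
Proof. by rewrite /Ex iterSr. Qed.

Lemma Ex_add j k F s : Ex (j + k) F s = Ex j (Ex k F) s.
Proof. by rewrite /Ex iterD. Qed.

Lemma Ex_le k F G s : treelike s ->
  (forall t, treelike t -> size t = (k + size s)%N -> F t <= G t) -> Ex k F s <= Ex k G s.
Proof.
elim: k F G s => [|k IH] F G s ts h; first exact: h.
rewrite !ExS; apply: IH => // t tt tsz; apply: mean_le => // i it.
by apply: h; [exact: treelike_grow|rewrite size_grow // tsz].
Qed.

Lemma Ex_eq k F G s : treelike s ->
  (forall t, treelike t -> size t = (k + size s)%N -> F t = G t) -> Ex k F s = Ex k G s.
Proof.
by move=> ts h; apply/eqP; rewrite eq_le !Ex_le // => t tt tsz; rewrite h.
Qed.

Lemma Ex_cst k c s : treelike s -> Ex k (fun=> c) s = c.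
Proof.
elim: k s => // k IH s ts; rewrite ExS -[RHS](IH s ts).
by apply: Ex_eq => // t tt _; rewrite mean_cst.
Qed.

Lemma ExD k F G s : Ex k (fun t => F t + G t) s = Ex k F s + Ex k G s.
Proof.
elim: k s => // k IH s; rewrite /Ex !iterS -/(Ex _ _) -meanD.
by apply: mean_eq => i _; exact: IH.
Qed.

Lemma ExZ k c F s : Ex k (fun t => c * F t) s = c * Ex k F s.
Proof.
elim: k s => // k IH s; rewrite /Ex !iterS -meanZ.
by apply: mean_eq => i _; exact: IH.
Qed.

Lemma Ex_sum k m (F : nat -> seq nat -> R) s :
  Ex k (fun t => \sum_(i < m) F i t) s = \sum_(i < m) Ex k (F i) s.
Proof.
elim: m => [|m IH]; last first.
  rewrite big_ord_recr /= -IH -ExD; congr (Ex k _ s).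
  by apply/funext => t; rewrite big_ord_recr.
rewrite big_ord0; have -> : (fun t => \sum_(i < 0) F i t) = (fun t => 0 * 0).
  by apply/funext => t; rewrite big_ord0 mul0r.
by rewrite ExZ mul0r.
Qed.

(** Supermartingales are only needed while the chain stays in a region [Q]
    that it cannot leave. *)
Lemma Ex_supermart (Q : pred (seq nat)) (F : seq nat -> R) k s :
  (forall t i, Q t -> (i < size t)%N -> Q (grow t i)) ->
  (forall t, Q t -> treelike t) ->
  (forall t, Q t -> mean F t <= F t) ->
  Q s -> Ex k F s <= F s.
Proof.
move=> Qg Qt QF; elim: k s => // k IH s Qs; rewrite /Ex iterS.
apply: le_trans (QF _ Qs); apply: mean_le; first exact: Qt.
by move=> i si; apply: IH; apply: Qg.
Qed.

Lemma Ex_le_on (Q : pred (seq nat)) (F G : seq nat -> R) k s :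
  (forall t i, Q t -> (i < size t)%N -> Q (grow t i)) ->
  (forall t, Q t -> treelike t) ->
  (forall t, Q t -> size t = (k + size s)%N -> F t <= G t) ->
  Q s -> Ex k F s <= Ex k G s.
Proof.
move=> Qg Qt; elim: k F G s => [|k IH] F G s h Qs; first exact: h.
rewrite !ExS; apply: IH => // t tt tsz; apply: mean_le; first exact: Qt.
by move=> i it; apply: h; [exact: Qg | rewrite size_grow // tsz].
Qed.

End Chain.

(** * Real powers and logarithms of integers *)

Section PowerSums.
Context {R : realType}.
Implicit Types (s : R).

(** The inequality 1 + x <= exp x at x = - 1 / (k + 1), inverted. *)
Lemma ratio_ge_expR k : (0 < k)%N -> expR (k.+1%:R^-1) <= k.+1%:R / k%:R :> R.
Proof.
move=> k0; have kp : 0 < k%:R :> R by rewrite ltr0n.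
have k1p : 0 < k.+1%:R :> R by rewrite ltr0n.
have := expR_ge1Dx (- (k.+1%:R^-1) : R); rewrite expRN => h.
rewrite -[leLHS]invrK -[leRHS]invrK lef_pV2 ?posrE ?invr_gt0 ?divr_gt0 ?expR_gt0 //.
rewrite invf_div; apply: le_trans h.
rewrite -natr1 in k1p *; rewrite le_eqVlt; apply/orP; left; apply/eqP; field; lra.
Qed.

Lemma powR_succ_ge s k : 0 <= s -> (0 < k)%N ->
  (1 + s / k.+1%:R) * k%:R `^ s <= k.+1%:R `^ s.
Proof.
move=> s0 k0; have kp : 0 < k%:R :> R by rewrite ltr0n.
rewrite -ler_pdivlMr ?powR_gt0 //.
have -> : k.+1%:R `^ s / k%:R `^ s = (k.+1%:R / k%:R) `^ s :> R.
  rewrite powRM ?invr_ge0 ?ler0n //; congr (_ * _).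
  by rewrite -(powR_inv1 (ler0n R k)) powRAC powR_inv1 ?powR_ge0.
apply: (@le_trans _ _ (expR (k.+1%:R^-1 * s))).
  by rewrite mulrC; exact: expR_ge1Dx.
rewrite expRM; apply: ge0_ler_powR => //; rewrite ?nnegrE ?expR_ge0 ?divr_ge0 ?ler0n //.
exact: ratio_ge_expR.
Qed.

Lemma ln_succ_ge k : (0 < k)%N -> k.+1%:R^-1 <= ln k.+1%:R - ln k%:R :> R.
Proof.
move=> k0; rewrite -ln_div ?posrE ?ltr0n //.
by rewrite -[leLHS]expRK ler_ln ?posrE ?expR_gt0 ?divr_gt0 ?ltr0n // ratio_ge_expR.
Qed.

Lemma ln_succ_le k : (0 < k)%N -> ln k.+1%:R - ln k%:R <= k%:R^-1 :> R.
Proof.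
move=> k0; rewrite -ln_div ?posrE ?ltr0n //.
have -> : k.+1%:R / k%:R = 1 + k%:R^-1 :> R.
  by rewrite -natr1 mulrDl divff ?mul1r ?pnatr_eq0 -?lt0n.
by apply: le_ln1Dx; apply: (@lt_le_trans _ _ 0); rewrite ?ltrN10 ?invr_ge0 ?ler0n.
Qed.

(** A discrete form of the derivative of x^-s, which lets sums of k^-(1 + s)
    telescope. *)
Lemma powR_neg_diff s k : 0 < s -> (0 < k)%N ->
  k%:R `^ (- (1 + s)) <= (2 + s) / s * (k%:R `^ (- s) - k.+1%:R `^ (- s)).
Proof.
move=> s0 k0; have kp : 1 <= k%:R :> R by rewrite ler1n.
have k1p : k.+1%:R = k%:R + 1 :> R by rewrite natr1.
have ap : 0 < k%:R `^ s :> R by apply: powR_gt0; lra.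
have bp : 0 < k.+1%:R `^ s :> R by apply: powR_gt0; lra.
have := powR_succ_ge (ltW s0) k0.
rewrite !powRN (@powRD _ _ 1 s); last by apply/implyP => _; lra.
rewrite powRr1 ?ler0n //.
set a := k%:R `^ s in ap *; set b := k.+1%:R `^ s in bp *; rewrite k1p.
set x : R := k%:R in kp *; move=> h.
have hb : b^-1 <= ((1 + s / (x + 1)) * a)^-1.
  have e1 : 0 < s / (x + 1) by apply: divr_gt0; lra.
  rewrite lef_pV2 ?posrE //; apply: mulr_gt0 => //; lra.
apply: (@le_trans _ _ ((2 + s) / s * (a^-1 - ((1 + s / (x + 1)) * a)^-1))).
  have -> : (2 + s) / s * (a^-1 - ((1 + s / (x + 1)) * a)^-1) =
     (2 + s) / (x + 1 + s) * a^-1.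
    by field; do ![apply/andP; split]; lra.
  rewrite invfM ler_pM2r ?invr_gt0 //.
  rewrite ler_pdivlMr; last by lra.
  rewrite ler_pdivrMl; last by lra.
  nra.
have k' : 0 < (2 + s) / s by apply: divr_gt0; lra.
by rewrite ler_pM2l //; lra.
Qed.

Lemma natr_unbounded (A : R) : exists N : nat, forall n : nat, (N <= n)%N -> A <= n%:R.
Proof.
exists (Num.truncn (Num.max A 0)).+1 => n h; apply: (@le_trans _ _ (Num.max A 0)).
  by rewrite le_max lexx.
have := @Num.Theory.truncn_itv _ (Num.max A 0); rewrite le_max lexx orbT => /(_ isT) /andP[_ h2].
by apply: le_trans (ltW h2) _; rewrite ler_nat.
Qed.

Lemma powR_unbounded s (A : R) : 0 < s ->
  exists N : nat, forall n : nat, (N <= n)%N -> A <= n%:R `^ s.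
Proof.
move=> s0; pose B := Num.max A 0.
have [N hN] := natr_unbounded (B `^ s^-1); exists N => n /hN h.
have B0 : 0 <= B by rewrite /B le_max lexx orbT.
apply: (@le_trans _ _ B); first by rewrite /B le_max lexx.
have -> : B = (B `^ s^-1) `^ s by rewrite -powRrM mulVf ?powRr1 //; lra.
by apply: ge0_ler_powR; rewrite ?nnegrE ?powR_ge0 //; lra.
Qed.

Lemma powR_neg_small s (e : R) : 0 < s -> 0 < e ->
  exists N : nat, forall n : nat, (N <= n)%N -> n%:R `^ (- s) <= e.
Proof.
move=> s0 e0; have [N hN] := powR_unbounded e^-1 s0.
exists N => n /hN h; rewrite powRN -[e]invrK lef_pV2 ?posrE ?invr_gt0 //.
by apply: lt_le_trans h; rewrite invr_gt0.
Qed.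

Lemma ln_unbounded (A : R) : exists N : nat, forall n : nat, (N <= n)%N -> A <= ln n%:R.
Proof.
have [N hN] := natr_unbounded (expR A); exists N => n /hN h.
by rewrite -[A]expRK ler_ln ?posrE ?expR_gt0 //; apply: lt_le_trans h; rewrite expR_gt0.
Qed.

Lemma pow_ratio_le (q D : nat) : (0 < D)%N ->
  (D%:R / D.+1%:R) ^+ q <= D%:R / (D%:R + q%:R) :> R.
Proof.
move=> D0; have Dp : 0 < D%:R :> R by rewrite ltr0n.
elim: q => [|q IH]; first by rewrite expr0 addr0 divff // gt_eqF.
rewrite exprS; apply: (@le_trans _ _ (D%:R / D.+1%:R * (D%:R / (D%:R + q%:R)))).
  by apply: ler_wpM2l IH; rewrite divr_ge0 ?ler0n.
have qp : 0 <= q%:R :> R by rewrite ler0n.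
rewrite -!natr1; set d : R := D%:R in Dp *; set x : R := q%:R in qp *.
rewrite mulf_div ler_pdivrMr; last by rewrite mulr_gt0 //; lra.
rewrite mulrAC ler_pdivlMr; last by lra.
rewrite -subr_ge0 (_ : _ - _ = d * x); last by ring.
by rewrite mulr_ge0 // ltW.
Qed.

Lemma pow_succ_ratio_le (q : nat) (x : R) : 0 <= x <= 1 -> (1 + x) ^+ q <= 1 + 2 ^+ q * x.
Proof.
case/andP => x0 x1; apply: (@le_trans _ _ (1 + (2 ^+ q - 1) * x)); last first.
  by rewrite lerD2l ler_wpM2r //; lra.
elim: q => [|q IH]; first by rewrite !expr0 subrr mul0r addr0.
rewrite exprSr; apply: le_trans (ler_wpM2r _ IH) _; first by lra.
have h : 1 <= 2 ^+ q :> R by apply: exprn_ege1; lra.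
rewrite exprS; set y := 2 ^+ q in h *.
rewrite -subr_ge0 (_ : _ - _ = (y - 1) * x * (1 - x)); last by ring.
by rewrite !mulr_ge0 //; lra.
Qed.

End PowerSums.

(** * Growth of the largest degree, and the probability of reaching a degree *)

Section Growth.
Context {R : realType} (f : nat -> R) (s c C : R).
Context (s_gt0 : 0 < s) (c_gt0 : 0 < c) (C_gt0 : 0 < C)
  (f_ge : forall n, (0 < n)%N -> c * n%:R `^ (1 + s) <= f n)
  (f_le : forall n, (0 < n)%N -> f n <= C * n%:R `^ (1 + s)).

Lemma attachment_gt0 n : (0 < n)%N -> 0 < f n.
Proof.
by move=> n0; apply: lt_le_trans (f_ge n0); rewrite mulr_gt0 ?powR_gt0 ?ltr0n.
Qed.

Let f_gt0 := attachment_gt0.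

(** The exponent 1 + s splits off the linear factor that is summed by the
    handshake lemma in [weight_le]. *)
Lemma powR1D x : 0 <= x -> x `^ (1 + s) = x * x `^ s.
Proof.
move=> x0; rewrite powRD ?powRr1 //.
by rewrite gt_eqF ?addr_gt0.
Qed.

(** Bound all but one of the 1 + s factors of a degree by the largest degree;
    the remaining ones add up to twice the number of edges. *)
Lemma weight_le t : treelike t ->
  weight f t <= 2 * C * (maxdeg t)%:R `^ s * (size t)%:R.
Proof.
move=> tt; have [t2 _ /eqP tsum] := and3P tt.
have h : weight f t <= C * (maxdeg t)%:R `^ s * (sumn t)%:R.
  rewrite sumnE (big_nth 0%N) big_mkord natr_sum mulr_sumr; apply: ler_sum => i _.
  have d0 : (0 < dg t i)%N by apply: treelike_nth_gt0.
  apply: le_trans (f_le d0) _; rewrite -mulrA ler_pM2l // powR1D ?ler0n // mulrC.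
  apply: ler_wpM2r; first by rewrite ler0n.
  by apply: ge0_ler_powR; rewrite ?nnegrE ?ler0n ?ler_nat ?nth_le_maxdeg // ltW.
apply: le_trans h _; rewrite tsum.
rewrite [leRHS](_ : _ = C * (maxdeg t)%:R `^ s * (2 * (size t)%:R)); last by ring.
by rewrite ler_wpM2l ?mulr_ge0 ?powR_ge0 ?(ltW C_gt0) // -natrM ler_nat; lia.
Qed.

Definition rate : R := c / (2 * C).

Lemma rate_gt0 : 0 < rate.
Proof. by rewrite /rate divr_gt0 // mulr_gt0. Qed.

Lemma prob_maxdeg t w : treelike t -> dg t w = maxdeg t ->
  rate * (maxdeg t)%:R / (size t)%:R <= f (dg t w) / weight f t.
Proof.
move=> tt ->; have D0 := maxdeg_gt0 tt.
have [t2 _ _] := and3P tt.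
have W0 := weight_gt0 f_gt0 tt.
have n0 : 0 < (size t)%:R :> R by rewrite ltr0n; lia.
have Ds : 0 < (maxdeg t)%:R `^ s :> R by rewrite powR_gt0 ?ltr0n.
rewrite ler_pdivlMr // mulrAC ler_pdivrMr //.
have Dr : 0 <= (maxdeg t)%:R :> R by rewrite ler0n.
apply: (@le_trans _ _ (rate * (maxdeg t)%:R * (2 * C * (maxdeg t)%:R `^ s * (size t)%:R))).
  apply: ler_wpM2l (weight_le tt); apply: mulr_ge0 => //; exact/ltW/rate_gt0.
apply: (@le_trans _ _ (c * (maxdeg t)%:R `^ (1 + s) * (size t)%:R)); last first.
  by rewrite ler_pM2r // f_ge.
rewrite powR1D // le_eqVlt; apply/orP; left; apply/eqP.
by rewrite /rate; have Cp := C_gt0; field; lra.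
Qed.

(** The largest degree increases with probability at least a constant times
    D / n, by [weight_le]. *)
Lemma mean_maxdeg (g : nat -> R) t : treelike t ->
  (forall m, (0 < m)%N -> g m.+1 <= g m) ->
  mean f (fun t' => g (maxdeg t')) t <=
  g (maxdeg t) - rate * (maxdeg t)%:R / (size t)%:R * (g (maxdeg t) - g (maxdeg t).+1).
Proof.
move=> tt gd; have [t2 _ _] := and3P tt.
have lt0 : (0 < size t)%N by lia.
have [w wt wm] := maxdeg_attained lt0.
have gD a b : (0 < a)%N -> (a <= b)%N -> g b <= g a.
  move=> a0 /subnK <-; elim: (b - a)%N => // m IH; rewrite addSn.
  by apply: le_trans IH; apply: gd; rewrite addn_gt0 a0 orbT.
apply: le_trans (mean_le1 f_gt0 (b := g (maxdeg t)) tt wt _) _.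
  by move=> i it _; apply: gD; rewrite ?maxdeg_gt0 // maxdeg_grow // leq_maxl.
rewrite lerD2l maxdeg_grow // wm (maxn_idPr (leqnSn _)).
rewrite -opprB mulrN lerN2 ler_wpM2r ?subr_ge0 ?gd ?maxdeg_gt0 // -{2}wm; exact: prob_maxdeg.
Qed.

Lemma mean_size (h : nat -> R) (F : seq nat -> R) t :
  mean f (fun t' => h (size t') * F t') t = h (size t).+1 * mean f F t.
Proof.
by rewrite -meanZ; apply: mean_eq => i it; rewrite size_grow.
Qed.

(** The largest degree increases at time n with probability at least a
    constant times 1 / n, and the harmonic series diverges. The divergence is
    used through the supermartingale (1 + (rate / 2) ln n) 2^-D. *)
Lemma maxdeg_unbounded (m : nat) (e : R) t : treelike t -> 0 < e ->
  exists k0, forall k, (k0 <= k)%N -> Ex f k (fun t' => (maxdeg t' <= m)%:R) t <= e.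
Proof.
move=> tt e0; have r0 := rate_gt0.
pose F t' : R := (1 + rate / 2 * ln (size t')%:R) * 2 ^- (maxdeg t').
have Fs t' : treelike t' -> mean f F t' <= F t'.
  move=> tt'; have [t2 _ _] := and3P tt'.
  rewrite /F (mean_size (fun n => 1 + rate / 2 * ln n%:R) (fun t => 2 ^- maxdeg t)).
  have n0 : 1 <= (size t')%:R :> R by rewrite ler1n; lia.
  have L0 : 0 <= ln (size t')%:R :> R by apply: ln_ge0.
  have L1 := @ln_succ_le R (size t') (ltnW t2).
  have L2 : 0 <= ln (size t').+1%:R :> R by apply: ln_ge0; rewrite ler1n.
  apply: le_trans (ler_wpM2l _ (mean_maxdeg (g := fun m => 2 ^- m) tt' _)) _.
  - by apply: addr_ge0 => //; apply: mulr_ge0 => //; lra.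
  - by move=> d _; rewrite exprS invfM; have : 0 <= 2 ^- d :> R by []; lra.
  rewrite exprS invfM; set y := 2 ^- _.
  have y0 : 0 < y by rewrite invr_gt0 exprn_gt0.
  have D1 : 1 <= (maxdeg t')%:R :> R by rewrite ler1n maxdeg_gt0.
  set D := (maxdeg t')%:R in D1 *; set n := (size t')%:R in n0 L0 L1 *.
  have -> : y - rate * D / n * (y - 2^-1 * y) = (1 - rate / 2 * D / n) * y by field; lra.
  rewrite mulrA ler_pM2r //.
  have z0 : 0 < n^-1 by rewrite invr_gt0; lra.
  apply: (@le_trans _ _ ((1 + rate / 2 * ln (size t').+1%:R) * (1 - rate / 2 / n))).
    apply: ler_wpM2l; first by nra.
    rewrite lerD2l lerN2 ler_pM2r //; nra.
  apply: (@le_trans _ _ ((1 + rate / 2 * ln (size t').+1%:R) - rate / 2 / n)).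
    have : 0 <= (rate / 2 * ln (size t').+1%:R) * (rate / 2 / n).
      by apply: mulr_ge0; apply: mulr_ge0 => //; try apply: ltW; lra.
    set z := rate / 2 / n; set y' := rate / 2 * _; lra.
  nra.
have F0 := Fs; pose A := 2 ^+ m * F t / e.
have [N hN] := ln_unbounded (A / (rate / 2)).
exists N => k Nk; have r2 : 0 < rate / 2 by lra.
have [t2 _ _] := and3P tt.
have hk : A <= 1 + rate / 2 * ln (k + size t)%:R.
  have := hN (k + size t)%N (leq_trans Nk (leq_addr _ _)).
  by rewrite ler_pdivrMr // => h; lra.
have h1 : 1 <= 1 + rate / 2 * ln (k + size t)%:R.
  by rewrite lerDl mulr_ge0 ?(ltW r2) //; apply: ln_ge0; rewrite ler1n; lia.
set B := 1 + _ in hk h1.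
have step : Ex f k (fun t' => (B * 2 ^- m) * (maxdeg t' <= m)%:R) t <= F t.
  apply: (@le_trans _ _ (Ex f k F t)); last first.
    by apply: (Ex_supermart f_gt0 (Q := treelike)) => // t' i; exact: treelike_grow.
  apply: (Ex_le f_gt0) => // t' tt' ts; rewrite /F ts -/B -mulrA ler_pM2l; last by lra.
  case: leqP => h; last by rewrite mulr0 invr_ge0 exprn_ge0.
  by rewrite mulr1 lef_pV2 ?posrE ?exprn_gt0 // ler_weXn2l // ler1n.
rewrite ExZ in step.
have Bp : 0 < B by lra.
have p2 : 0 < 2 ^+ m :> R by rewrite exprn_gt0.
rewrite -(ler_pM2l (x := B * 2 ^- m)); last by rewrite mulr_gt0 // invr_gt0.
apply: le_trans step _.
move: hk; rewrite /A ler_pdivrMr // => hk.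
by rewrite mulrAC ler_pdivlMr // mulrC.
Qed.

(** An explicit substitute for the sum of the 1 / f j over j >= k. *)
Definition tailf k : R := (2 + s) / s / c * k%:R `^ (- s).

Lemma tailf_ge0 k : 0 <= tailf k.
Proof.
have sp := s_gt0; have cp := c_gt0.
by rewrite mulr_ge0 ?powR_ge0 // divr_ge0 ?divr_ge0 //; lra.
Qed.

(** This is the only property of a tail sum of 1 / f that supermartingale
    arguments need. *)
Lemma tailf_diff k : (0 < k)%N -> 1 <= f k * (tailf k - tailf k.+1).
Proof.
move=> k0; rewrite /tailf -mulrBr.
have h := powR_neg_diff s_gt0 k0; have h2 := f_ge k0.
have p0 : 0 < k%:R `^ (1 + s) :> R by rewrite powR_gt0 // ltr0n.
have fk := f_gt0 k0.
have -> : (2 + s) / s / c * (k%:R `^ (- s) - k.+1%:R `^ (- s)) =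
  ((2 + s) / s * (k%:R `^ (- s) - k.+1%:R `^ (- s))) / c by ring.
rewrite mulrA ler_pdivlMr // mul1r.
apply: (@le_trans _ _ (f k * k%:R `^ (- (1 + s)))); last by rewrite ler_pM2l.
by rewrite powRN ler_pdivlMr.
Qed.

Lemma tailf_decr k : (0 < k)%N -> tailf k.+1 <= tailf k.
Proof.
move=> k0; rewrite -subr_ge0 -(pmulr_rge0 _ (f_gt0 k0)).
by apply: le_trans (tailf_diff k0); rewrite ler01.
Qed.

(** Heuristically, in the time scale in which a vertex of degree a receives
    edges at rate f a, the tail sum at the degree of [w] bounds the time left
    before the process explodes, and [u] needs k - a successive arrivals in it. *)
Definition reach_bound k u w t : R :=
  (\prod_(dg t u <= y < k) f y) * tailf (dg t w) ^+ (k - dg t u).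

Lemma prodf_ge0 a b : (0 < a)%N -> 0 <= \prod_(a <= y < b) f y.
Proof.
move=> a0; rewrite big_nat_cond; apply: prodr_ge0 => y /andP[/andP[ay _] _].
exact/ltW/f_gt0/(leq_trans a0).
Qed.

Lemma reach_ge0 k u w t : treelike t -> (u < size t)%N -> 0 <= reach_bound k u w t.
Proof.
move=> tt ut; rewrite mulr_ge0 ?exprn_ge0 ?tailf_ge0 // prodf_ge0 //.
exact: treelike_nth_gt0.
Qed.

Lemma reach_hit k u w t : (k <= dg t u)%N -> reach_bound k u w t = 1.
Proof.
by move=> h; rewrite /reach_bound big_geq // (eqP h) expr0 mulr1.
Qed.

(** Let r be the tail sum at the degree of [w], and a < k the degree of [u]. An
    edge at [u] multiplies the bound by 1 / (f a * r), so it contributes at most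
    1 / r times the bound over the weight; an edge at [w] lowers r by at least
    1 / f (dg t w), which compensates this by [tailf_diff]. *)
Lemma mean_reach k u w t : treelike t -> (u < size t)%N -> (w < size t)%N -> u != w ->
  mean f (reach_bound k u w) t <= reach_bound k u w t.
Proof.
move=> tt ut wt uw.
have [h|h] := leqP k (dg t u).
  rewrite (reach_hit w h) -(mean_cst f_gt0 1 tt); apply: (mean_le f_gt0) => // i it.
  by rewrite reach_hit // nth_grow // ut; lia.
have W0 := weight_gt0 f_gt0 tt.
apply: le_trans (mean_le2 f_gt0 (b := reach_bound k u w t) tt ut wt uw _) _.
  move=> i it iu iw; rewrite /reach_bound !nth_grow // ut wt.
  by rewrite (negbTE iu) (negbTE iw) !add0n.
rewrite -addrA gerDl /reach_bound !nth_grow // ut wt !eqxx (negbTE uw) eq_sym (negbTE uw).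
rewrite !add0n !add1n.
set a := dg t u in h *; set D := dg t w.
have a0 : (0 < a)%N by exact: treelike_nth_gt0.
have D0 : (0 < D)%N by exact: treelike_nth_gt0.
rewrite (big_ltn h) subnS; have : (0 < k - a)%N by rewrite subn_gt0.
case: (k - a)%N => // j _ /=; set p := \prod_(_ <= _ < _) _.
have p0 : 0 <= p by exact: prodf_ge0.
have fa := f_gt0 a0; have fD := f_gt0 D0.
have r1 := tailf_diff D0; have r0 := tailf_decr D0.
have rp := tailf_ge0 D; have rp1 := tailf_ge0 D.+1.
rewrite [X in X + _]mulrAC [X in _ + X]mulrAC -mulrDl pmulr_lle0 ?invr_gt0 //.
rewrite !exprS; set r := tailf D in r1 r0 rp *; set r' := tailf D.+1 in r1 r0 rp1 *.
have hp : r' ^+ j <= r ^+ j by apply: lerXn2r.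
have hp0 : 0 <= r ^+ j by apply: exprn_ge0.
have hp1 : 0 <= r' ^+ j by apply: exprn_ge0.
set x := r ^+ j in hp hp0 *; set x' := r' ^+ j in hp hp1 *.
have h1 : r' * x' <= r' * x by apply: ler_wpM2l.
have h2 : 0 <= f a * p by apply: mulr_ge0 => //; apply: ltW.
have h3 : 0 <= f a * p * r * x by do 2 apply: mulr_ge0 => //.
have h4 : x <= f D * (r - r') * x by rewrite ler_peMl.
have h5 : f D * (r' * x' - r * x) <= - x.
  apply: (@le_trans _ _ (f D * (r' * x - r * x))); last lra.
  by rewrite ler_pM2l // lerD2r.
have -> : f a * (p * x - f a * p * (r * x)) + f D * (f a * p * (r' * x') - f a * p * (r * x))
  = f a * p * (x + f D * (r' * x' - r * x)) - f a * (f a * p * r * x) by ring.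
have h6 : 0 <= f a * (f a * p * r * x) by apply: mulr_ge0 => //; apply: ltW.
have h7 : f a * p * (x + f D * (r' * x' - r * x)) <= 0.
  by apply: mulr_ge0_le0 => //; lra.
lra.
Qed.

(** The supermartingale equals 1 as soon as the degree of [u] is at least
    [k]. *)
Lemma Ex_reach k u w t j : treelike t -> (u < size t)%N -> (w < size t)%N -> u != w ->
  Ex f j (fun t' => (k <= dg t' u)%:R) t <= reach_bound k u w t.
Proof.
move=> tt ut wt uw; pose Q t' := [&& treelike t', (u < size t')%N & (w < size t')%N].
have Qg t' i : Q t' -> (i < size t')%N -> Q (grow t' i).
  case/and3P => h1 h2 h3 it; apply/and3P; split; first exact: treelike_grow.
  - by rewrite size_grow // ltnW.
  - by rewrite size_grow // ltnW.
have Qt t' : Q t' -> treelike t' by case/and3P.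
apply: (@le_trans _ _ (Ex f j (reach_bound k u w) t)).
  apply: (Ex_le_on f_gt0 Qg Qt); last by rewrite /Q tt ut wt.
  move=> t' /and3P[tt' ut' wt'] _; case: leqP => h; last exact: reach_ge0.
  by rewrite reach_hit.

apply: (Ex_supermart f_gt0 j Qg Qt); last by rewrite /Q tt ut wt.
by move=> t' /and3P[tt' ut' wt']; apply: mean_reach.
Qed.

(** The newborn vertex has degree 1, and it is compared with the vertex of
    largest degree at that moment. *)
Lemma Ex_newborn k t j : treelike t ->
  Ex f j.+1 (fun t' => (k <= dg t' (size t))%:R) t <=
  mean f (fun t' => (\prod_(1 <= y < k) f y) * tailf (maxdeg t') ^+ k.-1) t.
Proof.
move=> tt; rewrite /Ex iterS; apply: (mean_le f_gt0) => // i it.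
have tg := treelike_grow tt it.
have sg := size_grow it.
have lt0 : (0 < size (grow t i))%N by rewrite sg.
have [w wt wm] := maxdeg_attained lt0.
have nt : dg (grow t i) (size t) = 1%N by rewrite nth_grow // ltnn eqxx.
have uw : size t != w.
  apply/eqP => e; move: wm; rewrite -e nt maxdeg_grow //.
  by have := treelike_nth_gt0 tt it; lia.
apply: le_trans (Ex_reach k j tg _ wt uw) _; first by rewrite sg.
by rewrite /reach_bound nt wm subn1.
Qed.

End Growth.

(** * Finitely many vertices reach a large degree *)

Definition edge_degrees : seq nat := [:: 1; 1]%N.

Lemma treelike_edge : treelike edge_degrees. Proof. by []. Qed.

Definition late_large (k M : nat) (t : seq nat) : bool := has (fun d => k <= d)%N (drop M t).

Lemma late_large_le k M M' t : (M <= M')%N -> late_large k M' t -> late_large k M t.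
Proof.
move=> MM /(has_nthP 0%N)[i]; rewrite size_drop nth_drop => ih ki.
apply/(has_nthP 0%N); exists (M' - M + i)%N; first by rewrite size_drop; lia.
by rewrite nth_drop addnA subnKC.
Qed.

Section Late.
Context {R : realType} (f : nat -> R) (s c C : R).
Context (s_gt0 : 0 < s) (c_gt0 : 0 < c) (C_gt0 : 0 < C)
  (f_ge : forall n, (0 < n)%N -> c * n%:R `^ (1 + s) <= f n)
  (f_le : forall n, (0 < n)%N -> f n <= C * n%:R `^ (1 + s)).
Let f_gt0 := attachment_gt0 c_gt0 f_ge.

(** For D >= q the relative decrease of D^-q at time n is at least
    rate * q / (2 n) >= 2 / n on average, so n (n - 1) D^-q is a
    supermartingale. *)
Lemma Ex_maxdeg_moment (q : nat) t j : 4 <= rate c C * q%:R ->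
  treelike t -> (q <= maxdeg t)%N ->
  ((j + size t) * (j + size t).-1)%:R * Ex f j (fun t' => (maxdeg t')%:R ^- q) t <=
  (size t * (size t).-1)%:R.
Proof.
move=> hq tt qt; pose Q t' := treelike t' && (q <= maxdeg t')%N.
have Qg t' i : Q t' -> (i < size t')%N -> Q (grow t' i).
  case/andP => h1 h2 it; apply/andP; split; first exact: treelike_grow.
  by rewrite maxdeg_grow // (leq_trans h2) // leq_maxl.
have Qt t' : Q t' -> treelike t' by case/andP.
have r0 : 0 < rate c C by exact: rate_gt0.
pose F t' : R := (size t' * (size t').-1)%:R * (maxdeg t')%:R ^- q.
have FQ t' : Q t' -> mean f F t' <= F t'.
  case/andP => tt' qt'; have [t2 _ _] := and3P tt'.
  rewrite /F (mean_size f (fun n => (n * n.-1)%:R) (fun t => (maxdeg t)%:R ^- q)).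
  have D0 : (0 < maxdeg t')%N by exact: maxdeg_gt0.
  apply: le_trans (ler_wpM2l _ (mean_maxdeg s_gt0 c_gt0 C_gt0 f_ge f_le
    (g := fun m => m%:R ^- q) tt' _)) _.
  - by rewrite ler0n.
  - move=> m m0; rewrite lef_pV2 ?posrE ?exprn_gt0 ?ltr0n //.
    by apply: lerXn2r; rewrite ?nnegrE ?ler0n // ler_nat.
  have h := @pow_ratio_le R q _ D0.
  rewrite expr_div_n in h.
  have Dq : 0 < (maxdeg t')%:R ^+ q :> R by rewrite exprn_gt0 ?ltr0n.
  set D : R := (maxdeg t')%:R in h Dq *.
  set D1 : R := (maxdeg t').+1%:R in h *.
  have qD : q%:R <= D by rewrite ler_nat.
  have Dp : 1 <= D by rewrite ler1n.
  have q0 : 0 <= q%:R :> R by rewrite ler0n.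
  have -> : D1 ^- q = D ^- q * (D ^+ q / D1 ^+ q) by rewrite mulKf // gt_eqF.
  set y := D ^- q; have y0 : 0 < y by rewrite invr_gt0.
  set z := D ^+ q / _ in h *.
  have n2 : 2 <= (size t')%:R :> R by rewrite ler_nat.
  have -> : (size t' * (size t').-1)%:R = (size t')%:R * ((size t')%:R - 1) :> R.
    by rewrite natrM -subn1 natrB // ltnW.
  rewrite /= natrM -natr1; set n : R := (size t')%:R in n2 *.
  have h1 : rate c C * D * (1 - z) >= 2.
    have e1 : 1 - D / (D + q%:R) = q%:R / (D + q%:R) by field; lra.
    have e2 : D * (q%:R / (D + q%:R)) >= q%:R / 2.
      by rewrite mulrA ler_pdivlMr; nra.
    have e3 : D * (1 - z) >= q%:R / 2.
      apply: le_trans e2 _; rewrite -e1 ler_pM2l; lra.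
    by rewrite -mulrA; nra.
  have -> : (n + 1) * n * (y - rate c C * D / n * (y - y * z)) =
    ((n + 1) * (n - rate c C * D * (1 - z))) * y by field; lra.
  rewrite ler_pM2r //; nra.
have h := Ex_supermart f_gt0 j Qg Qt FQ (_ : Q t).
have {h} : Ex f j F t <= F t by apply: h; apply/andP.
have -> : Ex f j F t = ((j + size t) * (j + size t).-1)%:R *
    Ex f j (fun t' => (maxdeg t')%:R ^- q) t.
  by rewrite -ExZ; apply: (Ex_eq f_gt0) => // t' _ ts; rewrite /F ts.
move/le_trans; apply; rewrite /F ler_piMr ?ler0n // invf_le1 ?exprn_gt0 ?ltr0n ?maxdeg_gt0 //.
by rewrite exprn_ege1 // ler1n maxdeg_gt0.
Qed.

(** By [Ex_newborn] a vertex born at time n reaches degree [k] with probability at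
    most a constant times the mean of D^-q at that time, and these means are
    summable over n by [Ex_maxdeg_moment]. *)
Lemma Ex_late_large_from : exists k q : nat, (0 < k)%N /\ forall n (e : R), 0 < e ->
  exists M, forall t j, treelike t -> size t = n -> (q <= maxdeg t)%N ->
    Ex f j (fun t' => (late_large k M t')%:R) t <= e.
Proof.
have r0 : 0 < rate c C by exact: rate_gt0.
have [q hq] := natr_unbounded (4 / rate c C).
have {hq} hq : 4 <= rate c C * q%:R.
  by have := hq q (leqnn _); rewrite ler_pdivrMr // mulrC.
have [k1 hk] := natr_unbounded (q%:R / s).
have {hk} hk : q%:R <= s * k1%:R.
  by have := hk k1 (leqnn _); rewrite ler_pdivrMr // mulrC.
(* k - 1 is such that the power k - 1 of the tail sum, of order D^(- s (k - 1)),
   is at most a constant times D^-q. *)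
exists k1.+1, q; split => // n e e0.
pose B : R := (\prod_(1 <= y < k1.+1) f y) * ((2 + s) / s / c) ^+ k1.
have B0 : 0 <= B.
  rewrite mulr_ge0 ?(prodf_ge0 c_gt0 f_ge) // exprn_ge0 //.
  by rewrite divr_ge0 ?divr_ge0 ?(ltW c_gt0) ?(ltW s_gt0) // addr_ge0 // ltW.
pose A : R := B * (n * n.-1)%:R.
have A0 : 0 <= A by rewrite mulr_ge0 ?ler0n.
have [M0 hM0] := natr_unbounded (A / e).
exists (maxn M0 n.+1); set M := maxn _ _ => t j tt tn qt.
have Mn : (n < M)%N by rewrite leq_maxr.
have n2 : (1 < n)%N by rewrite -tn; have [] := and3P tt.
have AM : A / M%:R <= e.
  have := hM0 M (leq_maxl _ _); rewrite ler_pdivrMr // => h.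
  by rewrite ler_pdivrMr ?ltr0n 1?mulrC // (leq_trans _ Mn).
apply: le_trans AM.
apply: (@le_trans _ _ (Ex f j (fun t' => \sum_(i < j)
    ((M <= n + i)%N && (k1.+1 <= dg t' (n + i))%N)%:R) t)).
  apply: (Ex_le f_gt0) => // t' tt' ts'.
  case: (boolP (late_large _ _ _)) => [/(has_nthP 0%N)[i]|_]; last first.
    by rewrite sumr_ge0.
  rewrite size_drop nth_drop ts' tn => ij kd.
  have lt : (M + i - n < j)%N by clear -Mn ij; lia.
  rewrite (bigD1 (Ordinal lt)) //= subnKC; last by clear -Mn; lia.
  by rewrite kd leq_addr lerDl sumr_ge0.
rewrite (Ex_sum f j j (fun i t' => ((M <= n + i)%N && (k1.+1 <= dg t' (n + i))%N)%:R)).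
have step i : (i < j)%N ->
    Ex f j (fun t' => ((M <= n + i)%N && (k1.+1 <= dg t' (n + i))%N)%:R) t <=
    (if (M <= n + i)%N then A / (n + i)%:R - A / (n + i).+1%:R else 0).
  move=> ij; case: leqP => Mi; last by rewrite /= (Ex_cst f_gt0).
  rewrite /=; have -> : j = (i + (j - i).-1.+1)%N by clear -ij; lia.
  rewrite Ex_add.
  apply: (@le_trans _ _ (Ex f i (mean f (fun t' => B * (maxdeg t')%:R ^- q)) t)).
    apply: (Ex_le f_gt0) => // t' tt' ts'.
    have -> : (n + i)%N = size t' by rewrite ts' tn addnC.
    apply: le_trans (Ex_newborn s_gt0 c_gt0 C_gt0 f_ge k1.+1 (j - i).-1 tt') _.
    apply: (mean_le f_gt0) => // i' it'; rewrite /B -mulrA.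
    apply: ler_wpM2l; first exact: (prodf_ge0 c_gt0 f_ge).
    rewrite /= /tailf exprMn; apply: ler_wpM2l.
      rewrite exprn_ge0 //.
      by rewrite divr_ge0 ?divr_ge0 ?(ltW c_gt0) ?(ltW s_gt0) // addr_ge0 // ltW.
    have D1 : 1 <= (maxdeg (grow t' i'))%:R :> R.
      by rewrite ler1n maxdeg_gt0 // treelike_grow.
    rewrite -powR_mulrn ?powR_ge0 // -powRrM -powR_invn ?ler0n //.
    by apply: ler_powR => //; rewrite mulNr lerN2.
  rewrite -ExS ExZ; have := Ex_maxdeg_moment i.+1 hq tt qt.
  rewrite tn; set E := Ex _ _ _ _; rewrite addSn /= addnC => hE.
  have ni : 0 < (n + i)%:R :> R by rewrite ltr0n; clear -n2; lia.
  have ni1 : (n + i).+1%:R = (n + i)%:R + 1 :> R by rewrite natr1.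
  have -> : A / (n + i)%:R - A / (n + i).+1%:R = A / ((n + i).+1 * (n + i))%:R.
    by rewrite natrM ni1; field; lra.
  rewrite ler_pdivlMr; last by rewrite natrM mulr_gt0 // ni1; lra.
  by rewrite /A -mulrA; apply: ler_wpM2l => //; rewrite mulrC.
apply: (@le_trans _ _ (\sum_(i < j)
    (if (M <= n + i)%N then A / (n + i)%:R - A / (n + i).+1%:R else 0))).
  by apply: ler_sum => i _; apply: step.
apply: (@le_trans _ _ (if (M <= n + j)%N then A / M%:R - A / (n + j)%:R else 0)).
  elim: {step} j => [|j IH]; first by rewrite big_ord0 ifN //; clear -Mn; lia.
  rewrite big_ord_recr /=; case: (leqP M (n + j)) IH => Mj IH.
    rewrite [(n + j.+1)%N]addnS (leqW Mj); move: IH; set S := \sum_(i < j) _.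
    set a := A / (n + j)%:R; set b := A / _.+1%:R; set a' := A / M%:R; lra.
  rewrite addr0; case: leqP => h //; have <- : M = (n + j.+1)%N by clear -h Mj; lia.
  by rewrite subrr.
have M0' : 0 <= A / M%:R by rewrite divr_ge0.
by case: leqP => // _; rewrite gerBl divr_ge0.
Qed.

(** The largest degree first becomes at least [q] with high probability,
    and only then does [Ex_late_large_from] apply. *)
Lemma late_large_small : exists2 k : nat, (0 < k)%N & forall e : R, 0 < e ->
  exists M, forall j, Ex f j (fun t => (late_large k M t)%:R) edge_degrees <= e.
Proof.
have [k [q [k0 hkq]]] := Ex_late_large_from; exists k => // e e0.
have e2 : 0 < e / 2 by lra.
have [m hm] := maxdeg_unbounded s_gt0 c_gt0 C_gt0 f_ge f_le q treelike_edge e2.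
have [M hM] := hkq (m + 2)%N _ e2.
exists (maxn M (m + 2)) => j; have [mj|jm] := leqP m j; last first.
  rewrite (Ex_eq f_gt0 (G := fun=> 0)) ?(Ex_cst f_gt0) ?(ltW e0) // => t tt ts.
  by rewrite /late_large drop_oversize //= ts /=; lia.
rewrite -(subnKC mj) Ex_add.
apply: (@le_trans _ _ (Ex f m (fun t => (maxdeg t <= q)%:R + e / 2) edge_degrees)).
  apply: (Ex_le f_gt0) => // t tt ts; case: leqP => qt.
    apply: (@le_trans _ _ 1); last by rewrite /=; lra.
    rewrite -[leRHS](Ex_cst f_gt0 (j - m) 1 tt); apply: (Ex_le f_gt0) => // t' _ _.
    by case: late_large.
  rewrite add0r; apply: le_trans (hM t (j - m)%N tt ts (ltnW qt)).
  apply: (Ex_le f_gt0) => // t' _ _; rewrite ler_nat.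
  by case: (boolP (late_large _ _ t')) => // /(late_large_le (leq_maxl _ _)) ->.
rewrite ExD (Ex_cst f_gt0) //; have := hm m (leqnn _); lra.
Qed.

End Late.

(** * Two vertices cannot both reach large degrees *)

Section Rotation.
Context {R : realType} (z : nat -> R).

(** The product of the 1 + i z_m for m < n, as a pair of real numbers. *)
Fixpoint spiral (n : nat) : R * R :=
  if n is m.+1 then
    ((spiral m).1 - z m * (spiral m).2, (spiral m).2 + z m * (spiral m).1)
  else (1, 0).

(** The squared modulus of [spiral]. *)
Definition nrm n : R := (spiral n).1 ^+ 2 + (spiral n).2 ^+ 2.
(** The real part of [spiral] at [a] times the conjugate of [spiral] at [b]. *)
Definition dot a b : R := (spiral a).1 * (spiral b).1 + (spiral a).2 * (spiral b).2.
Definition wedge a b : R := (spiral a).1 * (spiral b).2 - (spiral a).2 * (spiral b).1.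

Lemma dotC a b : dot a b = dot b a.
Proof. by rewrite /dot; ring. Qed.

Lemma dotSl a b : dot a.+1 b = dot a b + z a * wedge a b.
Proof. by rewrite /dot /wedge /=; ring. Qed.

Lemma dotSr a b : dot a b.+1 = dot a b - z b * wedge a b.
Proof. by rewrite /dot /wedge /=; ring. Qed.

Lemma nrmS n : nrm n.+1 = (1 + z n ^+ 2) * nrm n.
Proof. by rewrite /nrm /=; ring. Qed.

Lemma nrm_gt0 n : 0 < nrm n.
Proof.
elim: n => [|n IH]; first by rewrite /nrm /= expr1n expr0n addr0.
by rewrite nrmS mulr_gt0 // ltr_pwDl // sqr_ge0.
Qed.

Lemma nrm_le a b : (a <= b)%N -> nrm a <= nrm b.
Proof.
move/subnK <-; elim: (b - a)%N => // m IH; apply: le_trans IH _.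
by rewrite addSn nrmS ler_peMl ?(ltW (nrm_gt0 _)) // lerDl sqr_ge0.
Qed.

Lemma dot_sqr_le a b : dot a b ^+ 2 <= nrm a * nrm b.
Proof.
rewrite -subr_ge0 (_ : _ - _ = wedge a b ^+ 2) ?sqr_ge0 //.
by rewrite /nrm /dot /wedge; ring.
Qed.

Lemma dot_abs_le (e G : R) a b : 0 <= e -> 0 <= G -> nrm a * nrm b <= (e * G) ^+ 2 ->
  `|dot a b| <= e * G.
Proof.
move=> e0 G0 h; rewrite -(ler_pXn2r (n := 2)) ?nnegrE ?mulr_ge0 //.
by rewrite -normrX ger0_norm ?sqr_ge0 // (le_trans (dot_sqr_le a b)).
Qed.

(** Each step moves the point by [z k] times its modulus, which is at most the
    final modulus. *)
Lemma coord_dist K N a b : (forall k, (K <= k)%N -> 0 <= z k) ->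
  (K <= a <= b)%N -> (b <= N)%N ->
  ((spiral b).1 - (spiral a).1) ^+ 2 + ((spiral b).2 - (spiral a).2) ^+ 2 <=
  2 * (\sum_(K <= k < N) z k) ^+ 2 * nrm N.
Proof.
move=> z0 /andP[Ka ab] bN.
pose S := Num.sqrt (nrm N).
have S2 : S ^+ 2 = nrm N by rewrite sqr_sqrtr // ltW // nrm_gt0.
have S0 : 0 <= S by rewrite sqrtr_ge0.
have bnd k : (k <= N)%N -> `|(spiral k).1| <= S /\ `|(spiral k).2| <= S.
  move=> kN; have h := nrm_le kN; rewrite -S2 in h.
  split; rewrite -(ler_pXn2r (n := 2)) ?nnegrE // -normrX ger0_norm ?sqr_ge0 //;
    apply: le_trans h; rewrite /nrm ?lerDl ?lerDr sqr_ge0 //.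
have sum_mono : \sum_(a <= k < b) z k <= \sum_(K <= k < N) z k.
  rewrite (big_cat_nat (n := a) (p := N)) //= ?(leq_trans ab) //.
  rewrite [in leRHS](big_cat_nat (n := b) (p := N)) //=.
  have p1 : 0 <= \sum_(K <= i < a) z i.
    by rewrite big_nat_cond sumr_ge0 // => i /andP[/andP[? _] _]; apply: z0.
  have p2 : 0 <= \sum_(b <= i < N) z i.
    rewrite big_nat_cond sumr_ge0 // => i /andP[/andP[bi _] _]; apply: z0.
    exact: leq_trans Ka (leq_trans ab bi).
  by move: p1 p2; set x := \sum_(K <= _ < a) _; set y := \sum_(b <= _ < N) _; set w := \sum_(a <= _ < b) _; lra.
have sum0 : 0 <= \sum_(a <= k < b) z k.
  rewrite big_nat_cond sumr_ge0 // => i /andP[/andP[ai _] _]; apply: z0.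
  exact: leq_trans ai.
have key : `|(spiral b).1 - (spiral a).1| <= (\sum_(a <= k < b) z k) * S /\
           `|(spiral b).2 - (spiral a).2| <= (\sum_(a <= k < b) z k) * S.
  elim: b ab bN {sum_mono sum0} => [|b IH].
    by rewrite leqn0 => /eqP -> _; rewrite !subrr normr0 big_geq // mul0r.
  rewrite leq_eqVlt => /predU1P[->|ab] bN.
    by rewrite !subrr normr0 big_geq // mul0r.
  have [h1 h2] := IH ab (ltnW bN).
  have [b1 b2] := bnd b (ltnW bN).
  have zb : 0 <= z b by apply: z0; apply: leq_trans Ka ab.
  rewrite big_nat_recr //= mulrDl; split.
    rewrite addrAC (le_trans (ler_normB _ _)) // lerD // normrM ger0_norm //.
    exact: ler_wpM2l.
  rewrite addrAC (le_trans (ler_normD _ _)) // lerD // normrM ger0_norm //.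
  exact: ler_wpM2l.
rewrite -S2; set T := \sum_(K <= _ < N) _ in sum_mono *.
have TS : 0 <= T * S by rewrite mulr_ge0 // (le_trans sum0).
have sq (x : R) : `|x| <= (\sum_(a <= k < b) z k) * S -> x ^+ 2 <= T ^+ 2 * S ^+ 2.
  move=> hx; rewrite -exprMn -[leLHS]ger0_norm ?sqr_ge0 // normrX.
  by apply: lerXn2r; rewrite ?nnegrE // (le_trans hx) // ler_wpM2r.
by have [/sq h1 /sq h2] := key; move: h1 h2; rewrite -mulrA; lra.
Qed.

(** The product of the 1 / (1 + z_k^2) is at least that of the 1 - z_k^2, hence
    at least 1 minus the sum of the z_k, as z_k^2 <= z_k. *)
Lemma nrm_tail K N : (forall k, (K <= k)%N -> 0 <= z k) -> (K <= N)%N ->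
  \sum_(K <= k < N) z k <= 1 ->
  (1 - \sum_(K <= k < N) z k) * nrm N <= nrm K.
Proof.
move=> z0 /subnK <-; elim: (N - K)%N => [|m IH].
  by rewrite add0n big_geq // subr0 mul1r.
rewrite addSn big_nat_recr ?leq_addl //= nrmS.
set x := z _; set g := nrm _ in IH *; set T := \sum_(K <= _ < _) _ in IH *.
have x0 : 0 <= x by apply: z0; rewrite leq_addl.
have T0 : 0 <= T.
  by rewrite /T big_nat_cond sumr_ge0 // => i /andP[/andP[? _] _]; apply: z0.
have g0 : 0 < g by exact: nrm_gt0.
move=> Tx; apply: le_trans (IH _); last by lra.
rewrite mulrA ler_pM2r //; have : (1 - T) * x ^+ 2 <= x ^+ 2 by nra.
have : x ^+ 2 <= x by nra.
have : 0 <= x ^+ 3 by apply: exprn_ge0.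
by nra.
Qed.

(** Beyond [K] the points hardly move, so their scalar product is close to the
    squared norm, which is itself almost final. *)
Lemma dot_ge K N a b : (forall k, (K <= k)%N -> 0 <= z k) ->
  \sum_(K <= k < N) z k <= 1 -> (K <= a)%N -> (K <= b)%N -> (a <= N)%N -> (b <= N)%N ->
  (1 - 2 * \sum_(K <= k < N) z k) * nrm N <= dot a b.
Proof.
move=> z0 T1; wlog ab : a b / (a <= b)%N.
  by move=> h Ka Kb aN bN; case: (leqP a b) => ab; [|rewrite dotC]; apply: h => //; apply: ltnW.
move=> Ka _ aN bN; have Kab : (K <= a <= b)%N by rewrite Ka.
have h1 := coord_dist z0 Kab bN.
have h2 := nrm_tail z0 (leq_trans Ka aN) T1.
have h3 := nrm_le Ka; have h4 := nrm_le ab.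
have -> : dot a b = (nrm a + nrm b - (((spiral b).1 - (spiral a).1) ^+ 2 + ((spiral b).2 - (spiral a).2) ^+ 2)) / 2.
  by rewrite /dot /nrm; field.
have G0 := nrm_gt0 N.
have T0 : 0 <= \sum_(K <= k < N) z k.
  by rewrite big_nat_cond sumr_ge0 // => i /andP[/andP[? _] _]; apply: z0.
set T := \sum_(K <= _ < _) _ in T0 T1 h1 h2 *; set G := nrm N in h1 h2 G0 *.
have : T ^+ 2 * G <= T * G by rewrite ler_pM2r //; nra.
by move: h1; rewrite -mulrA; lra.
Qed.

End Rotation.

Section Ties.
Context {R : realType} (f : nat -> R) (s c C : R).
Context (s_gt0 : 0 < s) (c_gt0 : 0 < c) (C_gt0 : 0 < C)
  (f_ge : forall n, (0 < n)%N -> c * n%:R `^ (1 + s) <= f n)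
  (f_le : forall n, (0 < n)%N -> f n <= C * n%:R `^ (1 + s)).
Let f_gt0 := attachment_gt0 c_gt0 f_ge.

Definition both_large K u v t : bool := (K <= dg t u)%N && (K <= dg t v)%N.

(** With z_k = l / f k, an edge at [u] and an edge at [v] change the scalar
    product by opposite multiples of the same wedge product, and the factors
    f (dg t u) and f (dg t v) of their probabilities cancel. *)
Lemma mean_dot l u v t : treelike t -> (u < size t)%N -> (v < size t)%N -> u != v ->
  mean f (fun t' => dot (fun k => l / f k) (dg t' u) (dg t' v)) t <=
  dot (fun k => l / f k) (dg t u) (dg t v).
Proof.
move=> tt ut vt uv; have W0 := weight_gt0 f_gt0 tt.
have fu := f_gt0 (treelike_nth_gt0 tt ut); have fv := f_gt0 (treelike_nth_gt0 tt vt).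
apply: le_trans (mean_le2 f_gt0 (b := dot (fun k => l / f k) (dg t u) (dg t v)) tt ut vt uv _) _.
  move=> i it iu iv; rewrite !nth_grow // ut vt.
  by rewrite (negbTE iu) (negbTE iv) !add0n.
rewrite !nth_grow // ut vt !eqxx (negbTE uv) eq_sym (negbTE uv) !add0n !add1n.
rewrite dotSl dotSr le_eqVlt; apply/orP; left; apply/eqP.
by field; lra.
Qed.

Lemma sum_inv_f K N : (0 < K)%N -> (K <= N)%N ->
  \sum_(K <= k < N) (f k)^-1 <= tailf s c K - tailf s c N.
Proof.
move=> K0 /subnK <-; elim: (N - K)%N => [|m IH]; first by rewrite big_geq // subrr.
rewrite addSn big_nat_recr ?leq_addl //=.
have n0 : (0 < m + K)%N by lia.
have h := tailf_diff s_gt0 c_gt0 f_ge n0; have fn := f_gt0 n0.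
have : (f (m + K)%N)^-1 <= tailf s c (m + K) - tailf s c (m + K).+1.
  by rewrite -[leLHS]mul1r ler_pdivrMr // mulrC.
lra.
Qed.

Lemma tailf_small (e : R) : 0 < e -> exists N, forall n, (N <= n)%N -> tailf s c n <= e.
Proof.
move=> e0; have sp := s_gt0; have cp := c_gt0.
have k0 : 0 < (2 + s) / s / c by rewrite divr_gt0 ?divr_gt0 //; lra.
have [N hN] := powR_neg_small s_gt0 (divr_gt0 e0 k0).
by exists N => n /hN; rewrite ler_pdivlMr // mulrC.
Qed.

(** Compare the martingale with its largest possible value G at the time
    considered. It is at least (1 - e) G if both degrees are at least [K], at
    least - e G if one of them is below [J], and at least - G otherwise, while
    its mean is at most e G. Hence, if p_K is the probability that both degrees
    are at least [K], then (1 - e) p_K <= 2 e + (p_J - p_K). The difference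
    p_J - p_K is what makes this a contraction instead of a plain bound. *)
Lemma both_large_step u v J (x : R) : u != v -> (u < J)%N -> (v < J)%N -> 0 < x <= 1 ->
  (forall j, Ex f j (fun t => (both_large J u v t)%:R) edge_degrees <= x) ->
  exists2 K, (J <= K)%N &
    forall j, Ex f j (fun t => (both_large K u v t)%:R) edge_degrees <= 3 / 4 * x.
Proof.
move=> uv uJ vJ /andP[x0 x1] hJ.
(* Small enough for (2 e + x) / (2 - e) <= 3 x / 4. *)
pose e := x / 8; have e0 : 0 < e by rewrite /e; lra.
have J0 : (0 < J)%N by exact: leq_ltn_trans uJ.
have fJ := f_gt0 J0.
(* With this l the factor 1 + (l / f J)^2 alone exceeds e^-2. *)
pose l := f J / e; have l0 : 0 < l by rewrite /l divr_gt0.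
pose z k := l / f k.
have e2l : 0 < e / 2 / l by rewrite divr_gt0 //; lra.
have [N hN] := tailf_small e2l.
pose K := maxn J.+1 N; have JK : (J < K)%N by rewrite leq_maxl.
exists K; first exact: ltnW.
have z0 k : (K <= k)%N -> 0 <= z k.
  by move=> Kk; rewrite divr_ge0 ?ltW // f_gt0 //; clear -JK Kk; lia.
move=> j; have [jJ|Jj] := leqP (j.+2) J.
  rewrite (Ex_eq f_gt0 (G := fun=> 0)) ?(Ex_cst f_gt0) ?mulr_ge0 //; first by lra.
  move=> t tt ts; rewrite /both_large [(K <= dg t u)%N]leqNgt.
  have -> : (dg t u < K)%N; last by [].
  have := nth_le_maxdeg t u; have := maxdeg_lt_size tt; rewrite ts /=.
  by clear -jJ JK; lia.
pose n := j.+2; pose G := nrm z n; have G0 : 0 < G by exact: nrm_gt0.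
have nrmJ : nrm z J <= e ^+ 2 * G.
  apply: (@le_trans _ _ (e ^+ 2 * nrm z J.+1)); last first.
    by rewrite ler_pM2l ?exprn_gt0 //; apply: nrm_le.
  rewrite nrmS mulrA ler_peMl ?(ltW (nrm_gt0 _ _)) // /z.
  have -> : e ^+ 2 * (1 + (l / f J) ^+ 2) = e ^+ 2 + 1 by rewrite /l; field; lra.
  by rewrite lerDr sqr_ge0.
have small a b : (a <= n)%N -> (b <= n)%N -> (a <= J)%N || (b <= J)%N ->
    `|dot z a b| <= e * G.
  wlog aJ : a b / (a <= J)%N.
    move=> h an bn ab; case/orP: (ab) => h1; first by apply: h => //.
    by rewrite dotC; apply: h => //; rewrite h1.
  move=> an bn _; apply: dot_abs_le; rewrite ?(ltW e0) ?(ltW G0) //.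
  apply: (@le_trans _ _ (e ^+ 2 * G * G)); last by rewrite le_eqVlt; apply/orP; left; apply/eqP; ring.
  apply: ler_pM; rewrite ?(ltW (nrm_gt0 _ _)) //; last exact: nrm_le.
  by apply: le_trans nrmJ; apply: nrm_le.
have T1 : \sum_(K <= k < n) z k <= e / 2.
  have [nK|Kn] := leqP n K; first by rewrite big_geq //; lra.
  rewrite /z -mulr_sumr; have K0 : (0 < K)%N by exact: leq_ltn_trans JK.
  have h := sum_inv_f K0 (ltnW Kn); have h2 := hN K (leq_maxr _ _).
  have h3 := tailf_ge0 s_gt0 c_gt0 n.
  rewrite -ler_pdivlMl // mulrC; apply: le_trans h _; lra.
have e1 : e <= 1 by rewrite /e; lra.
have point t : treelike t -> size t = n ->
    (2 - e) * (both_large K u v t)%:R - e - (both_large J u v t)%:R <= G^-1 * dot z (dg t u) (dg t v).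
  move=> tt ts; rewrite [leRHS]mulrC ler_pdivlMr //.
  have dn i : (dg t i <= n)%N.
    apply: leq_trans (nth_le_maxdeg t i) _; apply: leq_trans (maxdeg_lt_size tt) _.
    by rewrite ts.
  rewrite {1 2}/both_large; have [h1|h1] := boolP ((K <= dg t u)%N && (K <= dg t v)%N).
    have [ku kv] := andP h1.
    have -> : (J <= dg t u)%N && (J <= dg t v)%N by rewrite !(leq_trans (ltnW JK)).
    have T2 : \sum_(K <= k < n) z k <= 1 by lra.
    apply: le_trans (dot_ge z0 T2 ku kv (dn u) (dn v)).
    by rewrite ler_pM2r //=; lra.
  have [h2|h2] := boolP ((J <= dg t u)%N && (J <= dg t v)%N).
    have : `|dot z (dg t u) (dg t v)| <= 1 * G.
      apply: dot_abs_le; rewrite ?ler01 ?(ltW G0) // mul1r expr2.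
      by apply: ler_pM; rewrite ?(ltW (nrm_gt0 _ _)) //; apply: nrm_le.
    by rewrite ler_norml => /andP[h _]; move: h => /=; nra.
  have : `|dot z (dg t u) (dg t v)| <= e * G.
    apply: small => //; move: h2; rewrite negb_and -!ltnNge.
    by case/orP => h; rewrite (ltnW h) ?orbT.
  by rewrite ler_norml => /andP[h _]; move: h => /=; nra.
have init : Ex f j (fun t => dot z (dg t u) (dg t v)) edge_degrees <= e * G.
  (* At time m both vertices are present, and no degree exceeds J. *)
pose m := maxn u v; have mJ : (m < J)%N by rewrite gtn_max uJ vJ.
  have mj : (m <= j)%N by clear -mJ Jj; lia.
  rewrite -(subnKC mj) Ex_add -[leRHS](Ex_cst f_gt0 m _ treelike_edge).
  apply: (Ex_le f_gt0) => // t tt ts.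
  have ut : (u < size t)%N by rewrite ts /= -addSnnS ltn_addr // ltnS leq_maxl.
  have vt : (v < size t)%N by rewrite ts /= -addSnnS ltn_addr // ltnS leq_maxr.
  pose Q t' := [&& treelike t', (u < size t')%N & (v < size t')%N].
  have Qg t' i : Q t' -> (i < size t')%N -> Q (grow t' i).
    case/and3P => h1 h2 h3 it; apply/and3P; split; first exact: treelike_grow.
    - by rewrite size_grow // ltnW.
    - by rewrite size_grow // ltnW.
  have Qt t' : Q t' -> treelike t' by case/and3P.
  apply: (@le_trans _ _ (dot z (dg t u) (dg t v))).
    apply: (Ex_supermart (F := fun t => dot z (dg t u) (dg t v)) f_gt0 (j - m)%N Qg Qt);
      last by rewrite /Q tt ut vt.
    by move=> t' /and3P[tt' ut' vt']; apply: mean_dot.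
  apply: le_trans (ler_norm _) _.
  have dJ i : (dg t i <= J)%N.
    apply: leq_trans (nth_le_maxdeg t i) _; apply: leq_trans (maxdeg_lt_size tt) _.
    by rewrite ts /=; clear -mJ; lia.
  have dn i : (dg t i <= n)%N by apply: leq_trans (dJ i) _; rewrite /n; clear -Jj; lia.
  by apply: small; rewrite ?dn // dJ.
have : Ex f j (fun t => (2 - e) * (both_large K u v t)%:R + (- e + (-1) * (both_large J u v t)%:R))
    edge_degrees <= Ex f j (fun t => G^-1 * dot z (dg t u) (dg t v)) edge_degrees.
  apply: (Ex_le f_gt0) => // t tt ts; apply: le_trans (point t tt _); last by rewrite ts addnC.
  by rewrite mulN1r addrA.
rewrite ExD !ExZ ExD ExZ (Ex_cst f_gt0) //.
have hG : G^-1 * Ex f j (fun t => dot z (dg t u) (dg t v)) edge_degrees <= e.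
  by rewrite mulrC ler_pdivrMr.
have := hJ j; set p := Ex f j (fun t => (both_large K _ _ _)%:R) _; set q := Ex f j (fun t => (both_large J _ _ _)%:R) _.
have p0 : 0 <= p.
  rewrite -(Ex_cst f_gt0 j 0 treelike_edge); apply: (Ex_le f_gt0) => // t _ _.
move=> h1 h2; have : (2 - e) * p <= 2 * e + x by lra.
by rewrite /e => h; nra.
Qed.

Lemma both_large_le K K' u v t : (K <= K')%N -> both_large K' u v t -> both_large K u v t.
Proof. by move=> KK /andP[h1 h2]; rewrite /both_large !(leq_trans KK). Qed.

Lemma both_large_small u v (e : R) : u != v -> 0 < e ->
  exists K, forall j, Ex f j (fun t => (both_large K u v t)%:R) edge_degrees <= e.
Proof.
move=> uv e0.
have it i : exists2 K, (maxn u v < K)%N &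
    forall j, Ex f j (fun t => (both_large K u v t)%:R) edge_degrees <= (3 / 4) ^+ i.
  elim: i => [|i [K uvK hK]].
    exists (maxn u v).+1 => // j; rewrite expr0 -[leRHS](Ex_cst f_gt0 j 1 treelike_edge).
    by apply: (Ex_le f_gt0) => // t _ _; case: both_large.
  have [uK vK] : (u < K)%N /\ (v < K)%N by move: uvK; rewrite gtn_max => /andP.
  have xi : (0 < (3 / 4) ^+ i :> R) && ((3 / 4) ^+ i <= 1 :> R).
    by apply/andP; split; [apply: exprn_gt0 | apply: exprn_ile1]; lra.
  have [K' KK' hK'] := both_large_step uv uK vK xi hK.
  by exists K'; rewrite ?exprS // (leq_trans uvK).
have [i hi] := natr_unbounded (3 / e).
have [K _ hK] := it i; exists K => j; apply: le_trans (hK j) _.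
apply: le_trans (@pow_ratio_le R i 3 isT) _.
have := hi i (leqnn _); rewrite ler_pdivrMr // => h.
have i0 : 0 <= i%:R :> R by [].
rewrite ler_pdivrMr; last by lra.
by nra.
Qed.

(** Vertices born late are handled by [late_large_small]; the pairs of vertices
    born early are finitely many, and [both_large_small] applies to each. *)
Lemma crowded_small (e : R) : 0 < e ->
  exists K, forall j, Ex f j (fun t => (crowded K t)%:R) edge_degrees <= e.
Proof.
move=> e0; have e2 : 0 < e / 2 by lra.
have [k k0 hk] := late_large_small s_gt0 c_gt0 C_gt0 f_ge f_le.
have [M hM] := hk _ e2.
(* There are at most M * M pairs. *)
pose e' := e / 2 / (M * M).+1%:R; have e'0 : 0 < e' by rewrite divr_gt0 // ltr0n.
have /boolp.choice[Kf hKf] : forall uv : nat * nat, exists K, uv.1 != uv.2 ->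
    forall j, Ex f j (fun t => (both_large K uv.1 uv.2 t)%:R) edge_degrees <= e'.
  move=> [u v] /=; case: (eqVneq u v) => [_|uv]; first by exists 0%N.
  by have [K hK] := both_large_small uv e'0; exists K.
pose K := maxn k (\max_(u < M) \max_(v < M) Kf (val u, val v)).
have KfK u v : (u < M)%N -> (v < M)%N -> (Kf (u, v) <= K)%N.
  move=> uM vM; rewrite leq_max; apply/orP; right.
  apply: leq_trans (leq_bigmax (Ordinal uM)).
  exact: (leq_bigmax (F := fun v : 'I_M => Kf (u, val v)) (Ordinal vM)).
exists K => j.
apply: (@le_trans _ _ (Ex f j (fun t => (late_large k M t)%:R +
   \sum_(u < M) \sum_(v < M) ((val u != val v) && both_large (Kf (val u, val v)) u v t)%:R) edge_degrees)).
  apply: (Ex_le f_gt0) => // t tt ts.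
  have S0 (u : 'I_M) : 0 <= \sum_(v < M)
      ((val u != val v) && both_large (Kf (val u, val v)) u v t)%:R :> R.
    by apply: sumr_ge0.
  case: (boolP (crowded _ _)) => [/crowded_ex[u [v [uv vt ku kv]]]|_]; last first.
    by apply: addr_ge0 => //; apply: sumr_ge0.
  have [vM|Mv] := ltnP v M; last first.
    rewrite (_ : late_large k M t) ?lerDl ?sumr_ge0 //.
    apply/(has_nthP 0%N); exists (v - M)%N; first by rewrite size_drop; clear -vt Mv; lia.
    by rewrite nth_drop subnKC // (leq_trans _ kv) // leq_maxl.
  have uM := ltn_trans uv vM.
  apply: (@le_trans _ _ 1); first by rewrite lexx.
  rewrite (bigD1 (Ordinal uM)) //= (bigD1 (Ordinal vM)) //=.
  have b : both_large (Kf (u, v)) u v t.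
    by apply: (@both_large_le _ K); rewrite ?KfK // /both_large ku kv.
  rewrite b (ltn_eqF uv) /=.
  have h1 : 0 <= \sum_(i < M | i != Ordinal vM)
      ((u != i) && both_large (Kf (u, val i)) u i t)%:R :> R by apply: sumr_ge0.
  have h2 : 0 <= \sum_(u < M | u != Ordinal uM) \sum_(v < M)
      ((val u != val v) && both_large (Kf (val u, val v)) u v t)%:R :> R.
    by apply: sumr_ge0.
  have h3 : 0 <= (late_large k M t)%:R :> R by [].
  move: h1 h2; set a := \sum_(i < M | _) _; set b' := \sum_(i < M | _) _; lra.
rewrite ExD; have h1 := hM j.
suff h2 : Ex f j (fun t => \sum_(u < M) \sum_(v < M)
    ((val u != val v) && both_large (Kf (val u, val v)) u v t)%:R) edge_degrees <= e / 2 by lra.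
rewrite (Ex_sum f j M (fun u t => \sum_(v < M)
    ((u != val v) && both_large (Kf (u, val v)) u v t)%:R)).
apply: (@le_trans _ _ (\sum_(u < M) \sum_(v < M) e')).
  apply: ler_sum => u _.
  rewrite (Ex_sum f j M (fun v t => ((val u != v) && both_large (Kf (val u, v)) u v t)%:R)).
  apply: ler_sum => v _; have [->|uv] := eqVneq (val u) (val v).
    by rewrite /= (Ex_cst f_gt0) // ltW.
  by rewrite /=; apply: (hKf (val u, val v)).
rewrite !sumr_const !card_ord -mulrnA /e' -[leLHS]mulr_natr mulrAC.
rewrite ler_pdivrMr ?ltr0n // ler_pM2l // ler_nat; lia.
Qed.

End Ties.

(** * The hub takes over *)

Section Endgame.
Context {R : realType} (f : nat -> R) (s c C : R).
Context (s_gt0 : 0 < s) (c_gt0 : 0 < c) (C_gt0 : 0 < C)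
  (f_ge : forall n, (0 < n)%N -> c * n%:R `^ (1 + s) <= f n)
  (f_le : forall n, (0 < n)%N -> f n <= C * n%:R `^ (1 + s)).
Let f_gt0 := attachment_gt0 c_gt0 f_ge.

Section Fixed.
Context (K q : nat).
Context (sq : 1 + s <= q%:R).

Definition small_max : R := C * K%:R `^ (1 + s) + 1.
Notation F := small_max.

Lemma small_max_gt0 : 0 < F.
Proof. by rewrite ltr_wpDl // mulr_ge0 ?powR_ge0 ?(ltW C_gt0). Qed.

Lemma f_le_small d : (0 < d)%N -> (d < K)%N -> f d <= F.
Proof.
move=> d0 dK; apply: le_trans (f_le d0) _.
apply: (@le_trans _ _ (C * K%:R `^ (1 + s))); last by rewrite lerDl ler01.
have sp := s_gt0; rewrite ler_pM2l //; apply: ge0_ler_powR; rewrite ?nnegrE //.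
  by lra.
by rewrite ler_nat ltnW.
Qed.

Lemma weight_uncrowded t w : treelike t -> (w < size t)%N -> dg t w = maxdeg t ->
  ~~ crowded K t -> weight f t <= f (maxdeg t) + F * (size t)%:R.
Proof.
move=> tt wt wm nc; rewrite /weight (bigD1 (Ordinal wt)) //= wm lerD2l.
apply: (@le_trans _ _ (\sum_(i < size t) F)); last first.
  by rewrite sumr_const card_ord mulr_natr.
rewrite [leRHS](bigD1 (Ordinal wt)) //=.
apply: (@le_trans _ _ (\sum_(i < size t | i != Ordinal wt) F)); last first.
  by rewrite lerDr ltW // small_max_gt0.
apply: ler_sum => i iw; apply: f_le_small; first exact: treelike_nth_gt0.
by apply: (nth_lt_of_uncrowded nc wm wt).
Qed.

(** All vertices but [w] have degree less than [K], so together they weigh at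
    most a constant times n. *)
Lemma prob_nonmax t w : treelike t -> (w < size t)%N -> dg t w = maxdeg t ->
  ~~ crowded K t ->
  1 - f (dg t w) / weight f t <= F / c * (size t)%:R * (maxdeg t)%:R `^ (- (1 + s)).
Proof.
move=> tt wt wm nc; have h := weight_uncrowded tt wt wm nc.
have W0 := weight_gt0 f_gt0 tt; have D0 := maxdeg_gt0 tt; rewrite wm.
have fD := f_gt0 D0; have hD := f_ge D0; have F0 := small_max_gt0.
have Wf : f (maxdeg t) <= weight f t by rewrite -wm; apply: weight_ge.
have p0 : 0 < (maxdeg t)%:R `^ (1 + s) :> R by rewrite powR_gt0 // ltr0n.
rewrite powRN; set P := _ `^ _ in p0 hD *; set X := f _ in fD hD h Wf *.
have n0 : 0 <= (size t)%:R :> R by [].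
set n : R := (size t)%:R in n0 h *; set W := weight f t in W0 h Wf *.
have cp := c_gt0; clear wm.
apply: (@le_trans _ _ (F * n / X)).
  have -> : 1 - X / W = (W - X) / W by field; lra.
  apply: (@le_trans _ _ ((F * n) / W)); first by rewrite ler_pM2r ?invr_gt0 //; lra.
  by apply: ler_wpM2l; [rewrite mulr_ge0 // ltW | rewrite lef_pV2].
have -> : F / c * n / P = F * n / (c * P) by field; lra.
by apply: ler_wpM2l; [rewrite mulr_ge0 // ltW | rewrite lef_pV2 ?posrE // mulr_gt0].
Qed.

(** The probability x / (x + F n), where x = f D, exceeds (D + q) / n as soon as
    D is large and D + q <= n / 2. This is the rate needed for (n / D)^q not
    to increase. *)
Lemma prob_max_ge t w : treelike t -> (w < size t)%N -> dg t w = maxdeg t ->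
  ~~ crowded K t -> 2 * F * ((maxdeg t)%:R + q%:R) <= c * (maxdeg t)%:R `^ (1 + s) ->
  2 * ((maxdeg t)%:R + q%:R) <= (size t)%:R :> R ->
  ((maxdeg t)%:R + q%:R) / (size t)%:R <= f (dg t w) / weight f t.
Proof.
move=> tt wt wm nc h1 h2; have h := weight_uncrowded tt wt wm nc.
have W0 := weight_gt0 f_gt0 tt; have D0 := maxdeg_gt0 tt; rewrite wm; clear wm.
have fD := f_gt0 D0; have hD := f_ge D0; have F0 := small_max_gt0.
have [t2 _ _] := and3P tt.
have n0 : 0 < (size t)%:R :> R by rewrite ltr0n ltnW.
have D1 : 0 < (maxdeg t)%:R :> R by rewrite ltr0n.
have q0 : 0 <= q%:R :> R by [].
rewrite ler_pdivlMr // mulrAC ler_pdivrMr //.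
set X := f _ in fD hD h *; set n : R := (size t)%:R in n0 h h2 *.
set W := weight f t in W0 h *; set Y := _ + _ in h1 h2 *.
have Y0 : 0 < Y by rewrite /Y; lra.
apply: (@le_trans _ _ (Y * (X + F * n))); first by rewrite ler_pM2l.
have e1 : 2 * F * Y * n <= X * n by rewrite ler_pM2r //; lra.
have e2 : X * (2 * Y) <= X * n by rewrite ler_pM2l.
rewrite mulrDr; lra.
Qed.

(** Set to zero once the sequence is crowded: crowding is permanent, so this only
    lowers the mean of the next value, and degrees other than the largest may be
    assumed to be bounded. *)
Definition spread t : R := (~~ crowded K t)%:R * ((size t)%:R / (maxdeg t)%:R) ^+ q.

Lemma spread_ge0 t : 0 <= spread t.
Proof. by rewrite mulr_ge0 // exprn_ge0 // divr_ge0. Qed.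

Definition drift : R := F / c * 4 `^ (1 + s) * 2 ^+ q.

Lemma drift_ge0 : 0 <= drift.
Proof.
have F0 := small_max_gt0.
by rewrite !mulr_ge0 ?powR_ge0 ?invr_ge0 ?(ltW c_gt0) ?(ltW F0) ?exprn_ge0.
Qed.

(** The degree from which [prob_max_ge] applies. The default value is never
    used, see [hub_startP]. *)
Definition hub_start : nat := xget 0%N [set m | forall D : nat, (m <= D)%N ->
  2 * F * (D%:R + q%:R) <= c * D%:R `^ (1 + s)].

Lemma hub_startP (D : nat) : (hub_start <= D)%N -> 2 * F * (D%:R + q%:R) <= c * D%:R `^ (1 + s).
Proof.
rewrite /hub_start; case: xgetP => [m _ h|h]; first exact: h.
have [N hN] := powR_unbounded (2 * F * (1 + q%:R) / c) s_gt0.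
exfalso; apply: (h (maxn N 1)) => /= {}D; rewrite geq_max => /andP[ND D1].
have := hN D ND; rewrite ler_pdivrMr // => h'.
have F0 := small_max_gt0; have Dr : 1 <= D%:R :> R by rewrite ler1n.
have q0 : 0 <= q%:R :> R by [].
rewrite (powR1D s_gt0) ?ler0n // mulrCA -mulrA.
apply: (@le_trans _ _ (D%:R * (2 * F * (1 + q%:R)))); last first.
  by rewrite ler_pM2l //; lra.
have -> : D%:R * (2 * F * (1 + q%:R)) = 2 * (F * (D%:R * (1 + q%:R))) by ring.
by rewrite ler_pM2l // ler_pM2l //; nra.
Qed.

(** An edge at the hub always decreases n / D. Far from the regime D ~ n, edges
    at the hub are frequent enough by [prob_max_ge] to make the mean decrease.
    When D is at least n / 4, the other edges have probability O(n^-s) and each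
    increases the function by a factor 1 + O(1 / n). *)
Lemma mean_spread t : treelike t -> (hub_start <= maxdeg t)%N -> (4 * q <= size t)%N ->
  mean f spread t <= (1 + drift * (size t)%:R `^ (- (1 + s))) * spread t.
Proof.
move=> tt hD hq; have dr0 := drift_ge0.
have [cr|nc] := boolP (crowded K t).
  rewrite {2}/spread cr mul0r mulr0 -(mean_cst f_gt0 0 tt).
  by apply: (mean_le f_gt0) => // i it; rewrite /spread crowded_grow // mul0r.
have [t2 _ _] := and3P tt.
have lt0 : (0 < size t)%N by exact: ltnW.
have [w wt wm] := maxdeg_attained lt0.
have Dpos := maxdeg_gt0 tt; have Dn := maxdeg_lt_size tt.
rewrite [in leRHS]/spread nc mul1r.
pose b : R := ((size t).+1%:R / (maxdeg t)%:R) ^+ q.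
have b0 : 0 <= b by rewrite exprn_ge0 // divr_ge0.
have D1 : 1 <= (maxdeg t)%:R :> R by rewrite ler1n.
have n1 : 2 <= (size t)%:R :> R by rewrite ler_nat.
have sprw i : (i < size t)%N ->
    spread (grow t i) <= ((size t).+1%:R / (maxdeg (grow t i))%:R) ^+ q.
  move=> it; rewrite /spread size_grow //.
  by rewrite ler_piMl ?exprn_ge0 ?divr_ge0 // lern1 leq_b1.
apply: le_trans (mean_le1 f_gt0 (b := b) tt wt _) _.
  move=> i it _; apply: le_trans (sprw i it) _; apply: lerXn2r;
    rewrite ?nnegrE ?divr_ge0 //.
  apply: ler_wpM2l => //; have [D2 D3] : (0 < maxdeg (grow t i))%N /\ (maxdeg t <= maxdeg (grow t i))%N.
    by rewrite maxdeg_grow // leq_maxl; split => //; rewrite leq_max ltn0Sn orbT.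
  by rewrite lef_pV2 ?posrE ?ltr0n // ler_nat.
have p0 := prob_ge0 f_gt0 tt wt.
set p := f _ / _ in p0 *.
have p1 : p <= 1 by rewrite ler_pdivrMr ?(weight_gt0 f_gt0) // mul1r weight_ge.
have pn := prob_nonmax tt wt wm nc; rewrite -/p in pn.
have sw := sprw w wt.
rewrite maxdeg_grow // wm (maxn_idPr (leqnSn _)) in sw.
move/eqP: wm => wm.
pose x := spread (grow t w); rewrite -/x in sw *.
set n : R := (size t)%:R in n1 pn *; set D : R := (maxdeg t)%:R in D1 pn b b0 *.
have D1' : (maxdeg t).+1%:R = D + 1 :> R by rewrite natr1.
have n1' : (size t).+1%:R = n + 1 :> R by rewrite natr1.
have U0 : 0 < (n / D) ^+ q by rewrite exprn_gt0 // divr_gt0; lra.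
have bE : b = (1 + n^-1) ^+ q * (n / D) ^+ q.
  by rewrite /b n1' -exprMn; congr (_ ^+ q); field; lra.
have dn0 : 0 <= drift * n `^ (- (1 + s)) by rewrite mulr_ge0 // powR_ge0.
(* If n < 2 (D + q), then n >= 4 q gives D >= n / 4. *)
have [far|near] := leP (2 * (D + q%:R)) n.
  have hp := prob_max_ge tt wt (eqP wm) nc (hub_startP hD) far; rewrite -/p -/D -/n in hp.
  apply: (@le_trans _ _ ((n / D) ^+ q)); last by rewrite ler_peMl ?(ltW U0) // lerDl.
  have q0 : 0 <= q%:R :> R by [].
  have xb : x <= b * (D / (D + q%:R)).
    apply: le_trans sw _; rewrite (_ : _ ^+ q = b * (D / (maxdeg t).+1%:R) ^+ q).
      by apply: ler_wpM2l => //; apply: pow_ratio_le.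
    by rewrite /b -exprMn D1' n1'; congr (_ ^+ q); field; lra.
  have -> : b + p * (x - b) = b - p * (b - x) by ring.
  apply: (@le_trans _ _ (b - (D + q%:R) / n * (b * (q%:R / (D + q%:R))))).
    rewrite lerD2l lerN2; apply: ler_pM => //.
    - by rewrite divr_ge0 //; lra.
    - by rewrite mulr_ge0 // divr_ge0 //; lra.
    - have -> : b * (q%:R / (D + q%:R)) = b - b * (D / (D + q%:R)) by field; lra.
      by lra.
  have -> : b - (D + q%:R) / n * (b * (q%:R / (D + q%:R))) = b * (1 - q%:R / n).
    by field; lra.
  rewrite bE mulrAC ler_piMl ?(ltW U0) //.
  have nV : 0 < n^-1 by rewrite invr_gt0; lra.
  have z0 : 0 <= (1 + n^-1) ^+ q by apply: exprn_ge0; lra.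
  apply: (@le_trans _ _ ((1 + n^-1) ^+ q * expR (- (q%:R / n)))).
    by apply: ler_wpM2l => //; apply: expR_ge1Dx.
  rewrite expRN ler_pdivrMr ?expR_gt0 // mul1r mulrC expRM powR_mulrn ?expR_ge0 //.
  apply: lerXn2r; rewrite ?nnegrE ?expR_ge0 ?expR_ge1Dx //; lra.
have xU : x <= (n / D) ^+ q.
  apply: le_trans sw _; rewrite D1' n1'; apply: lerXn2r; rewrite ?nnegrE ?divr_ge0 //; try lra.
  have Dn' : D <= n by rewrite ler_nat (leq_trans Dn) // leq_pred.
  rewrite ler_pdivrMr; last by lra.
  rewrite mulrAC ler_pdivlMr; last by lra.
  by lra.
have D4 : n <= 4 * D.
  have : 4 * q%:R <= n by rewrite -natrM ler_nat.
  by lra.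
have bU : b <= (1 + 2 ^+ q / n) * (n / D) ^+ q.
  rewrite bE; apply: ler_wpM2r; first exact: ltW.
  by apply: pow_succ_ratio_le; rewrite invr_ge0 invf_le1; lra.
have -> : b + p * (x - b) = p * x + (1 - p) * b by ring.
apply: (@le_trans _ _ (p * (n / D) ^+ q + (1 - p) * ((1 + 2 ^+ q / n) * (n / D) ^+ q))).
  by apply: lerD; apply: ler_wpM2l => //; lra.
have -> : p * (n / D) ^+ q + (1 - p) * ((1 + 2 ^+ q / n) * (n / D) ^+ q) =
  (1 + (1 - p) * 2 ^+ q / n) * (n / D) ^+ q by ring.
rewrite ler_pM2r // lerD2l.
have pD : D `^ (- (1 + s)) <= 4 `^ (1 + s) * n `^ (- (1 + s)).
  have sp := s_gt0; have n0 : 0 <= n by lra.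
  have Dq : 0 < D `^ (1 + s) by apply: powR_gt0; lra.
  have nq : 0 < n `^ (1 + s) by apply: powR_gt0; lra.
  rewrite !powRN ler_pdivlMr // mulrC ler_pdivrMr //.
  rewrite -powRM; [|by lra|by lra].
  by apply: ge0_ler_powR; rewrite ?nnegrE //; lra.
have F0 := small_max_gt0; have cp := c_gt0.
have q2 : 0 < 2 ^+ q :> R by rewrite exprn_gt0.
apply: (@le_trans _ _ ((F / c * n * (4 `^ (1 + s) * n `^ (- (1 + s)))) * 2 ^+ q / n)).
  rewrite ler_pM2r ?invr_gt0; last by lra.
  rewrite ler_pM2r //; apply: le_trans pn _; apply: ler_wpM2l pD.
  by rewrite mulr_ge0 ?divr_ge0 //; lra.
rewrite le_eqVlt; apply/orP; left; apply/eqP.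
by rewrite /drift; field; lra.
Qed.

Definition drift_total : R := drift * ((2 + s) / s).

Lemma drift_total_ge0 : 0 <= drift_total.
Proof.
have sp := s_gt0; by rewrite mulr_ge0 ?drift_ge0 // divr_ge0 //; lra.
Qed.

(** The factors 1 + O(n^-(1 + s)) of [mean_spread] have a bounded product; the
    exponential of a multiple of n^-s absorbs them exactly. *)
Lemma Ex_spread j t : treelike t -> (hub_start <= maxdeg t)%N -> (4 * q <= size t)%N ->
  Ex f j spread t <= expR drift_total * (size t)%:R ^+ q.
Proof.
move=> tt hD hq.
pose Q t' := [&& treelike t', (hub_start <= maxdeg t')%N & (4 * q <= size t')%N].
have Qg t' i : Q t' -> (i < size t')%N -> Q (grow t' i).
  case/and3P => h1 h2 h3 it; apply/and3P; split; first exact: treelike_grow.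
  - by rewrite maxdeg_grow // (leq_trans h2) // leq_maxl.
  - by rewrite size_grow // (leq_trans h3).
have Qt t' : Q t' -> treelike t' by case/and3P.
have e0 := drift_total_ge0.
pose G n : R := expR (drift_total * n%:R `^ (- s)).
have GE t' : Q t' -> mean f (fun t' => G (size t') * spread t') t' <= G (size t') * spread t'.
  case/and3P => tt' hD' hq'; rewrite mean_size.
  have t0 : (0 < size t')%N by have [h _ _] := and3P tt'; exact: ltnW.
  apply: (@le_trans _ _ (G (size t').+1 *
     ((1 + drift * (size t')%:R `^ (- (1 + s))) * spread t'))).
    by apply: ler_wpM2l; [apply: expR_ge0 | apply: mean_spread].
  rewrite mulrA; apply: ler_wpM2r; first exact: spread_ge0.
  apply: (@le_trans _ _ (G (size t').+1 * expR (drift * (size t')%:R `^ (- (1 + s))))).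
    by apply: ler_wpM2l; [apply: expR_ge0 | apply: expR_ge1Dx].
  rewrite /G -expRD ler_expR.
  have := ler_wpM2l drift_ge0 (powR_neg_diff s_gt0 t0); rewrite /drift_total.
  by rewrite mulrA; lra.
apply: (@le_trans _ _ (Ex f j (fun t' => G (size t') * spread t') t)).
  apply: (Ex_le f_gt0) => // t' _ _; rewrite ler_peMl ?spread_ge0 //.
  by rewrite /G -expR0 ler_expR mulr_ge0 // powR_ge0.
apply: le_trans (Ex_supermart f_gt0 j Qg Qt GE _) _; first by apply/and3P.
have t0 : (1 <= size t)%N by have [h _ _] := and3P tt; exact: ltnW.
apply: ler_pM; rewrite ?expR_ge0 ?spread_ge0 //.
  rewrite /G ler_expR ler_piMr // powRN invf_le1 ?powR_gt0 ?ltr0n //.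
  rewrite -[leLHS](powRr0 (size t)%:R); apply: ler_powR; first by rewrite ler1n.
  exact: ltW.
rewrite /spread; have [_|_] := boolP (crowded K t); first by rewrite mul0r exprn_ge0.
rewrite mul1r; apply: lerXn2r; rewrite ?nnegrE ?divr_ge0 //.
by rewrite ler_pdivrMr ?ltr0n ?maxdeg_gt0 // ler_peMr // ler1n maxdeg_gt0.
Qed.

Definition uncrowded_loss t : R := (~~ crowded K t)%:R * (loss t)%:R.

(** A miss has probability at most a constant times n / D^(1 + s), which is
    n^-s (n / D)^(1 + s), and n / D >= 1 allows the exponent q. *)
Lemma mean_uncrowded_loss t : treelike t ->
  mean f uncrowded_loss t <= uncrowded_loss t + F / c * (size t)%:R `^ (- s) * spread t.
Proof.
move=> tt; have [cr|nc] := boolP (crowded K t).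
  rewrite /uncrowded_loss /spread cr !mul0r mulr0 addr0 -(mean_cst f_gt0 0 tt).
  by apply: (mean_le f_gt0) => // i it; rewrite crowded_grow // mul0r.
have [t2 _ _] := and3P tt.
have lt0 : (0 < size t)%N by exact: ltnW.
have [w wt wm] := maxdeg_attained lt0.
have wl i : (i < size t)%N -> uncrowded_loss (grow t i) <= (loss t + (dg t i != maxdeg t))%:R.
  by move=> it; rewrite /uncrowded_loss loss_grow // ler_piMl // lern1 leq_b1.
apply: le_trans (mean_le1 f_gt0 (b := (loss t).+1%:R) tt wt _) _.
  move=> i it _; apply: le_trans (wl i it) _; rewrite ler_nat -addn1 leq_add2l.
  exact: leq_b1.
have lw := wl w wt; rewrite wm eqxx addn0 in lw.
have p0 := prob_ge0 f_gt0 tt wt; have pn := prob_nonmax tt wt wm nc; clear wm.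
rewrite /uncrowded_loss nc mul1r -natr1 in lw *.
set p := f _ / _ in p0 pn *; set l : R := (loss t)%:R in lw *.
set x := (~~ _)%:R * _ in lw *.
have : p * (x - (l + 1)) <= p * (- 1) by apply: ler_wpM2l => //; lra.
suff : 1 - p <= F / c * (size t)%:R `^ (- s) * spread t by lra.
apply: le_trans pn _; have F0 := small_max_gt0; have cp := c_gt0; have sp := s_gt0.
rewrite -!mulrA; do 2 (rewrite ler_pM2l ?invr_gt0 //).
rewrite /spread nc mul1r.
have n0 : 0 < (size t)%:R :> R by rewrite ltr0n.
have D1 : 0 < (maxdeg t)%:R :> R by rewrite ltr0n maxdeg_gt0.
have r1 : 1 <= (size t)%:R / (maxdeg t)%:R :> R.
  by rewrite ler_pdivlMr // mul1r ler_nat (leq_trans (maxdeg_lt_size tt)) // leq_pred.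
apply: (@le_trans _ _ ((size t)%:R `^ (- s) * ((size t)%:R / (maxdeg t)%:R) `^ (1 + s))).
  have ns : 0 < (size t)%:R `^ s :> R by exact: powR_gt0.
  rewrite powRM ?invr_ge0 ?(ltW n0) ?(ltW D1) //.
  rewrite -[(maxdeg t)%:R^-1]powR_inv1 ?(ltW D1) // -powRrM mulN1r.
  rewrite mulrA ler_pM2r ?powR_gt0 // (powR1D s_gt0) ?(ltW n0) // powRN mulrCA mulVf ?mulr1 //.
  by rewrite gt_eqF.
rewrite ler_pM2l ?powR_gt0 // -powR_mulrn ?divr_ge0 //.
exact: ler_powR.
Qed.

Lemma Ex_uncrowded_loss t : treelike t -> (hub_start <= maxdeg t)%N -> (4 * q <= size t)%N ->
  forall j, Ex f j uncrowded_loss t <= (size t)%:R +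
    (F / c * (expR drift_total * (size t)%:R ^+ q)) * \sum_(i < j) (i + size t)%:R `^ (- s).
Proof.
move=> tt hD hq j; have F0 := small_max_gt0; have cp := c_gt0.
elim: j => [|j IH].
  rewrite big_ord0 mulr0 addr0 /Ex /= /uncrowded_loss.
  apply: (@le_trans _ _ (loss t)%:R); first by rewrite ler_piMl // lern1 leq_b1.
  by rewrite ler_nat /loss; lia.
rewrite ExS big_ord_recr /= mulrDr addrA.
apply: (@le_trans _ _ (Ex f j (fun t' => uncrowded_loss t' + (F / c * (j + size t)%:R `^ (- s)) * spread t') t)).
  apply: (Ex_le f_gt0) => // t' tt' ts'; rewrite -ts'; exact: mean_uncrowded_loss.
rewrite ExD ExZ; apply: lerD => //.
have h := Ex_spread j tt hD hq.
have -> : F / c * (expR drift_total * (size t)%:R ^+ q) * (j + size t)%:R `^ (- s) =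
  (F / c * (j + size t)%:R `^ (- s)) * (expR drift_total * (size t)%:R ^+ q) by ring.
apply: ler_wpM2l h; rewrite mulr_ge0 ?powR_ge0 // divr_ge0 //; lra.
Qed.

End Fixed.

Definition growth (n : nat) : R := 1 + \sum_(1 <= m < n) m%:R `^ (- s).

(** Run the chain until the largest degree is large, apply [Ex_uncrowded_loss]
    from there on, and conclude with the Markov inequality. *)
Lemma loss_tail (e : R) : 0 < e -> exists2 B : R, 0 < B & forall j (x : R), 0 < x ->
  Ex f j (fun t => (x < (loss t)%:R)%R%:R) edge_degrees <= e + B * growth (j + 2) / x.
Proof.
move=> e0; have e2 : 0 < e / 2 by lra.
have [K hK] := crowded_small s_gt0 c_gt0 C_gt0 f_ge f_le e2.
have [q0 hq0] := natr_unbounded (1 + s).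
have sq := hq0 q0 (leqnn _); set q := q0 in sq.
have [m1 hm1] := maxdeg_unbounded s_gt0 c_gt0 C_gt0 f_ge f_le (hub_start K q) treelike_edge e2.
pose m := maxn m1 (4 * q)%N; pose n := (m + 2)%N.
pose A : R := small_max K / c * (expR (drift_total K q) * n%:R ^+ q).
have F0 := small_max_gt0 K; have cp := c_gt0.
have A0 : 0 <= A.
  by rewrite mulr_ge0 ?divr_ge0 ?(ltW F0) ?(ltW cp) // mulr_ge0 ?expR_ge0 // exprn_ge0.
have nA : 0 < n%:R + A by rewrite ltr_pwDl // ltr0n /n addn2.
exists (n%:R + A) => // j x x0.
have g1 k : 1 <= growth k by rewrite lerDl sumr_ge0 // => i _; rewrite powR_ge0.
have markov (y : R) : 0 <= y -> (x < y)%R%:R <= y / x.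
  move=> y0; case: ltP => h; last by rewrite divr_ge0 // ltW.
  by rewrite ler_pdivlMr // mul1r ltW.
have [mj|jm] := leqP m j; last first.
  apply: (@le_trans _ _ (n%:R / x)).
    rewrite -[leRHS](Ex_cst f_gt0 j _ treelike_edge); apply: (Ex_le f_gt0) => // t tt ts.
    apply: le_trans (markov _ _) _ => //; rewrite ler_pM2r ?invr_gt0 // ler_nat /loss ts /= /n.
    by clear -jm; lia.
  apply: ler_wpDl; first exact: ltW.
  rewrite ler_pM2r ?invr_gt0 // mulrDl.
  by apply: ler_wpDr; [rewrite mulr_ge0 // (le_trans ler01) | rewrite ler_peMr].
rewrite -{1}(subnKC mj) Ex_add.
pose G := (n%:R + A) * growth (j + 2) / x.
apply: (@le_trans _ _ (Ex f m (fun t => (maxdeg t <= hub_start K q)%:R +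
    (Ex f (j - m) (fun t' => (crowded K t')%:R) t + G)) edge_degrees)).
  apply: (Ex_le f_gt0) => // t tt ts.
  have G0 : 0 <= G.
    by rewrite divr_ge0 ?(ltW x0) // mulr_ge0 ?(ltW nA) // (le_trans ler01).
  have E0 : 0 <= Ex f (j - m) (fun t' => (crowded K t')%:R) t.
    rewrite -(Ex_cst f_gt0 (j - m)%N 0 tt); apply: (Ex_le f_gt0) => // t' _ _.
  case: leqP => hD.
    apply: (@le_trans _ _ 1); last by move: E0; set y := Ex _ _ _ _ => E0; rewrite /=; lra.
    rewrite -[leRHS](Ex_cst f_gt0 (j - m)%N 1 tt); apply: (Ex_le f_gt0) => // t' _ _.
    by case: ltP.
  rewrite add0r.
  apply: (@le_trans _ _ (Ex f (j - m) (fun t' => (crowded K t')%:R + x^-1 * uncrowded_loss K t') t)).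
    apply: (Ex_le f_gt0) => // t' _ _; rewrite /uncrowded_loss.
    case: (crowded K t') => /=; first by rewrite mul0r mulr0 addr0; case: ltP.
    by rewrite mul1r add0r mulrC; apply: markov.
  rewrite ExD ExZ lerD2l /G [leRHS]mulrC ler_pM2l ?invr_gt0 //.
  have tn : size t = n by rewrite ts.
  have hq : (4 * q <= size t)%N.
    by rewrite tn /n; apply: leq_trans (leq_addr _ _); rewrite leq_maxr.
  apply: le_trans (Ex_uncrowded_loss sq tt (ltnW hD) hq _) _.
  rewrite tn -/A mulrDl; apply: lerD; first by rewrite ler_peMr.
  apply: ler_wpM2l => //; rewrite /growth ler_wpDl //.
  rewrite (big_cat_nat (n := n)) //=; last 2 first.
  - by rewrite /n addn2.
  - by rewrite /n leq_add2r.
  rewrite ler_wpDl //; first by apply: sumr_ge0 => i _; rewrite powR_ge0.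
  have -> : (j + 2)%N = (j - m + n)%N by rewrite /n addnA subnK.
  by rewrite -{2}[n]add0n big_addn addnK big_mkord.
rewrite ExD ExD (Ex_cst f_gt0) // -Ex_add subnKC //.
have h1 := hK j; have h2 := hm1 m (leq_maxl _ _).
move: h1 h2; rewrite /G; set a := Ex _ _ _ _; set b := Ex _ _ _ _; lra.
Qed.

End Endgame.

(** * Sums of inverse powers *)

Section GrowthBounds.
Context {R : realType}.
Implicit Types s : R.

Lemma growth_ge1 s n : 1 <= growth s n.
Proof. by rewrite lerDl sumr_ge0 // => i _; rewrite powR_ge0. Qed.

Lemma growth_telescope s (g : nat -> R) n : (0 < n)%N ->
  (forall m, (0 < m)%N -> m%:R `^ (- s) <= g m.+1 - g m) ->
  growth s n <= 1 + (g n - g 1%N).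
Proof.
case: n => // n _ h; rewrite lerD2l; elim: n => [|n IH]; first by rewrite big_geq // subrr.
by rewrite big_nat_recr //=; have := h n.+1 isT; lra.
Qed.

Lemma growth_log : exists2 A : R, 0 < A & forall n, (2 <= n)%N -> growth 1 n <= A * ln n%:R.
Proof.
have l2 : 0 < ln 2 :> R by rewrite ln_gt0 // ltr1n.
exists (1 + 2 / ln 2) => [|n n2]; first by rewrite addr_gt0 // divr_gt0.
(* The term of index 1 cannot be compared with a difference of logarithms; the
   value - 1 at 1 lets it telescope with the others. *)
pose g m : R := if m is m'.+1 then if m' is 0 then -1 else ln m'%:R else 0.
have h : growth 1 n <= 1 + (g n - g 1%N).
  apply: growth_telescope; first exact: ltnW.
  case=> // [[_|m _]]; first by rewrite powR_inv1 // invr1 /g ln1; lra.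
  by rewrite powR_inv1 ?ler0n //; apply: ln_succ_ge.
have gn : g n <= ln n%:R.
  case: n n2 {h} => [|[|n]] // _; rewrite /g /= ler_ln ?posrE ?ltr0n // ler_nat.
  exact: leqnSn.
have ln2n : ln 2 <= ln n%:R :> R by rewrite ler_ln ?posrE ?ltr0n ?ler_nat // ltnW.
have : 2 <= 2 / ln 2 * ln n%:R :> R by rewrite mulrAC ler_pdivlMr //; lra.
by rewrite /g in h gn *; lra.
Qed.

Lemma growth_pow s : 0 < s < 1 ->
  exists2 A : R, 0 < A & forall n, (1 <= n)%N -> growth s n <= A * n%:R `^ (1 - s).
Proof.
case/andP => s0 s1; have b0 : 0 < 1 - s by lra.
exists (1 + 2 / (1 - s)) => [|n n1]; first by rewrite addr_gt0 // divr_gt0.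
have h : growth s n <= 1 + (2 / (1 - s) * n%:R `^ (1 - s) - 2 / (1 - s) * 1%:R `^ (1 - s)).
  apply: (@growth_telescope s (fun m => 2 / (1 - s) * m%:R `^ (1 - s))) => // m m0.
  have hm := powR_succ_ge (ltW b0) m0.
  have m1 : 1 <= m%:R :> R by rewrite ler1n.
  have mE : m.+1%:R = m%:R + 1 :> R by rewrite natr1.
  have mp : m%:R `^ (- s) = m%:R `^ (1 - s) / m%:R :> R.
    rewrite [in LHS](_ : - s = (1 - s) - 1); last by ring.
    by rewrite powRB ?powRr1 // pnatr_eq0 -lt0n m0 implybT.
  have P0 : 0 < m%:R `^ (1 - s) :> R by rewrite powR_gt0; lra.
  rewrite mp -mulrBr mulrAC ler_pdivlMr //; rewrite mE in hm *.
  set P := m%:R `^ (1 - s) in hm P0 *; set x : R := m%:R in m1 hm *.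
  have e1 : (1 - s) / (2 * x) * P <= (1 - s) / (x + 1) * P.
    rewrite ler_pM2r // ler_pM2l // lef_pV2 ?posrE; lra.
  have -> : P / x * (1 - s) = 2 * ((1 - s) / (2 * x) * P) by field; lra.
  by rewrite ler_pM2l //; lra.
have p1 : 1 <= n%:R `^ (1 - s) :> R.
  by rewrite -[leLHS](powRr0 n%:R); apply: ler_powR; [rewrite ler1n|apply: ltW].
rewrite powR1 in h.
have : 0 < 2 / (1 - s) by rewrite divr_gt0.
set a := 2 / (1 - s) in h *; lra.
Qed.

Lemma growth_bounded s : 1 < s -> exists2 A : R, 0 < A & forall n, growth s n <= A.
Proof.
move=> s1; have b0 : 0 < s - 1 by lra.
pose k : R := (2 + (s - 1)) / (s - 1); have k0 : 0 < k by rewrite divr_gt0 //; lra.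
exists (1 + k) => [|[|n]]; first by rewrite addr_gt0.
  by rewrite /growth big_geq // addr0 lerDl ltW.
apply: le_trans (@growth_telescope s (fun m => - (k * m%:R `^ (- (s - 1)))) n.+1 isT _) _.
  move=> m m0; have := powR_neg_diff b0 m0.
  by rewrite -/k (_ : 1 + (s - 1) = s); [lra | ring].
have h : 0 <= k * n.+1%:R `^ (- (s - 1)) by rewrite mulr_ge0 ?powR_ge0 ?(ltW k0).
by rewrite powR1; lra.
Qed.

Lemma growth_sublinear s (e : R) : 0 < s -> 0 < e ->
  exists N : nat, forall n : nat, (N <= n)%N -> growth s n <= e * n%:R.
Proof.
move=> s0 e0; have e2 : 0 < e / 2 by lra.
have [N hN] := powR_neg_small s0 e2.
have lin n : growth s (N + n) <= growth s N + e / 2 * n%:R.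
  elim: n => [|n IH]; first by rewrite addn0 mulr0 addr0.
  rewrite addnS -[n.+1%:R]natr1 mulrDr mulr1 addrA.
  apply: (@le_trans _ _ (growth s (N + n) + e / 2)); last by lra.
  rewrite /growth; case: (N + n)%N (hN (N + n)%N (leq_addr _ _)) => [|l] hl.
    by rewrite !big_geq // lerDl ltW.
  by rewrite big_nat_recr //= addrA lerD2l.
have [M hM] := natr_unbounded (growth s N / (e / 2)).
exists (N + M)%N => n NMn; have Nn : (N <= n)%N by apply: leq_trans NMn; rewrite leq_addr.
have := lin (n - N)%N; rewrite subnKC // => h.
have h1 : growth s N <= e / 2 * n%:R.
  have := hM n (leq_trans (leq_addl _ _) NMn); rewrite ler_pdivrMr // => h1; lra.
have h2 : (n - N)%:R <= n%:R :> R by rewrite ler_nat leq_subr.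
have : e / 2 * (n - N)%:R <= e / 2 * n%:R by rewrite ler_pM2l.
lra.
Qed.

End GrowthBounds.

(** * Graphs, pendant vertices and degrees *)

Section GraphEncoding.
Context {V : finType}.

(** Graphs are determined by their vertices and edges; this makes them a
    finite type, so that laws of random trees are finite sums. *)
Definition graph_code (G : sgraph V) : {set V} * {set {set V}} := (verts G, edges G).

Definition graph_decode (p : {set V} * {set {set V}}) : option (sgraph V) :=
  match boolP [forall e in p.2, (#|e| == 2)%N && (e \subset p.1)] with
  | AltTrue h => Some (SGraph h)
  | AltFalse _ => None
  end.

Lemma graph_codeK : pcancel graph_code graph_decode.
Proof.
case=> v e h; rewrite /graph_decode /=.
by case: {-}_ / boolP => [h'|/negP //]; rewrite (bool_irrelevance h h').
Qed.

HB.instance Definition _ := Equality.copy (sgraph V) (pcan_type graph_codeK).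
HB.instance Definition _ := Choice.copy (sgraph V) (pcan_type graph_codeK).
HB.instance Definition _ := Countable.copy (sgraph V) (pcan_type graph_codeK).
HB.instance Definition _ := Finite.copy (sgraph V) (pcan_type graph_codeK).

Lemma sgraph_eq (G H : sgraph V) : verts G = verts H -> edges G = edges H -> G = H.
Proof. by move=> h1 h2; apply: (pcan_inj graph_codeK); rewrite /graph_code h1 h2. Qed.

Lemma edge_card (G : sgraph V) e : e \in edges G -> #|e| = 2%N.
Proof. by move=> eG; have /forall_inP/(_ _ eG)/andP[/eqP] := edges_verts G. Qed.

Lemma edge_sub (G : sgraph V) e : e \in edges G -> e \subset verts G.
Proof. by move=> eG; have /forall_inP/(_ _ eG)/andP[] := edges_verts G. Qed.

Lemma adj_sym (G : sgraph V) : symmetric (adj G).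
Proof. by move=> x y; rewrite /adj finset.setUC. Qed.

Lemma adj_neq (G : sgraph V) x y : adj G x y -> x != y.
Proof.
by move=> /edge_card; rewrite cards2; case: eqP.
Qed.

Lemma adj_verts (G : sgraph V) x y : adj G x y -> (x \in verts G) /\ (y \in verts G).
Proof.
by move=> /edge_sub /fintype.subsetP h; split; apply: h; rewrite !inE eqxx ?orbT.
Qed.

Definition nbrs (G : sgraph V) x : {set V} := [set y | adj G x y]%SET.

Lemma card_nbrs (G : sgraph V) x : #|nbrs G x| = deg G x.
Proof.
have inj : {in nbrs G x &, injective (fun y => [set x; y]%SET)}.
  move=> y z; rewrite !inE => hy hz e.
  have : y \in [set x; z]%SET by rewrite -e !inE eqxx orbT.
  by rewrite !inE eq_sym (negbTE (adj_neq hy)) => /eqP.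
rewrite /deg -(card_in_imset inj); apply: eq_card => e; rewrite !inE.
apply/imsetP/andP => [[y]|[eG xe]].
  by rewrite inE => hy ->; split=> //; rewrite !inE eqxx.
have ec : #|e| == 2%N by rewrite (edge_card eG).
case/cards2P: ec => a [b [ab ee]].
have ab' : adj G a b by rewrite /adj -ee.
move: xe; rewrite ee !inE => /orP[/eqP ->|/eqP ->]; first by exists b; rewrite ?inE.
by exists a; rewrite ?inE 1?adj_sym // finset.setUC.
Qed.

End GraphEncoding.

Section Pendant.
Context {U W : finType} (h : U -> W) (z : W).
Context (h_inj : injective h) (h_neq : forall x, h x != z).
Implicit Types (E : {set {set U}}) (x y u : U).

(** The edges obtained from [E] by renaming along [h] and joining the new point
    [z] to [h u]. The new trees of the growth process and the enlarged common
    subtrees are both of this form. *)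
Definition pendant E u : {set {set W}} :=
  ([set h u; z] |: [set (h @: (e : {set U}))%SET | e in E])%SET.

Lemma pendant_old E u x y :
  ([set h x; h y]%SET \in pendant E u) = ([set x; y]%SET \in E).
Proof.
rewrite in_setU1.
have -> : ([set h x; h y] == [set h u; z])%SET = false.
  apply/eqP => /setP /(_ z); rewrite !inE eqxx orbT.
  by rewrite ![z == _]eq_sym !(negbTE (h_neq _)).
rewrite /= (_ : [set h x; h y]%SET = (h @: [set x; y])%SET).
  by rewrite mem_imset //; apply: imset_inj h_inj.
by rewrite imsetU !imset_set1.
Qed.

Lemma pendant_new E u x : ([set h x; z]%SET \in pendant E u) = (x == u).
Proof.
rewrite in_setU1; apply/orP/eqP => [[/eqP/setP/(_ (h x))|]|->].
- by rewrite !inE eqxx /= (negbTE (h_neq _)) orbF => /esym/eqP; apply: h_inj.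
- case/imsetP => e _ /setP/(_ z); rewrite !inE eqxx orbT => /esym/imsetP[w _ /eqP].
  by rewrite eq_sym (negbTE (h_neq _)).
- by left.
Qed.

End Pendant.

Section Attach.
Context {n : nat}.
Implicit Types (t : sgraph 'I_n) (i j : 'I_n).

Lemma old_inj : injective (@old_vertex n).
Proof. by move=> i j /(congr1 val) /= /val_inj. Qed.

Lemma old_neq_max i : old_vertex i != ord_max.
Proof. by rewrite -val_eqE /= neq_ltn ltn_ord. Qed.

Lemma ord_old_or_max (x : 'I_n.+1) : x = ord_max \/ exists i, x = old_vertex i.
Proof.
have [xn|nx] := ltnP x n; first by right; exists (Ordinal xn); apply: val_inj.
by left; apply: val_inj => /=; apply/eqP; rewrite eqn_leq nx -ltnS ltn_ord.
Qed.

Lemma adj_attach_old t i (x y : 'I_n) :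
  adj (attach t i) (old_vertex x) (old_vertex y) = adj t x y.
Proof. exact: (pendant_old old_inj old_neq_max). Qed.

Lemma adj_attach_max t i (x : 'I_n) :
  adj (attach t i) (old_vertex x) ord_max = (x == i).
Proof. exact: (pendant_new old_inj old_neq_max). Qed.

Lemma deg_attach_old t i (x : 'I_n) :
  deg (attach t i) (old_vertex x) = ((i == x) + deg t x)%N.
Proof.
rewrite -!card_nbrs.
have -> : nbrs (attach t i) (old_vertex x) =
    ((if i == x then [set ord_max] else finset.set0) :|: (@old_vertex n @: nbrs t x))%SET.
  apply/setP => y; rewrite !inE.
  have [->|[j ->]] := ord_old_or_max y.
    rewrite adj_attach_max eq_sym; case: eqP => _; rewrite !inE ?eqxx //=.
    apply/esym/negbTE/imsetP => -[z _ /eqP]; by rewrite eq_sym (negbTE (old_neq_max _)).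
  rewrite adj_attach_old mem_imset ?inE; last exact: old_inj.
  by case: eqP; rewrite !inE ?(negbTE (old_neq_max _)).
rewrite cardsU (card_imset _ old_inj) (_ : _ :&: _ = finset.set0)%SET ?cards0 ?subn0.
  by case: eqP; rewrite ?cards1 ?cards0.
apply/setP => y; rewrite !inE; apply/negbTE/negP => /andP[].
case: eqP => _; rewrite !inE // => /eqP -> /imsetP[z _ /eqP].
by rewrite eq_sym (negbTE (old_neq_max _)).
Qed.

Lemma deg_attach_max t i : deg (attach t i) ord_max = 1%N.
Proof.
rewrite -card_nbrs (_ : nbrs _ _ = [set old_vertex i]%SET) ?cards1 //.
apply/setP => y; rewrite !inE adj_sym; have [->|[j ->]] := ord_old_or_max y.
  rewrite eq_sym (negbTE (old_neq_max _)); apply/negbTE/negP => /adj_neq.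
  by rewrite eqxx.
by rewrite adj_attach_max (inj_eq old_inj).
Qed.

Lemma attach_inj t t' i i' : verts t = verts t' ->
  attach t i = attach t' i' -> t = t' /\ i = i'.
Proof.
move=> hv h.
have ad x y : adj t x y = adj t' x y by rewrite -(adj_attach_old t i) h adj_attach_old.
split; last first.
  apply/eqP; rewrite -(adj_attach_max t') -h adj_attach_max eqxx //.
apply: sgraph_eq => //; apply/setP => e.
have key (s s' : sgraph 'I_n) : (forall x y, adj s x y = adj s' x y) ->
    e \in edges s -> e \in edges s'.
  move=> hs es; have ec : #|e| == 2%N by rewrite (edge_card es).
  case/cards2P: ec => a [b [ab ee]].
  by move: (hs a b); rewrite /adj -ee es => /esym.
by apply/idP/idP; apply: key.
Qed.

Definition degseq t : seq nat := [seq deg t i | i <- enum 'I_n].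

Lemma size_degseq t : size (degseq t) = n.
Proof. by rewrite size_map size_enum_ord. Qed.

Lemma nth_degseq t i : dg (degseq t) i = deg t i.
Proof. by rewrite (nth_map i) ?size_enum_ord // nth_ord_enum. Qed.

End Attach.

Lemma degseq_attach n (t : sgraph 'I_n) (i : 'I_n) :
  degseq (attach t i) = grow (degseq t) i.
Proof.
have si : (i < size (degseq t))%N by rewrite size_degseq.
apply: (@eq_from_nth _ 0%N) => [|j]; first by rewrite size_degseq size_grow // size_degseq.
rewrite size_degseq => jn; rewrite -[j]/(val (Ordinal jn)) nth_degseq nth_grow //.
rewrite size_degseq; have [h|[x h]] := ord_old_or_max (Ordinal jn).
  by rewrite h deg_attach_max /= ltnn eqxx.
by rewrite h deg_attach_old /= ltn_ord nth_degseq val_eqE.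
Qed.

(** * Common stars *)

Section Star.
Context {V : finType}.
Implicit Types (v : V) (A : {set V}).

Lemma star_proof v A :
  [forall e in [set [set v; a] | a in A :\ v]%SET, (#|e : {set V}| == 2)%N && (e \subset (v |: A)%SET)].
Proof.
apply/forall_inP => e /imsetP[a]; rewrite !inE => /andP[av aA] ->.
rewrite cards2 (eq_sym v) av /=; apply/fintype.subsetP => x; rewrite !inE => /orP[/eqP->|/eqP->].
  by rewrite eqxx.
by rewrite aA orbT.
Qed.

Definition star v A : sgraph V := SGraph (star_proof v A).

Lemma adj_star v A x y :
  adj (star v A) x y = ((x == v) && (y \in A :\ v)%SET) || ((y == v) && (x \in A :\ v)%SET).
Proof.
rewrite /adj /=; apply/imsetP/orP => [[a aA /setP e]|[]/andP[/eqP->]]; last 2 first.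
- by move=> yA; exists y.
- by move=> xA; exists x => //; rewrite finset.setUC.
move: aA (e x) (e v) (e a); rewrite !inE !eqxx !orbT /= => /andP[av aA].
case: (eqVneq x v) => [->|xv] /=.
  by rewrite (negbTE av) /= => _ _ /eqP <-; left; rewrite av.
move=> /esym/eqP -> /eqP <- _.
by right; rewrite eqxx.
Qed.

Lemma star_connected v A : connected_graph (star v A).
Proof.
have sym := sym_connect_sym (adj_sym (star v A)).
suff h x : x \in verts (star v A) -> connect (adj (star v A)) v x.
  by move=> x y /h hx /h; apply: connect_trans; rewrite sym.
rewrite /= in_setU1; case: eqVneq => [-> _|xv /= xA]; first exact: connect0.
by apply: connect1; rewrite adj_star eqxx !inE xv xA.
Qed.

(** Every edge contains the centre. In a cycle x, y, w, ... with at least three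
    points, the centre is then y, or both x and w; the successor of w excludes
    the first case. *)
Lemma star_acyclic v A : acyclic_graph (star v A).
Proof.
have av x y : adj (star v A) x y -> (x == v) || (y == v).
  by rewrite adj_star => /orP[]/andP[->]; rewrite ?orbT.
case=> [|x [|y [|w c]]] // /andP[/and3P[/av xy /av yw wc] uq].
have [nxy nxw nyw] : [/\ x != y, x != w & y != w].
  by move: uq; rewrite /= !inE !negb_or => /andP[/and3P[-> -> _] /andP[/andP[-> _] _]].
have [u /av wu uy] : exists2 u, adj (star v A) w u & u != y.
  case: c wc uq => [|u c] /= /andP[wu _]; first by exists x.
  by rewrite !inE !negb_or => /and3P[_ /and3P[_ yu _] _]; exists u => //; rewrite eq_sym.
exfalso; have [yv|yv] := eqVneq y v.
  by move: wu; rewrite -yv (negbTE uy) eq_sym (negbTE nyw).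
by move: xy yw nxw; rewrite (negbTE yv) orbF /= => /eqP -> /eqP ->; rewrite eqxx.
Qed.

Lemma star_tree v A : is_tree (star v A).
Proof.
split; [|exact: star_connected|exact: star_acyclic].
by apply/set0Pn; exists v; rewrite /= setU11.
Qed.

Lemma star_subgraph (G : sgraph V) v A :
  v \in verts G -> A \subset nbrs G v -> subgraph (star v A) G.
Proof.
move=> vG /fintype.subsetP AN; split; apply/fintype.subsetP => x.
  rewrite /= in_setU1 => /orP[/eqP -> //|/AN]; rewrite inE => /adj_verts[].
  by [].
case/imsetP => a; rewrite !inE => /andP[_ /AN]; rewrite inE => h ->; exact: h.
Qed.

End Star.

Lemma card_bij (V W : finType) (w0 : W) (A : {set V}) (B : {set W}) : #|A| = #|B| ->
  exists2 g : V -> W, {in A &, injective g} & g @: A = B.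
Proof.
move=> AB; pose g x := nth w0 (enum B) (index x (enum A)).
have gB x : x \in A -> g x \in B.
  move=> xA; rewrite -mem_enum mem_nth // -cardE -AB cardE index_mem.
  by rewrite mem_enum.
have gi : {in A &, injective g}.
  move=> x y xA yA /eqP; rewrite nth_uniq ?enum_uniq // -?cardE -?AB ?cardE ?index_mem ?mem_enum //.
  by move=> /eqP e; rewrite -[x](@nth_index _ x _ (enum A)) ?mem_enum // e nth_index ?mem_enum.
exists g => //; apply/eqP; rewrite eqEcard card_in_imset // AB leqnn andbT.
by apply/fintype.subsetP => _ /imsetP[x xA ->]; apply: gB.
Qed.

Lemma star_iso (V W : finType) (v : V) (w : W) (A : {set V}) (B : {set W}) :
  v \notin A -> w \notin B -> #|A| = #|B| -> graph_iso (star v A) (star w B).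
Proof.
move=> vA wB /(card_bij w)[g gi gAB].
have gA x : x \in A -> g x \in B by move=> xA; rewrite -gAB imset_f.
have neq x : x \in A -> x != v by apply: contraTneq => ->.
have neqB x : x \in A -> g x != w by move=> /gA; apply: contraTneq => ->.
pose phi x := if x == v then w else g x.
exists phi; split => /=.
- move=> x y; rewrite !inE /phi.
  case: (eqVneq x v) => [->|xv] /=; case: (eqVneq y v) => [->|yv] //=.
  + by move=> _ /neqB /eqP h /esym.
  + by move=> /neqB /eqP h _ e; case: h.
  + exact: gi.
- apply/setP => y; rewrite !inE; apply/imsetP/orP => [[x]|].
    rewrite !inE /phi => /orP[/eqP ->|xA] ->; first by left; rewrite eqxx.
    by right; rewrite (negbTE (neq _ xA)) gA.
  case=> [/eqP ->|]; first by exists v; rewrite ?setU11 // /phi eqxx.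
  rewrite -gAB => /imsetP[x xA ->]; exists x; first by rewrite inE xA orbT.
  by rewrite /phi (negbTE (neq _ xA)).
- have phw x : x \in verts (star v A) -> (phi x == w) = (x == v).
    rewrite /= in_setU1 /phi; case: (eqVneq x v) => [_ _|xv /= xA]; first by rewrite eqxx.
    exact/negbTE/neqB.
  have phB x : x \in verts (star v A) -> (phi x \in B :\ w)%SET = (x \in A :\ v)%SET.
    move=> xS; rewrite in_setD1 phw // in_setD1.
    move: xS; rewrite /= in_setU1 /phi; case: (eqVneq x v) => //= _ xA.
    by rewrite gA.
  by move=> x y xS yS; rewrite !adj_star !phw // !phB.
Qed.

Lemma graph_iso_refl (V : finType) (G : sgraph V) : graph_iso G G.
Proof. by exists id; split => //; rewrite imset_id. Qed.

Lemma subset_of_card (V : finType) (A : {set V}) k : (k <= #|A|)%N ->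
  exists2 B : {set V}, B \subset A & #|B| = k.
Proof.
move=> kA; exists [set x in take k (enum A)]%SET.
  by apply/fintype.subsetP => x; rewrite inE => /mem_take; rewrite mem_enum.
rewrite cardsE (card_uniqP _) ?take_uniq ?enum_uniq // size_take -cardE.
by case: ltngtP kA.
Qed.

(** The stars with k leaves around [v] and [w] are isomorphic. *)
Lemma lcs_size_star (V W : finType) (G : sgraph V) (H : sgraph W) v w k :
  v \in verts G -> w \in verts H -> (k <= deg G v)%N -> (k <= deg H w)%N ->
  (k < lcs_size G H)%N.
Proof.
move=> vG wH; rewrite -!card_nbrs => /subset_of_card[A AG Ak] /subset_of_card[B BH Bk].
have nself (T : finType) (F : sgraph T) x : x \notin nbrs F x.
  by rewrite inE; apply/negP => /adj_neq; rewrite eqxx.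
have vA : v \notin A by apply: contra (nself _ G v); apply: (fintype.subsetP AG).
have wB : w \notin B by apply: contra (nself _ H w); apply: (fintype.subsetP BH).
have -> : k.+1 = #|verts (star v A)| by rewrite /= cardsU1 vA Ak.
apply: lcs_size_ub; split; first exact: star_tree.
- exists (star v A); last exact: graph_iso_refl.
  by split; [exact: star_subgraph|exact: star_tree].
- exists (star w B); last by apply: star_iso; rewrite // Ak.
  by split; [exact: star_subgraph|exact: star_tree].
Qed.

Lemma lcs_size_maxdeg n (t t' : sgraph 'I_n) : (0 < n)%N ->
  verts t = [set: 'I_n]%SET -> verts t' = [set: 'I_n]%SET ->
  (minn (maxdeg (degseq t)) (maxdeg (degseq t')) < lcs_size t t')%N.
Proof.
move=> n0 vt vt'.
have max_att (u : sgraph 'I_n) : exists v, deg u v = maxdeg (degseq u).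
  have [|w wu wm] := @maxdeg_attained (degseq u); first by rewrite size_degseq.
  rewrite size_degseq in wu; exists (Ordinal wu); rewrite -wm.
  by rewrite -[w]/(val (Ordinal wu)) nth_degseq.
have [v hv] := max_att t; have [w hw] := max_att t'.
apply: (@lcs_size_star _ _ _ _ v w); rewrite ?vt ?vt' ?inE // ?hv ?hw.
  exact: geq_minl.
exact: geq_minr.
Qed.

Lemma lcs_size_le n (t t' : sgraph 'I_n) : (lcs_size t t' <= n)%N.
Proof.
apply/bigmax_leqP => k _; rewrite -ltnS (leq_trans (ltn_ord k)) // ltnS.
by rewrite -[leqRHS]card_ord max_card.
Qed.

(** * Adding a leaf to a common subtree *)

Section Grafting.
Context {U W : finType} (h : U -> W) (z : W).
Context (h_inj : injective h) (h_neq : forall x, h x != z).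
Context (G : sgraph U) (s : U) (sG : s \in verts G).

Lemma graft_proof : [forall e in pendant h z (edges G) s,
  (#|e : {set W}| == 2)%N && (e \subset (z |: [set h x | x in verts G])%SET)].
Proof.
apply/forall_inP => e; rewrite in_setU1 => /orP[/eqP ->|/imsetP[e' e'G ->]].
  rewrite cards2 h_neq /=; apply/fintype.subsetP => x; rewrite !inE => /orP[/eqP ->|/eqP ->].
    by rewrite imset_f ?orbT.
  by rewrite eqxx.
rewrite card_imset // (edge_card e'G) /=; apply/fintype.subsetP => x.
by move=> /(fintype.subsetP (imsetS h (edge_sub e'G))) xG; rewrite in_setU1 xG orbT.
Qed.

(** The tree [G] with a leaf added at [s], drawn in another type. *)
Definition graft : sgraph W := SGraph graft_proof.

Lemma adj_graft_old x y : adj graft (h x) (h y) = adj G x y.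
Proof. exact: pendant_old. Qed.

Lemma adj_graft_new x : adj graft (h x) z = (x == s).
Proof. exact: pendant_new. Qed.

Lemma adj_graft_newl x : adj graft z (h x) = (x == s).
Proof. by rewrite adj_sym adj_graft_new. Qed.

Lemma verts_graftP y : y \in verts graft -> y = z \/ exists2 x, x \in verts G & y = h x.
Proof.
by rewrite in_setU1 => /orP[/eqP ->|/imsetP[x xG ->]]; [left|right; exists x].
Qed.

Lemma card_graft : #|verts graft| = #|verts G|.+1.
Proof.
rewrite /= cardsU1 card_imset // (_ : z \notin _) //.
by apply/imsetP => -[x _ /eqP]; rewrite eq_sym (negbTE (h_neq x)).
Qed.

Lemma adj_graft_newE y : adj graft z y -> y = h s.
Proof.
move=> zy; have [_ /verts_graftP[yz|[x _ yx]]] := adj_verts zy.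
  by have := adj_neq zy; rewrite yz eqxx.
by move: zy; rewrite yx adj_graft_newl => /eqP ->.
Qed.

(** A cycle through the new point would enter and leave it by the same
    neighbour; a cycle avoiding it is a cycle of [G]. *)
Lemma graft_tree : is_tree G -> is_tree graft.
Proof.
case=> Gn0 Gcon Gac; split.
- by apply/set0Pn; exists z; rewrite /= setU11.
- have sym := sym_connect_sym (adj_sym graft).
  have hom x y : connect (adj G) x y -> connect (adj graft) (h x) (h y).
    case/connectP => p; elim: p x => [|w p IH] x /=; first by move=> _ ->; apply: connect0.
    case/andP => xw pth yl; apply: connect_trans (IH w pth yl).
    by apply: connect1; rewrite adj_graft_old.
  suff cs x : x \in verts graft -> connect (adj graft) (h s) x.
    by move=> x y /cs hx /cs; apply: connect_trans; rewrite sym.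
  case/verts_graftP => [->|[y yG ->]]; last exact: hom (Gcon _ _ sG yG).
  by apply: connect1; rewrite adj_graft_new.
- move=> c /andP[cyc uq]; rewrite ltnNge; apply/negP => c3.
  have [zc|zc] := boolP (z \in c).
    have [i c' cE] := rot_to zc.
    move: cyc uq c3; rewrite -(rot_cycle i) -(rot_uniq i) -(size_rot i) cE.
    case: c' {cE} => [|x c'] //=; case/lastP: c' => // c' y.
    rewrite rcons_path last_rcons => /and3P[/adj_graft_newE -> _].
    rewrite adj_sym => /adj_graft_newE -> /and3P[_ + _] _.
    by rewrite mem_rcons inE eqxx.
  have imc y : y \in c -> exists x, y = h x.
    move=> yc; have := next_cycle cyc yc => /adj_verts[/verts_graftP[yz|[x _ ->]] _].
      by rewrite -yz yc in zc.
    by exists x.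
  have [c' cE] : exists c', c = map h c'.
    elim: c imc {cyc uq c3 zc} => [|y c IH] imc; first by exists [::].
    have [|c' ->] := IH; first by move=> w wc; apply: imc; rewrite inE wc orbT.
    by have [x ->] := imc y (mem_head _ _); exists (x :: c').
  have : (size c' < 3)%N.
    apply: Gac; rewrite /ucycle; move: cyc uq; rewrite cE map_inj_uniq // => cyc ->.
    rewrite andbT; move: cyc; case: (c') => [|x p] //=.
    rewrite -map_rcons path_map; congr (is_true _); apply: eq_path => a b /=.
    exact: adj_graft_old.
  by rewrite ltnNge; move: c3; rewrite cE size_map => ->.
Qed.

End Grafting.

Lemma some_injective (U : Type) : injective (@Some U).
Proof. by move=> x y []. Qed.

(** The abstract common subtree is enlarged by the new point of an option
    type, its two copies by a new vertex of each tree. *)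
Lemma graft_iso (U V W : finType) (h : V -> W) (z : W)
    (h_inj : injective h) (h_neq : forall x, h x != z)
    (S : sgraph U) (H : sgraph V) (s : U) (v : V)
    (sS : s \in verts S) (vH : v \in verts H) (phi : U -> V)
    (phi_inj : {in verts S &, injective phi}) (phiS : phi @: verts S = verts H)
    (phi_adj : {in verts S &, forall x y, adj H (phi x) (phi y) = adj S x y})
    (phis : phi s = v) (Some_neq : forall x : U, Some x != None) :
  graph_iso (graft (@some_injective U) Some_neq sS) (graft h_inj h_neq vH).
Proof.
pose psi (x : option U) := if x is Some x' then h (phi x') else z.
have vS (x : U) : Some x \in verts (graft (@some_injective U) Some_neq sS) -> x \in verts S.
  by move=> hx; case: (verts_graftP hx) => [//|[y yS [->]]].
exists psi; split.
- move=> [x|] [y|] //=.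
  + by move=> /vS xS /vS yS /h_inj /phi_inj ->.
  + by move=> _ _ /eqP; rewrite (negbTE (h_neq _)).
  + by move=> _ _ /eqP; rewrite eq_sym (negbTE (h_neq _)).
- apply/setP => y; apply/imsetP/idP => [[[x|] xS ->]|hy] /=; last first.
    case: (verts_graftP hy) => [->|[x xH ->]]; last first.
      move: xH; rewrite -phiS => /imsetP[u uS ->]; exists (Some u) => //=.
      by rewrite in_setU1 imset_f ?orbT.
    by exists None; rewrite //= setU11.
  + by rewrite setU11.
  + by rewrite in_setU1 imset_f ?orbT // -phiS imset_f // vS.
- have sc (x : U) : x \in verts S -> (phi x == v) = (x == s).
    move=> xS; apply/eqP/eqP => [|->] //; rewrite -phis => /phi_inj; exact.
  move=> [x|] [y|] /=.
  + by move=> /vS xS /vS yS; rewrite !adj_graft_old phi_adj.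
  + by move=> /vS xS _; rewrite !adj_graft_new sc.
  + by move=> _ /vS yS; rewrite !adj_graft_newl sc.
  + move=> _ _; apply/idP/idP => /adj_neq; by rewrite eqxx.
Qed.

Section Hubs.
Context {n : nat}.
Implicit Types (t : sgraph 'I_n).

Definition leaves_at t v : {set 'I_n} := [set a | nbrs t a == [set v]%SET]%SET.

(** A path of [H] that leaves [a] has to start with its only neighbour. *)
Lemma connected_nbr t (H : sgraph 'I_n) a b v :
  subtree H t -> a \in leaves_at t v -> a \in verts H -> b \in verts H -> a != b ->
  adj H a v.
Proof.
case=> [[_ He] [_ Hc _]] + aH bH ab.
rewrite inE => /eqP an; have /connectP[[|y p] /=] := Hc _ _ aH bH.
  by move=> _ e; rewrite e eqxx in ab.
case/andP => ay _ _; have : y \in nbrs t a by rewrite inE; apply: (fintype.subsetP He).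
by rewrite an inE => /eqP <-.
Qed.

(** A subtree that misses fewer vertices than there are leaves at [v] contains
    such a leaf, hence [v], and joins [v] to all leaves that it contains. *)
Lemma hub_in_subtree t (H : sgraph 'I_n) v :
  subtree H t -> (1 < #|verts H|)%N -> (n < #|leaves_at t v| + #|verts H|)%N ->
  v \in verts H /\ (#|leaves_at t v| + #|verts H| <= n + #|nbrs H v|)%N.
Proof.
move=> Ht H2 big.
have cap : (#|leaves_at t v| + #|verts H| <= n + #|leaves_at t v :&: verts H|)%N.
  by rewrite -cardsUI leq_add2r -[leqRHS]card_ord max_card.
have nb : (leaves_at t v :&: verts H)%SET \subset nbrs H v.
  apply/fintype.subsetP => a; rewrite finset.in_setI => /andP[aL aH]; rewrite inE adj_sym.
  have [b bH ba] : exists2 b, b \in verts H & a != b.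
    have /set0Pn[b] : (verts H :\ a)%SET != finset.set0.
      by rewrite -card_gt0; move: H2; rewrite (cardsD1 a) aH.
    by rewrite !inE => /andP[ba bH]; exists b => //; rewrite eq_sym.
  exact: connected_nbr Ht aL aH bH ba.
split; last by apply: leq_trans cap _; rewrite leq_add2l subset_leq_card.
have /card_gt0P[a aI] : (0 < #|leaves_at t v :&: verts H|)%N.
  by move: (leq_trans big cap); rewrite -[X in (X < _)%N]addn0 ltn_add2l.
by have := fintype.subsetP nb _ aI; rewrite inE => /adj_verts[].
Qed.

Lemma old_graft_subgraph t (H : sgraph 'I_n) v (vH : v \in verts H) :
  verts t = [set: 'I_n]%SET -> subgraph H t ->
  subgraph (graft (@old_inj n) (@old_neq_max n) vH) (attach t v).
Proof.
move=> vt [_ He]; split; first exact: finset.subsetT.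
by apply: finset.setUS; apply: imsetS.
Qed.

(** By [hub_in_subtree] the vertex [v] belongs to the copy of a largest common
    subtree in [t] and has a degree above [m] there. Its counterpart in [t'] has
    the same degree in the other copy, so it is [v'], and a leaf can be added at
    both. *)
Lemma lcs_size_attach t t' v v' m :
  (2 <= n)%N -> verts t = [set: 'I_n]%SET -> verts t' = [set: 'I_n]%SET ->
  (forall x, x != v' -> (deg t' x <= m)%N) ->
  (2 <= lcs_size t t')%N ->
  (n + m < #|leaves_at t v| + lcs_size t t')%N ->
  (lcs_size t t' < lcs_size (attach t v) (attach t' v'))%N.
Proof.
move=> n2 vt vt' dm X2 big.
have [v0 w0] : 'I_n * 'I_n by split; exact: (Ordinal n2).
have c0 : common_subtree (star v0 finset.set0) t t'.
  have sg (u : sgraph 'I_n) x : verts u = [set: 'I_n]%SET -> subtree (star x finset.set0) u.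
    move=> vu; split; last exact: star_tree.
    by apply: star_subgraph; rewrite ?vu ?inE // finset.sub0set.
  split; first exact: star_tree.
    by exists (star v0 finset.set0); [exact: sg|exact: graph_iso_refl].
  by exists (star v0 finset.set0); [exact: sg|exact: graph_iso_refl].
have [U [S [[St [H Ht [phi [phi_inj phiS phi_adj]]] [H' Ht' [phi' [phi'_inj phi'S phi'_adj]]]] SE]]]
  := lcs_size_attained c0.
have HE : #|verts H| = lcs_size t t' by rewrite -phiS card_in_imset.
have [vH nH] : v \in verts H /\ (#|leaves_at t v| + #|verts H| <= n + #|nbrs H v|)%N.
  apply: hub_in_subtree => //; rewrite HE //.
  by apply: leq_ltn_trans big; rewrite leq_addr.
have : v \in phi @: verts S by rewrite phiS.
case/imsetP => s sS vs.
have nS : #|nbrs S s| = #|nbrs H v|.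
  have sub : nbrs S s \subset verts S.
    by apply/fintype.subsetP => x; rewrite inE => /adj_verts[].
  rewrite -(card_in_imset (f := phi) (D := nbrs S s)); last first.
    by move=> x y /(fintype.subsetP sub) xS /(fintype.subsetP sub); apply: phi_inj.
  apply: eq_card => y; apply/imsetP/idP => [[x]|].
    move=> xN ->; have xS := fintype.subsetP sub _ xN; move: xN.
    by rewrite !inE vs phi_adj.
  rewrite inE => vy; have [_] := adj_verts vy; rewrite -phiS => /imsetP[x xS yx].
  by exists x => //; rewrite inE -phi_adj // -vs -yx.
have nS' : (#|nbrs S s| <= deg t' (phi' s))%N.
  have sub : nbrs S s \subset verts S.
    by apply/fintype.subsetP => x; rewrite inE => /adj_verts[].
  rewrite -card_nbrs -(card_in_imset (f := phi') (D := nbrs S s)); last first.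
    by move=> x y /(fintype.subsetP sub) xS /(fintype.subsetP sub); apply: phi'_inj.
  apply: subset_leq_card; apply/fintype.subsetP => y /imsetP[x xN ->].
  have xS := fintype.subsetP sub _ xN; move: xN; rewrite !inE -phi'_adj //.
  by case: Ht' => -[_ He] _; apply: (fintype.subsetP He).
have sv' : phi' s = v'.
  apply/eqP; apply/negPn/negP => /dm.
  by move: big nH nS nS'; rewrite HE; clear; lia.
have v'H' : v' \in verts H' by rewrite -sv' -phi'S imset_f.
have Some_neq (x : U) : Some x != None by [].
pose S' := graft (@some_injective U) Some_neq sS.
have <- : #|verts S'| = (lcs_size t t').+1 by rewrite card_graft SE.
apply: lcs_size_ub; split; first exact: graft_tree.
- exists (graft (@old_inj n) (@old_neq_max n) vH);
    last exact: (graft_iso _ _ _ _ phi_inj phiS phi_adj (esym vs)).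
  by case: Ht => h1 h2; split; [exact: old_graft_subgraph|exact: graft_tree].
- exists (graft (@old_inj n) (@old_neq_max n) v'H');
    last exact: (graft_iso _ _ _ _ phi'_inj phi'S phi'_adj sv').
  by case: Ht' => h1 h2; split; [exact: old_graft_subgraph|exact: graft_tree].
Qed.

End Hubs.

Lemma leaves_attach n (t : sgraph 'I_n) v :
  (#|leaves_at t v| < #|leaves_at (attach t v) (old_vertex v)|)%N.
Proof.
have sub : (ord_max |: (@old_vertex n @: leaves_at t v))%SET \subset
    leaves_at (attach t v) (old_vertex v).
  apply/fintype.subsetP => x; rewrite in_setU1 => /orP[/eqP ->|/imsetP[a aL ->]]; rewrite inE.
    apply/eqP/setP => y; rewrite !inE adj_sym; have [->|[j ->]] := ord_old_or_max y.
      rewrite eq_sym (negbTE (old_neq_max _)); apply/negbTE/negP => /adj_neq.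
      by rewrite eqxx.
    by rewrite adj_attach_max (inj_eq (@old_inj n)).
  move: aL; rewrite inE => /eqP an.
  have av : adj t a v by have := set11 v; rewrite -an inE.
  apply/eqP/setP => y; rewrite !inE; have [->|[j ->]] := ord_old_or_max y.
    by rewrite adj_attach_max (negbTE (adj_neq av)) eq_sym (negbTE (old_neq_max _)).
  rewrite adj_attach_old (inj_eq (@old_inj n)).
  apply/idP/eqP => [aj|->] //; have : j \in nbrs t a by rewrite inE.
  by rewrite an inE => /eqP.
apply: leq_trans (subset_leq_card sub); rewrite cardsU1 card_imset; last exact: old_inj.
rewrite (_ : ord_max \notin _) //; apply/imsetP => -[a _ /eqP].
by rewrite eq_sym (negbTE (old_neq_max _)).
Qed.

(** * Trees growing at a hub *)

(** Induction on a bound for the initial value. *)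
Lemma nonincreasing_stationary (u : nat -> nat) N :
  (forall n, (N <= n)%N -> (u n.+1 <= u n)%N) ->
  exists k M, forall n, (M <= n)%N -> u n = k.
Proof.
move: {2}(u N) (leqnn (u N)) => b; elim: b N => [|b IH] N uN dec.
  exists 0%N, N => n /subnK <-; elim: (n - N)%N => [|m IHm].
    by apply/eqP; rewrite -leqn0.
  by apply/eqP; rewrite -leqn0 -IHm addSn dec // leq_addl.
have [[n Nn un]|same] := pselect (exists2 n, (N <= n)%N & u n != u N).
  apply: (IH n) => [|m nm]; last by apply: dec; apply: leq_trans nm.
  have : (u n <= u N)%N.
    move: Nn => /subnK <-; elim: (n - N)%N => // m IHm.
    by apply: leq_trans IHm; rewrite addSn dec // leq_addl.
  by move: un uN; clear; lia.
exists (u N), N => n Nn; apply/eqP/negPn/negP => un.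
by apply: same; exists n.
Qed.

Section GraphSequence.
Context (T : forall n, sgraph 'I_n).
Context (Ta : forall n, (2 <= n)%N -> exists u, T n.+1 = attach (T n) u)
  (Tt : forall n, (2 <= n)%N -> treelike (degseq (T n))).

Definition lossT n := loss (degseq (T n)).

Lemma lossT_incr n : (2 <= n)%N -> (lossT n <= lossT n.+1)%N.
Proof.
move=> n2; have [u hu] := Ta n2; rewrite /lossT hu degseq_attach.
rewrite loss_grow ?leq_addr ?Tt //.
by rewrite size_degseq.
Qed.

Lemma maxdeg_lossT n : (2 <= n)%N -> (maxdeg (degseq (T n)) + lossT n).+1 = n.
Proof.
move=> n2; have := maxdeg_lt_size (Tt n2); rewrite /lossT /loss size_degseq; lia.
Qed.

Lemma lossT_stationary B : (forall n, (lossT n <= B)%N) ->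
  exists k M, forall n, (M <= n)%N -> lossT n = k.
Proof.
move=> hB; have [n n2|k [M hM]] := @nonincreasing_stationary (fun n => B - lossT n)%N 2.
  by apply: leq_sub2l; apply: lossT_incr.
by exists (B - k)%N, M => n /hM; have := hB n; lia.
Qed.

(** As long as the loss does not change, new vertices join a vertex of largest
    degree, which thereby becomes the only one and must be chosen again. *)
Lemma hub_forever n0 : (2 <= n0)%N ->
  (forall n, (n0 <= n)%N -> lossT n = lossT n0) ->
  forall n, (n0 <= n)%N -> exists v,
    [/\ T n.+1 = attach (T n) v, deg (T n) v = maxdeg (degseq (T n)),
        (n <= n0 + #|leaves_at (T n) v|)%N &
        forall x, x != v -> (deg (T n) x <= n0)%N].
Proof.
move=> n02 lc.
have next n : (n0 <= n)%N -> exists2 v, T n.+1 = attach (T n) v &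
    deg (T n) v = maxdeg (degseq (T n)).
  move=> nn; have n2 := leq_trans n02 nn; have [v hv] := Ta n2; exists v => //.
  apply/eqP/negPn/negP => nm; have := lc n.+1 (leqW nn); rewrite -(lc n nn).
  rewrite /lossT hv degseq_attach loss_grow ?Tt ?size_degseq // nth_degseq nm.
  by rewrite addn1 => /esym/n_Sn.
move=> n /subnK <-; elim: (n - n0)%N => [|m [v [hv dv lv ov]]].
  have [v h1 h2] := next n0 (leqnn _); exists v; split; rewrite ?leq_addr // => x _.
  rewrite -nth_degseq (leq_trans (nth_le_maxdeg _ _)) //.
  by have := @maxdeg_lossT (0 + n0)%N n02; lia.
rewrite addSn; have mn : (n0 <= (m + n0).+1)%N by rewrite leqW // leq_addl.
have mn2 : (2 <= m + n0)%N by rewrite (leq_trans n02) // leq_addl.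
have D0 := maxdeg_gt0 (Tt mn2).
have [v' h1 h2] := next _ mn.
have sz : (v < size (degseq (T (m + n0))))%N by rewrite size_degseq.
have md : maxdeg (degseq (T (m + n0).+1)) = (deg (T (m + n0)) v).+1.
  by rewrite hv degseq_attach maxdeg_grow ?Tt // nth_degseq dv; apply/maxn_idPr.
have vv : v' = old_vertex v.
  apply/eqP/negPn/negP => ne; move: h2; rewrite md hv.
  move: ne; have [->|[j ->]] := ord_old_or_max v' => ne.
    by rewrite deg_attach_max dv; lia.
  rewrite deg_attach_old; have [vj|_] := eqVneq v j; first by rewrite vj eqxx in ne.
  by rewrite add0n -nth_degseq dv; have := nth_le_maxdeg (degseq (T (m + n0))) j; lia.
subst v'; exists (old_vertex v); split => //.
  have := leaves_attach (T (m + n0)) v; rewrite -hv; lia.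
rewrite hv => x; have [->|[j ->]] := ord_old_or_max x => ne.
  by rewrite deg_attach_max (leq_trans _ n02).
rewrite deg_attach_old; have [vj|_] := eqVneq v j; first by rewrite vj eqxx in ne.
by rewrite add0n ov //; apply: contraNneq ne => ->.
Qed.

End GraphSequence.

(** For n large, [lcs_size_attach] shows that n - X_n does not increase. *)
Lemma lcs_defect_stationary (T T' : forall n, sgraph 'I_n) B :
  (forall n, verts (T n) = [set: 'I_n]%SET) -> (forall n, verts (T' n) = [set: 'I_n]%SET) ->
  (forall n, (2 <= n)%N -> exists u, T n.+1 = attach (T n) u) ->
  (forall n, (2 <= n)%N -> exists u, T' n.+1 = attach (T' n) u) ->
  (forall n, (2 <= n)%N -> treelike (degseq (T n))) ->
  (forall n, (2 <= n)%N -> treelike (degseq (T' n))) ->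
  (forall n, (lossT T n <= B)%N) -> (forall n, (lossT T' n <= B)%N) ->
  exists k M, forall n, (M <= n)%N -> (n - lcs_size (T n) (T' n))%N = k.
Proof.
move=> Tv Tv' Ta Ta' Tt Tt' hB hB'.
have [k [M hM]] := lossT_stationary Ta Tt hB.
have [k' [M' hM']] := lossT_stationary Ta' Tt' hB'.
pose n0 := (M + M' + 2)%N.
have n02 : (2 <= n0)%N by rewrite leq_addl.
have c n : (n0 <= n)%N -> lossT T n = lossT T n0.
  by move=> nn; rewrite !hM //; move: nn; rewrite /n0; clear; lia.
have c' n : (n0 <= n)%N -> lossT T' n = lossT T' n0.
  by move=> nn; rewrite !hM' //; move: nn; rewrite /n0; clear; lia.
have hub := hub_forever Ta Tt n02 c.
have hub' := hub_forever Ta' Tt' n02 c'.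
(* At least n - n0 leaves at each hub, other degrees at most n0, and at most B
   vertices missed: n > 2 n0 + B is large enough for lcs_size_attach. *)
apply: (@nonincreasing_stationary _ (3 * n0 + B + 2)%N) => n nn.
have n2 : (2 <= n)%N by move: nn; clear; lia.
have nn0 : (n0 <= n)%N by move: nn; clear; lia.
have [v [-> _ lv _]] := hub n nn0.
have [v' [-> _ _ ov']] := hub' n nn0.
have X1 : (n <= lcs_size (T n) (T' n) + B)%N.
  have := lcs_size_maxdeg (ltnW n2) (Tv n) (Tv' n).
  have := maxdeg_lossT Tt n2; have := maxdeg_lossT Tt' n2; have := hB n; have := hB' n.
  by clear; lia.
have : (lcs_size (T n) (T' n) < lcs_size (attach (T n) v) (attach (T' n) v'))%N.
  apply: (@lcs_size_attach n _ _ _ _ n0) => //.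
    by move: X1 nn; clear; lia.
  by move: X1 nn lv; clear; lia.
by move: (lcs_size_le (T n) (T' n)); clear; lia.
Qed.

(** * The law of the degree sequence *)

Section Fibers.
Context {d : measure_display} {Omega : measurableType d} {R : realType}
  (P : probability Omega R) {S : finType} (Z : Omega -> S)
  (mZ : forall s, measurable (Z @^-1` [set s])).

(** Events defined by a variable with finitely many values are finite unions of
    its fibers. *)
Lemma measurable_fibers (A : set S) : measurable (Z @^-1` A).
Proof.
have -> : Z @^-1` A = \bigcup_(s in A) Z @^-1` [set s].
  apply/seteqP; split => [w Aw|w [s As /= e]]; first by exists (Z w).
    by rewrite /preimage /= e.
by apply: fin_bigcup_measurable => //; exact: finite_finset.
Qed.

Lemma measure_fibers (B : set Omega) : measurable B ->
  P B = (\sum_(s : S) P (B `&` Z @^-1` [set s]))%E.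
Proof.
move=> mB; have {1}-> : B = \bigcup_(s in [set: S]) (B `&` Z @^-1` [set s]).
  by apply/seteqP; split => [w Bw|w [s _ []]] //; exists (Z w).
rewrite measure_fin_bigcup; last 3 first.
- exact: finite_finset.
- by move=> i j _ _ [w [[_ <-] [_ <-]]].
- by move=> s _; apply: measurableI.
rewrite (fsbigE (index_enum S)) ?index_enum_uniq //.
  by apply: eq_bigl => i; rewrite in_setT.
by move=> i _; rewrite mem_index_enum.
Qed.

End Fibers.

Section Law.
Context {d : measure_display} {Omega : measurableType d} {R : realType}
  (P : probability Omega R) (f : nat -> R) (T : forall n, Omega -> sgraph 'I_n)
  (TG : growing_trees P f T).

Definition tree_prob n (t : sgraph 'I_n) : R := fine (P (T n @^-1` [set t])).

Lemma tree_probE n (t : sgraph 'I_n) : P (T n @^-1` [set t]) = (tree_prob t)%:E.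
Proof. by rewrite /tree_prob fineK // fin_num_measure //; apply: growing_measurable TG _ _. Qed.

Lemma prob_tree n (A : pred (sgraph 'I_n)) :
  P (T n @^-1` [set t | A t]) = (\sum_t tree_prob t * (A t)%:R)%:E.
Proof.
have mT := growing_measurable TG (n := n).
rewrite (measure_fibers P mT (measurable_fibers mT _)) -sumEFin; apply: eq_bigr => t _.
have [At|nAt] := boolP (A t).
  rewrite mulr1 -tree_probE; congr (P _); apply/seteqP; split => [w []|w /= e] //.
  by split => //=; rewrite e.
rewrite mulr0 (_ : _ `&` _ = set0) ?measure0 // -subset0 => w /= [+ e].
by rewrite e (negbTE nAt).
Qed.

Lemma weight_degseq n (t : sgraph 'I_n) : weight f (degseq t) = \sum_(j < n) f (deg t j).
Proof.
rewrite /weight -(big_mkord xpredT (fun i => f (dg (degseq t) i))) size_degseq big_mkord.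
by apply: eq_bigr => i _; rewrite nth_degseq.
Qed.

Lemma mean_degseq n (t : sgraph 'I_n) (F : seq nat -> R) :
  mean f F (degseq t) =
  \sum_(i < n) f (deg t i) / (\sum_(j < n) f (deg t j)) * F (degseq (attach t i)).
Proof.
rewrite /mean -(big_mkord xpredT (fun i => f (dg (degseq t) i) / weight f (degseq t) *
  F (grow (degseq t) i))) size_degseq big_mkord.
by apply: eq_bigr => i _; rewrite nth_degseq weight_degseq degseq_attach.
Qed.

(** Split the event that the new tree is t' according to the old tree, and use
    that a tree determines the tree and the vertex from which it grew. *)
Lemma tree_prob_step n (F : seq nat -> R) : (2 <= n)%N ->
  \sum_(t : sgraph 'I_n.+1) tree_prob t * F (degseq t) =
  \sum_(t : sgraph 'I_n) tree_prob t * mean f F (degseq t).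
Proof.
move=> n2; have mT := growing_measurable TG (n := n).
have mT' := growing_measurable TG (n := n.+1).
have joint (t : sgraph 'I_n) (t' : sgraph 'I_n.+1) :
    P (T n.+1 @^-1` [set t'] `&` T n @^-1` [set t]) =
    (\sum_(i < n | attach t i == t') tree_prob t * (f (deg t i) / \sum_(j < n) f (deg t j)))%:E.
  have [/existsP[i /eqP it]|no] := boolP [exists i, attach t i == t'].
    rewrite (big_pred1 i); last first.
      move=> j; rewrite -it; apply/eqP/eqP => [|->] //.
      by case/attach_inj.
    by rewrite setIC -it (growing_law TG) // tree_probE -EFinM.
  rewrite big_pred0; last by move=> i; apply/negbTE; move/existsPn: no.
  rewrite (_ : _ `&` _ = set0) ?measure0 // -subset0 => w /= [e1 e2].
  have [u hu] := growing_attach TG w n2; case/existsP: no; exists u.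
  by rewrite -e1 hu e2.
have prS (t' : sgraph 'I_n.+1) : tree_prob t' =
    \sum_(t : sgraph 'I_n) \sum_(i < n | attach t i == t')
       tree_prob t * (f (deg t i) / \sum_(j < n) f (deg t j)).
  apply: EFin_inj; rewrite -tree_probE (measure_fibers P mT (mT' t')) -sumEFin.
  by apply: eq_bigr => t _; exact: joint.
transitivity (\sum_(t' : sgraph 'I_n.+1) \sum_(t : sgraph 'I_n) \sum_(i < n | attach t i == t')
       tree_prob t * (f (deg t i) / \sum_(j < n) f (deg t j)) * F (degseq (attach t i))).
  apply: eq_bigr => t' _; rewrite prS mulr_suml; apply: eq_bigr => t _.
  by rewrite mulr_suml; apply: eq_bigr => i /eqP ->.
rewrite exchange_big; apply: eq_bigr => t _ /=.
rewrite mean_degseq mulr_sumr (exchange_big_dep xpredT) //=; apply: eq_bigr => i _.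
by rewrite (big_pred1 (attach t i)) ?mulrA.
Qed.

Lemma degseq_two w : degseq (T 2 w) = edge_degrees.
Proof.
apply: (@eq_from_nth _ 0%N); first by rewrite size_degseq.
rewrite size_degseq => j j2; rewrite -[j]/(val (Ordinal j2)) nth_degseq /deg.
rewrite (growing_two TG) (_ : [set e in _ | _]%SET = [set [set: 'I_2]]%SET).
  by rewrite cards1; case: j j2 => [|[|]].
by apply/setP => e; rewrite !inE; case: eqP => // ->; rewrite inE.
Qed.

(** The degree sequence of the random tree follows the chain started from a
    single edge. *)
Lemma tree_prob_Ex k (F : seq nat -> R) :
  \sum_(t : sgraph 'I_k.+2) tree_prob t * F (degseq t) = Ex f k F edge_degrees.
Proof.
elim: k F => [|k IH] F; last by rewrite tree_prob_step // IH ExS.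
have tot : \sum_(t : sgraph 'I_2) tree_prob t = 1.
  apply: EFin_inj; rewrite -(@probability_setT _ _ _ P).
  have -> : [set: Omega] = T 2 @^-1` [set t | xpredT t] by apply/seteqP.
  by rewrite prob_tree; congr EFin; apply: eq_bigr => t _; rewrite mulr1.
rewrite /Ex /= -[RHS]mul1r -tot mulr_suml; apply: eq_bigr => t _.
have [->|ne] := eqVneq (degseq t) edge_degrees; first by [].
rewrite (_ : tree_prob t = 0) ?mul0r //.
apply: EFin_inj; rewrite -tree_probE (_ : _ @^-1` _ = set0) ?measure0 // -subset0 => w /= e.
by move: ne; rewrite -e degseq_two eqxx.
Qed.

Lemma prob_degseq k (A : pred (seq nat)) :
  P (T k.+2 @^-1` [set t | A (degseq t)]) = (Ex f k (fun s => (A s)%:R) edge_degrees)%:E.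
Proof. by rewrite (prob_tree (fun t => A (degseq t))) -tree_prob_Ex. Qed.

Lemma treelike_degseq n w : (2 <= n)%N -> treelike (degseq (T n w)).
Proof.
elim: n => // n IH; rewrite leq_eqVlt => /predU1P[<-|]; first by rewrite degseq_two.
rewrite ltnS => n2; have [u ->] := growing_attach TG w n2.
by rewrite degseq_attach; apply: treelike_grow; rewrite ?IH // size_degseq.
Qed.

End Law.

(** * Almost sure convergence and tightness *)

(** The finitely many values at which the asymptotic bounds may fail are
    absorbed in the constants, because [f] is positive there. *)
Lemma theta_bounds (R : realType) (alpha : R) (f : nat -> R) :
  (forall n, (0 < n)%N -> 0 < f n) ->
  (f : nat -> R^o) =Theta_\oo (fun n => n%:R `^ alpha : R^o) ->
  exists c C : R, [/\ 0 < c, 0 < C &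
    forall n, (0 < n)%N -> c * n%:R `^ alpha <= f n /\ f n <= C * n%:R `^ alpha].
Proof.
move=> f0; rewrite eqThetaE => /asboolP[[k1 k2] /= /andP[k10 k20] [N _ hN]].
have pos n : (0 < n)%N -> 0 < n%:R `^ alpha :> R by move=> n0; rewrite powR_gt0 // ltr0n.
have hN' n : (N <= n)%N -> (0 < n)%N ->
    k1 * n%:R `^ alpha <= f n /\ f n <= k2 * n%:R `^ alpha.
  move=> Nn n0; have [] := hN n Nn.
  by rewrite (ger0_norm (ltW (pos n n0))) (ger0_norm (ltW (f0 n n0))).
pose u n : R := n%:R `^ alpha / f n; pose v n : R := f n / n%:R `^ alpha.
have u0 n : (0 < n)%N -> 0 <= u n by move=> n0; rewrite divr_ge0 ?ltW ?pos ?f0.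
have v0 n : (0 < n)%N -> 0 <= v n by move=> n0; rewrite divr_ge0 ?ltW ?pos ?f0.
pose U := \sum_(1 <= m < N) u m; pose W := \sum_(1 <= m < N) v m.
have U0 : 0 <= U by rewrite /U big_nat_cond sumr_ge0 // => i /andP[/andP[i0 _] _]; apply: u0.
have W0 : 0 <= W by rewrite /W big_nat_cond sumr_ge0 // => i /andP[/andP[i0 _] _]; apply: v0.
have single (x : nat -> R) n : (forall m, (0 < m)%N -> 0 <= x m) -> (0 < n)%N -> (n < N)%N ->
    x n <= \sum_(1 <= m < N) x m.
  move=> x0 n0 nN; rewrite (big_cat_nat (n := n)) //=; last exact: ltnW.
  rewrite [X in _ + X]big_ltn // addrCA lerDl addr_ge0 //.
    by rewrite big_nat_cond sumr_ge0 // => i /andP[/andP[i0 _] _]; apply: x0.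
  rewrite big_nat_cond sumr_ge0 // => i /andP[/andP[i0 _] _]; apply: x0.
  exact: leq_ltn_trans i0.
have k1V : 0 < k1^-1 by rewrite invr_gt0.
exists (k1^-1 + U)^-1, (k2 + W); split => [||n n0].
- by rewrite invr_gt0 ltr_wpDr.
- by rewrite ltr_wpDr.
have p := pos n n0; have fn := f0 n n0.
have s0 : 0 < k1^-1 + U by rewrite ltr_wpDr.
have [Nn|nN] := leqP N n.
  have [h1 h2] := hN' n Nn n0; split.
    apply: le_trans h1; rewrite ler_pM2r // -[leRHS]invrK lef_pV2 ?posrE //.
    by rewrite lerDl.
  by apply: le_trans h2 _; rewrite ler_pM2r // lerDl.
split.
  rewrite mulrC ler_pdivrMr // mulrC -ler_pdivrMr //.
  by apply: le_trans (single u n u0 n0 nN) _; rewrite lerDr ltW.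
rewrite -ler_pdivrMr //.
by apply: le_trans (single v n v0 n0 nN) _; rewrite lerDr ltW.
Qed.

Section TwoTrees.
Context (R : realType) (s c C : R) (f : nat -> R)
    (d : measure_display) (Omega : measurableType d) (P : probability Omega R)
    (T1 T2 : forall n : nat, Omega -> sgraph 'I_n).
Context (s_gt0 : 0 < s) (c_gt0 : 0 < c) (C_gt0 : 0 < C)
  (f_ge : forall n, (0 < n)%N -> c * n%:R `^ (1 + s) <= f n)
  (f_le : forall n, (0 < n)%N -> f n <= C * n%:R `^ (1 + s))
  (T1G : growing_trees P f T1) (T2G : growing_trees P f T2).

Definition defect n w : R := n%:R - (lcs_size (T1 n w) (T2 n w))%:R.

Lemma loss_tail_prob T (TG : growing_trees P f T) (e : R) : 0 < e ->
  exists2 B : R, 0 < B & forall n (x : R), (2 <= n)%N -> 0 < x ->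
    (P [set w | (x < (loss (degseq (T n w)))%:R)%R] <= (e + B * growth s n / x)%:E)%E.
Proof.
move=> e0; have [B B0 hB] := loss_tail s_gt0 c_gt0 C_gt0 f_ge f_le e0.
exists B => // -[|[|k]] x // _ x0.
have := prob_degseq TG k (fun t => (x < (loss t)%:R)%R) => /= ->.
by rewrite lee_fin -addn2; apply: hB.
Qed.

Lemma measurable_pair n (A : sgraph 'I_n -> sgraph 'I_n -> Prop) :
  measurable [set w | A (T1 n w) (T2 n w)].
Proof.
pose Z w := (T1 n w, T2 n w).
have mZ p : measurable (Z @^-1` [set p]).
  rewrite (_ : _ @^-1` _ = T1 n @^-1` [set p.1] `&` T2 n @^-1` [set p.2]).
    by apply: measurableI; [apply: growing_measurable T1G _ _|apply: growing_measurable T2G _ _].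
  apply/seteqP; split => w; case: p => a b /=; first by case=> -> ->.
  by case=> <- <-.
exact: (measurable_fibers mZ [set p | A p.1 p.2]).
Qed.

Lemma defect_ge0 n w : 0 <= defect n w.
Proof. by rewrite subr_ge0 ler_nat lcs_size_le. Qed.

(** The stars around the vertices of largest degree. *)
Lemma defect_le n w : (2 <= n)%N ->
  defect n w <= (loss (degseq (T1 n w)))%:R \/ defect n w <= (loss (degseq (T2 n w)))%:R.
Proof.
move=> n2; have h := lcs_size_maxdeg (ltnW n2) (growing_verts T1G n w) (growing_verts T2G n w).
have X1 := lcs_size_le (T1 n w) (T2 n w).
have h1 := maxdeg_lt_size (treelike_degseq T1G w n2).
have h2 := maxdeg_lt_size (treelike_degseq T2G w n2).
rewrite /defect -natrB // !ler_nat /loss !size_degseq in h1 h2 *.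
have : ((n - lcs_size (T1 n w) (T2 n w) <= n.-1 - maxdeg (degseq (T1 n w))) ||
        (n - lcs_size (T1 n w) (T2 n w) <= n.-1 - maxdeg (degseq (T2 n w))))%N.
  by move: h X1 h1 h2; clear -n2; lia.
by case/orP; [left|right].
Qed.

(** The defect exceeds a threshold only if one of the two losses does. *)
Lemma defect_tail (g : nat -> R) (A e : R) : 0 < A -> 0 < e ->
  (forall n, (2 <= n)%N -> 0 < g n) -> (forall n, (2 <= n)%N -> growth s n <= A * g n) ->
  exists2 K : R, 0 < K & forall K' n, K <= K' -> (2 <= n)%N ->
    (P [set w | (K' * g n < defect n w)%R] <= e%:E)%E.
Proof.
move=> A0 e0 g0 gA; have e4 : 0 < e / 4 by rewrite divr_gt0.
have [B1 B10 h1] := loss_tail_prob T1G e4.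
have [B2 B20 h2] := loss_tail_prob T2G e4.
pose B := B1 + B2; have B0 : 0 < B by rewrite addr_gt0.
exists (2 * B * A / e); first by rewrite divr_gt0 // !mulr_gt0.
move=> K n hK n2.
have K0 : 0 < K by apply: lt_le_trans hK; rewrite divr_gt0 // !mulr_gt0.
have x0 : 0 < K * g n by rewrite mulr_gt0 // g0.
have m1 : measurable [set w | (K * g n < (loss (degseq (T1 n w)))%:R)%R].
  exact: (measurable_pair (fun t _ => K * g n < (loss (degseq t))%:R)).
have m2 : measurable [set w | (K * g n < (loss (degseq (T2 n w)))%:R)%R].
  exact: (measurable_pair (fun _ t => K * g n < (loss (degseq t))%:R)).
have m3 : measurable [set w | (K * g n < defect n w)%R].
  exact: (measurable_pair (fun t t' => K * g n < n%:R - (lcs_size t t')%:R)).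
apply: (@le_trans _ _ (P ([set w | (K * g n < (loss (degseq (T1 n w)))%:R)%R] `|`
    [set w | (K * g n < (loss (degseq (T2 n w)))%:R)%R]))).
  apply: le_measure; rewrite ?inE //; first exact: measurableU.
  by move=> w /= hw; have [h|h] := defect_le w n2; [left|right]; apply: lt_le_trans h.
apply: le_trans (measureU2 _ m1 m2) _.
apply: le_trans (leeD (h1 n _ n2 x0) (h2 n _ n2 x0)) _.
rewrite -EFinD lee_fin.
have -> : e / 4 + B1 * growth s n / (K * g n) + (e / 4 + B2 * growth s n / (K * g n)) =
  e / 2 + B * growth s n / (K * g n) by rewrite /B; field; rewrite !lt0r_neq0 ?g0.
have : B * growth s n / (K * g n) <= e / 2.
  rewrite ler_pdivrMr //; apply: (@le_trans _ _ (B * (A * g n))).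
    by rewrite ler_pM2l // gA.
  rewrite !mulrA ler_pM2r ?g0 //.
  have : 2 * B * A <= K * e by rewrite -ler_pdivrMr.
  lra.
lra.
Qed.

Lemma tight_defect (g : nat -> R) (A : R) (D : set nat) (Y : nat -> Omega -> R) :
  0 < A -> (forall n, (2 <= n)%N -> 0 < g n) ->
  (forall n, (2 <= n)%N -> growth s n <= A * g n) ->
  (forall n w, (2 <= n)%N -> Y n w = defect n w / g n) ->
  (forall n w, D n -> (n < 2)%N -> 0 <= Y n w <= 1) -> tight P D Y.
Proof.
move=> A0 g0 gA YE Ysmall e e0; have [K K0 hK] := defect_tail A0 e0 g0 gA.
exists `[0, Num.max K 1]%classic; first exact: segment_compact.
move=> n Dn; have [n2|n2] := leqP 2 n; last first.
  rewrite (_ : _ @^-1` _ = set0) ?measure0 ?lee_fin ?ltW // -subset0 => w /= h; apply: h.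
  rewrite in_itv /=; have /andP[-> h] := Ysmall n w Dn n2.
  by rewrite le_max h orbT.
apply: (@le_trans _ _ (P [set w | (Num.max K 1 * g n < defect n w)%R])); last first.
  by apply: hK => //; rewrite le_max lexx.
apply: le_measure; rewrite ?inE.
- rewrite (_ : _ @^-1` _ = [set w | ~ `[0, Num.max K 1]%classic (defect n w / g n)]).
    exact: (measurable_pair (fun t t' => ~ `[0, Num.max K 1]%classic
      ((n%:R - (lcs_size t t')%:R) / g n))).
  by apply/seteqP; split => w /=; rewrite YE.
- exact: (measurable_pair (fun t t' => Num.max K 1 * g n < n%:R - (lcs_size t t')%:R)).
move=> w /=; rewrite YE // in_itv /= divr_ge0 ?defect_ge0 ?(ltW (g0 n n2)) //= => h.
by rewrite ltNge; apply/negP => h'; apply: h; rewrite ler_pdivrMr ?g0.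
Qed.

(** Take eps_n to be the square root of growth n / n: it tends to zero, but eps_n n
    eventually exceeds every fixed multiple of growth n. *)
Lemma defect_whp : exists2 eps : nat -> R, eps n @[n --> \oo] --> 0 &
  P [set w | (1 - eps n) * n%:R <= (lcs_size (T1 n w) (T2 n w))%:R] @[n --> \oo] --> 1%E.
Proof.
pose eps n : R := Num.sqrt (growth s n / n%:R).
have G1 n : 1 <= growth s n by exact: growth_ge1.
exists eps.
  apply/cvgrPdist_le => e e0.
  have [N hN] := growth_sublinear s_gt0 (exprn_gt0 2 e0).
  exists (maxn N 1) => // n /=; rewrite geq_max => /andP[Nn n1].
  rewrite sub0r normrN ger0_norm ?sqrtr_ge0 //.
  rewrite -[leRHS]ger0_norm ?(ltW e0) // -sqrtr_sqr ler_wsqrtr //.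
  by rewrite ler_pdivrMr ?ltr0n // hN.
have mA n : measurable [set w | (1 - eps n) * n%:R <= (lcs_size (T1 n w) (T2 n w))%:R].
  exact: (measurable_pair (fun t t' => (1 - eps n) * n%:R <= (lcs_size t t')%:R)).
apply/fine_cvgP; split; first by apply: nearW => n; apply: fin_num_measure.
apply/cvgrPdist_le => e e0.
have g0 n : (2 <= n)%N -> 0 < growth s n by move=> _; apply: lt_le_trans (G1 n).
have gA n : (2 <= n)%N -> growth s n <= 1 * growth s n by rewrite mul1r.
have [K K0 hK] := defect_tail ltr01 e0 g0 gA.
have KV : 0 < K^-1 by rewrite invr_gt0.
have [N hN] := growth_sublinear s_gt0 (exprn_gt0 2 KV).
exists (maxn N 2) => // n /=; rewrite geq_max => /andP[Nn n2].
have np : 0 < n%:R :> R by rewrite ltr0n ltnW.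
have KG : K * growth s n <= eps n * n%:R.
  have -> : K * growth s n = K * (growth s n / n%:R) * n%:R by field; rewrite gt_eqF.
  rewrite ler_pM2r // /eps; set r := growth s n / n%:R.
  have r0 : 0 <= r by rewrite divr_ge0 // (le_trans ler01).
  have rK : Num.sqrt r <= K^-1.
    rewrite -[leRHS]ger0_norm ?(ltW KV) // -sqrtr_sqr ler_wsqrtr //.
    by rewrite ler_pdivrMr // hN.
  rewrite -{1}(sqr_sqrtr r0) expr2 mulrA ler_piMl ?sqrtr_ge0 //.
  by rewrite -(mulfV (lt0r_neq0 K0)) ler_pM2l.
set E := [set w | (1 - eps n) * n%:R <= _].
have PC : (P (~` E) <= e%:E)%E.
  apply: le_trans (hK K n (lexx _) n2); apply: le_measure; rewrite ?inE.
  - by apply: measurableC; exact: mA.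
  - exact: (measurable_pair (fun t t' => K * growth s n < n%:R - (lcs_size t t')%:R)).
  move=> w /= /negP; rewrite -ltNge /defect => h; apply: le_lt_trans KG _; lra.
have mE : measurable E by exact: mA.
have fE : P E \is a fin_num by exact: fin_num_measure.
move: PC; rewrite probability_setC // -(fineK fE) -EFinB lee_fin => h.
rewrite ger0_norm // subr_ge0 -lee_fin fineK //; exact: probability_le1.
Qed.

(** The losses never decrease, so the events below increase with n and the
    uniform bound of [loss_tail_prob] passes to their union. *)
Lemma losses_bounded_as (e : R) : 1 < s -> 0 < e ->
  exists B : nat, (P (\bigcup_n [set w | ((B < loss (degseq (T1 n.+2 w))) ||
     (B < loss (degseq (T2 n.+2 w))))%N]) <= e%:E)%E.
Proof.
move=> s1 e0; have e4 : 0 < e / 4 by rewrite divr_gt0.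
have [B1 B10 h1] := loss_tail_prob T1G e4.
have [B2 B20 h2] := loss_tail_prob T2G e4.
have [A A0 hA] := growth_bounded s1.
have [N hN] := natr_unbounded ((B1 + B2) * A / (e / 2)).
pose B := N.+1; have Bp : 0 < B%:R :> R by rewrite ltr0n.
have hB : (B1 + B2) * A / B%:R <= e / 2.
  have := hN B (leqnSn N); rewrite ler_pdivrMr ?divr_gt0 // => h.
  by rewrite ler_pdivrMr // [leRHS]mulrC.
exists B; set F := fun n => [set w | _].
have mF n : measurable (F n).
  exact: (measurable_pair (fun t t' => (B < loss (degseq t)) || (B < loss (degseq t')))%N).
have Fe n : (P (F n) <= e%:E)%E.
  have m1 : measurable [set w | (B%:R < (loss (degseq (T1 n.+2 w)))%:R :> R)%R].
    exact: (measurable_pair (fun t _ => B%:R < (loss (degseq t))%:R :> R)).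
  have m2 : measurable [set w | (B%:R < (loss (degseq (T2 n.+2 w)))%:R :> R)%R].
    exact: (measurable_pair (fun _ t => B%:R < (loss (degseq t))%:R :> R)).
  apply: (@le_trans _ _ (P ([set w | (B%:R < (loss (degseq (T1 n.+2 w)))%:R :> R)%R] `|`
    [set w | (B%:R < (loss (degseq (T2 n.+2 w)))%:R :> R)%R]))).
    apply: le_measure; rewrite ?inE //; first exact: measurableU.
    by move=> w /orP[h|h]; [left|right]; rewrite /= ltr_nat.
  apply: le_trans (measureU2 _ m1 m2) _.
  apply: le_trans (leeD (h1 n.+2 _ isT Bp) (h2 n.+2 _ isT Bp)) _.
  rewrite -EFinD lee_fin.
  have -> : e / 4 + B1 * growth s n.+2 / B%:R + (e / 4 + B2 * growth s n.+2 / B%:R) =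
    e / 2 + (B1 + B2) * growth s n.+2 / B%:R by field; rewrite gt_eqF.
  suff : (B1 + B2) * growth s n.+2 / B%:R <= e / 2 by lra.
  apply: le_trans hB; rewrite ler_pM2r ?invr_gt0 // ler_pM2l ?addr_gt0 //.
have nd : {homo F : n m / (n <= m)%N >-> (n <= m)%O}.
  move=> n m nm; apply/subsetPset => w.
  have inc T (TG : growing_trees P f T) :
      (loss (degseq (T n.+2 w)) <= loss (degseq (T m.+2 w)))%N.
    move: nm => /subnK <-; elim: (m - n)%N => // k IH; apply: leq_trans IH _.
    apply: (@lossT_incr (fun n => T n w) _ _ (k + n).+2) => // n' n'2.
      exact: (growing_attach TG).
    exact: (treelike_degseq TG).
  by move=> /orP[h|h]; apply/orP; [left|right]; apply: leq_trans h _; apply: inc.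
have mU : measurable (\bigcup_n F n) by exact: bigcup_measurable.
have cv := nondecreasing_cvg_mu (mu := P) mF mU nd.
rewrite -(cvg_lim _ cv) //; apply: lime_le; first by apply/cvg_ex; eexists; exact: cv.
by apply: nearW => n; exact: Fe.
Qed.

Definition stationary_defect k : set Omega :=
  \bigcup_M \bigcap_(n in [set n | (M <= n)%N])
     [set w | (n - lcs_size (T1 n w) (T2 n w))%N = k].

Lemma measurable_stationary k : measurable (stationary_defect k).
Proof.
apply: bigcupT_measurable => M; apply: bigcap_measurable => [|n _].
  by exists M => /=.
exact: (measurable_pair (fun t t' => (n - lcs_size t t')%N = k)).
Qed.

Lemma stationary_ae : 1 < s -> P (~` \bigcup_k stationary_defect k) = 0.
Proof.
move=> s1; have mU : measurable (\bigcup_k stationary_defect k).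
  by apply: bigcupT_measurable => k; exact: measurable_stationary.
have mC := measurableC mU.
apply/eqP; rewrite eq_le measure_ge0 andbT; apply/lee_addgt0Pr => e e0; rewrite add0e.
have [B hB] := losses_bounded_as s1 e0; apply: le_trans hB.
apply: le_measure; rewrite ?inE //.
  apply: bigcupT_measurable => n.
  exact: (measurable_pair (fun t t' => (B < loss (degseq t)) || (B < loss (degseq t')))%N).
move=> w /= nw; apply: contrapT => nB; apply: nw.
have small T n : (n < 2)%N -> (lossT (fun n => T n w) n <= B)%N.
  by move=> n2; rewrite /lossT /loss size_degseq; case: n n2 => [|[|]].
have big n : (2 <= n)%N -> ((loss (degseq (T1 n w)) <= B) && (loss (degseq (T2 n w)) <= B))%N.
  case: n => [|[|n]] // _; apply/negPn/negP => h; apply: nB; exists n => //=.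
  by move: h; rewrite negb_and -!ltnNge.
have [||||||||k [M hM]] := @lcs_defect_stationary (fun n => T1 n w) (fun n => T2 n w) B.
- by move=> n; exact: growing_verts T1G n w.
- by move=> n; exact: growing_verts T2G n w.
- exact: (fun n => growing_attach T1G (n := n) w).
- exact: (fun n => growing_attach T2G (n := n) w).
- exact: (fun n => treelike_degseq T1G (n := n) w).
- exact: (fun n => treelike_degseq T2G (n := n) w).
- by move=> n; have [/big/andP[]|/small] := leqP 2 n.
- by move=> n; have [/big/andP[]|/small] := leqP 2 n.
by exists k => //; exists M.
Qed.

(** The default value 0 is taken on a null set only, see [stationary_ae]. *)
Definition limit_defect (w : Omega) : nat :=
  xget 0%N [set k | stationary_defect k w].

Lemma stationary_inj j k w : stationary_defect j w -> stationary_defect k w -> j = k.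
Proof.
move=> [M _ hM] [M' _ hM'].
by rewrite -(hM (maxn M M')) ?(hM' (maxn M M')) //= ?leq_maxl ?leq_maxr.
Qed.

Lemma limit_defectE k w : stationary_defect k w -> limit_defect w = k.
Proof.
rewrite /limit_defect => hk; case: xgetP => [j _ hj|/(_ k)//].
exact: stationary_inj hj hk.
Qed.

Lemma measurable_limit_defect :
  measurable_fun [set: Omega] (fun w => (limit_defect w)%:R : R).
Proof.
have m1 k : measurable [set w | limit_defect w = k].
  have [->|k0] := eqVneq k 0%N.
    rewrite (_ : [set w | _] = stationary_defect 0 `|` ~` \bigcup_k stationary_defect k).
      apply: measurableU; first exact: measurable_stationary.
      by apply: measurableC; apply: bigcupT_measurable => j; exact: measurable_stationary.
    apply/seteqP; split => w /=.
      rewrite {1}/limit_defect; case: xgetP => [j -> hj j0|h _]; first by left; rewrite -j0.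
      by right => -[j _]; exact: h.
    case; first exact: limit_defectE.
    by rewrite /limit_defect; case: xgetP => // j _ hj []; exists j.
  rewrite (_ : [set w | _] = stationary_defect k); first exact: measurable_stationary.
  apply/seteqP; split => w /=; last exact: limit_defectE.
  by rewrite /limit_defect; case: xgetP => [j -> hj <-|_ e] //; rewrite -e eqxx in k0.
move=> _ B mB; rewrite setTI.
rewrite (_ : _ @^-1` _ = \bigcup_(k in [set k | B k%:R]) [set w | limit_defect w = k]).
  by apply: bigcup_measurable => k _.
apply/seteqP; split => [w /= h|w [k /= h e]]; first by exists (limit_defect w).
by rewrite /= e.
Qed.

Lemma defect_cvg_as : 1 < s -> exists Y : {RV P >-> R},
  {ae P, forall w, (n%:R - (lcs_size (T1 n w) (T2 n w))%:R : R) @[n --> \oo] --> Y w}.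
Proof.
move=> s1; exists (mfun_Sub (mem_set measurable_limit_defect)).
exists (~` \bigcup_k stationary_defect k); split.
- by apply: measurableC; apply: bigcupT_measurable => k; exact: measurable_stationary.
- exact: stationary_ae.
move=> w /= nc hw; apply: nc; move: (hw) => [k _ hk]; rewrite /= (limit_defectE hk).
have [M _ hM] := hk; apply: cvg_near_cst; exists M => // n /= Mn.
by rewrite -natrB ?lcs_size_le // (hM n Mn).
Qed.

End TwoTrees.

Theorem corollary7p5 (R : realType) (alpha : R) (f : nat -> R)
    (d : measure_display) (Omega : measurableType d) (P : probability Omega R)
    (T1 T2 : forall n : nat, Omega -> sgraph 'I_n)
    (X : nat -> Omega -> nat)
    (alpha_gt1 : 1 < alpha)
    (f_gt0 : forall n : nat, (0 < n)%N -> 0 < f n)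
    (f_Theta : (f : nat -> R^o) =Theta_\oo (fun n => n%:R `^ alpha : R^o))
    (T1_growing : growing_trees P f T1)
    (T2_growing : growing_trees P f T2)
    (T1T2_indep : independent_processes P T1 T2)
    (X_lcs : forall n w, X n w = lcs_size (T1 n w) (T2 n w)) :
  [/\ 2 < alpha ->
        exists Y : {RV P >-> R},
          {ae P, forall w, (n%:R - (X n w)%:R : R) @[n --> \oo] --> Y w},
      alpha = 2 ->
        tight P [set n | (2 <= n)%N]
          (fun n w => (n%:R - (X n w)%:R) / ln n%:R),
      1 < alpha < 2 ->
        tight P [set n | (1 <= n)%N]
          (fun n w => (n%:R - (X n w)%:R) * n%:R `^ (alpha - 2)) &
      exists2 eps : nat -> R,
        eps n @[n --> \oo] --> 0 &
        P [set w | (1 - eps n) * n%:R <= (X n w)%:R] @[n --> \oo] --> 1%E].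
Proof.
have XE : X = fun n w => lcs_size (T1 n w) (T2 n w).
  by apply/funext => n; apply/funext => w; exact: X_lcs.
rewrite {X_lcs}XE; have [c [C [c0 C0 fb]]] := theta_bounds f_gt0 f_Theta.
pose s := alpha - 1; have s0 : 0 < s by rewrite subr_gt0.
have sE : alpha = 1 + s by rewrite /s addrC subrK.
have f_ge n : (0 < n)%N -> c * n%:R `^ (1 + s) <= f n by rewrite -sE => /fb[].
have f_le n : (0 < n)%N -> f n <= C * n%:R `^ (1 + s) by rewrite -sE => /fb[].
have n_gt0 n : (2 <= n)%N -> 0 < n%:R :> R by move=> n2; rewrite ltr0n ltnW.
split=> [a2|a2|/andP[_ a2]|].
- have s1 : 1 < s by rewrite /s; lra.
  exact: (defect_cvg_as s0 c0 C0 f_ge f_le T1_growing T2_growing s1).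
- have s1 : s = 1 by rewrite /s a2; lra.
  have [A A0 hA] := @growth_log R.
  apply: (tight_defect s0 c0 C0 f_ge f_le T1_growing T2_growing (g := fun n => ln n%:R) A0).
  + by move=> n n2; rewrite ln_gt0 // ltr1n.
  + by move=> n n2; rewrite s1 hA.
  + by [].
  + by move=> n w /= n2; rewrite ltnNge n2.
- have s1 : 0 < s < 1 by rewrite s0 /s; lra.
  have [A A0 hA] := growth_pow s1.
  apply: (tight_defect s0 c0 C0 f_ge f_le T1_growing T2_growing
    (g := fun n => n%:R `^ (1 - s)) A0).
  + by move=> n n2; rewrite powR_gt0 // n_gt0.
  + by move=> n n2; rewrite hA // ltnW.
  + by move=> n w n2; rewrite -powRN; congr (_ * _ `^ _); rewrite /s; lra.
  + move=> n w /= n1 n2; have -> : n = 1%N by apply/eqP; rewrite eqn_leq n1 -ltnS n2.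
    rewrite powR1 mulr1 subr_ge0 lern1 lcs_size_le /=.
    by rewrite gerBl.
- exact: (defect_whp s0 c0 C0 f_ge f_le T1_growing T2_growing).
Qed.
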